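(* Let $(\mathbb{E},\langle\,,\rangle,\rho,[\,,])$ be a curved Courant algebroid over a manifold $M$ with $\mathbb{E}=TM\oplus E$ for some vector bundle $E\to M$, and let $\nabla$ be a vector bundle connection on $E$ with curvature $R_\nabla\in\Omega^2(M,\mathrm{End}\,E)$. The Courant algebroid lift $(TE,g_\nabla,\rho_\nabla,[\,,]_\nabla)$ of $(\mathbb{E},\langle\,,\rangle,\rho,[\,,])$ by $\nabla$ is a Courant algebroid if and only if $R_\nabla(\rho(a),\rho(b))=0$ for all $a,b\in\Gamma(\mathbb{E})$ and $(\mathbb{E},\langle\,,\rangle,\rho,[\,,])$ is a Courant algebroid.
   Context: Everything is smooth. A tuple $(\mathbb{E},\langle\,,\rangle,\rho,[\,,])$ over $M$ consists of a vector bundle $\mathbb{E}\to M$, a non-degenerate symmetric pairing $\langle\,,\rangle\in\Gamma(\mathrm{Sym}^2\mathbb{E}^* )$, a vector bundle morphism $\rho:\mathbb{E}\to TM$ over $\mathrm{id}_M$ (the anchor), and an $\mathbb{R}$-bilinear bracket on $\Gamma(\mathbb{E})$. Define $\rho^*:T^*M\to\mathbb{E}$ by $\langle\rho^*\alpha,b\rangle=\alpha(\rho(b))$. Properties (for $a,b,c\in\Gamma(\mathbb{E})$, $f\in C^\infty(M)$): (Ca1) $[a,b]+[b,a]=\rho^*d\langle a,b\rangle$; (Ca2) $\rho(a)\langle b,c\rangle=\langle[a,b],c\rangle+\langle b,[a,c]\rangle$; (Ca3) $[a,[b,c]]=[[a,b],c]+[b,[a,c]]$; (Ca4) $[a,fb]=(\rho(a)f)b+f[a,b]$;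 (Ca5) $[fa,b]=-(\rho(b)f)a+f[a,b]+\langle a,b\rangle\rho^*df$. A metric algebroid satisfies (Ca1), (Ca2) (hence (Ca4), (Ca5) hold automatically). A Courant algebroid satisfies (Ca1)–(Ca3). With $F(a,b):=\rho([a,b])-[\rho(a),\rho(b)]_{\mathrm{Lie}}$, a curved Courant algebroid is a metric algebroid for which $F\in\Gamma(\wedge^2\mathbb{E}^*\otimes TM)$ and $F(a,b)=0$ whenever $a\in\ker\rho$ (pointwise). Courant algebroid lift: let $\mathbb{E}=TM\oplus E$ with $\mathrm{pr}:E\to M$ a vector bundle, the tuple satisfying (Ca4) and (Ca5), and $\nabla$ a connection on $E$. For $X\in\mathfrak{X}(M)$ let $X^{h}\in\mathfrak{X}(E)$ be its horizontal lift with respect to $\nabla$; for $\varphi\in\Gamma(E)$ let $\varphi^{v}\in\mathfrak{X}(E)$ be its vertical lift, $\varphi^v_q=\frac{d}{dt}|_{t=0}(q+t\varphi_{\mathrm{pr}(q)})$. Set $\phi:\Gamma(\mathbb{E})\to\mathfrak{X}(E)$, $\phi(X+\varphi)=X^h+\varphi^v$; its image locally generates $\mathfrak{X}(E)$. The lift is the tuple $(TE,g_\nabla,\rho_\nabla,[\,,]_\nabla)$ over the manifold $E$, where $g_\nabla$ is the unique pairing on $TE$ with $g_\nabla(\phi a,\phi b)=\mathrm{pr}^*\langle a,b\rangle$, $\rho_\nabla:TE\to TE$ is the unique vector bundle endomorphism with $\rho_\nabla(\phi a)=\phi(\rho(a))=\rho(a)^h$, and $[\,,]_\nabla$ is the unique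 bracket on $\mathfrak{X}(E)$ with $[\phi a,\phi b]_\nabla=\phi[a,b]$ such that $(TE,g_\nabla,\rho_\nabla,[\,,]_\nabla)$ satisfies (Ca4) and (Ca5). *)

(* Defs.v *)
From HB Require Import structures.
From mathcomp Require Import all_boot all_order all_algebra.
From mathcomp Require Import boolp classical_sets functions reals.
From mathcomp Require Import topology normedtype landau derive.
From mathcomp Require Import ring.

Set Implicit Arguments.
Unset Strict Implicit.
Unset Printing Implicit Defensive.

Import Order.TTheory GRing.Theory Num.Theory.
Import numFieldNormedType.Exports.

Local Open Scope classical_set_scope.
Local Open Scope ring_scope.

Section SmoothOn.
Context (R : realType) (n : nat).
Implicit Types (U : set 'rV[R]_n) (f g : 'rV[R]_n -> R) (k : nat).

Fixpoint class_C k U f : Prop :=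
  match k with
  | 0 => forall x, U x -> {for x, continuous f}
  | k'.+1 => (forall x, U x -> differentiable f x) /\
             (forall v, class_C k' U (fun x => 'D_v f x))
  end.

Definition smooth_on U f : Prop := forall k, class_C k U f.

Lemma near_eq_differentiable f g x : {near x, f =1 g} ->
  differentiable f x -> differentiable g x.
Proof.
move=> fg df.
have fgx : f x = g x by exact: nbhs_singleton fg.
have cdf : continuous ('d f x) by exact: diff_continuous.
have eg : g \o shift x = cst (g x) + 'd f x +o_ 0 id.
  apply/eqaddoP => e e0; have /diff_locally/eqaddoP/(_ _ e0) := df.
  move: (fg); rewrite (near_shift 0 x) subr0 => fg0; apply: filterS2 fg0.
  by move=> y /=; rewrite !fctE /= => -> ; rewrite fgx.
have dgE := diff_unique cdf eg.
by apply/diff_locallyP; rewrite dgE.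
Qed.

Lemma class_C_eq k U f g : open U -> (forall x, U x -> f x = g x) ->
  class_C k U f -> class_C k U g.
Proof.
move=> oU; elim: k f g => [|k IH] f g fg /=; have nfg x : U x -> {near x, f =1 g}
  by move=> Ux; apply: filterS (open_nbhs_nbhs (conj oU Ux)) => y Uy; exact: fg.
  move=> cf x Ux; rewrite /prop_for /continuous_at -(fg x Ux).
  by apply: cvg_trans (cf x Ux); apply: (@near_eq_cvg _ _ (nbhs x) (nbhs_filter x) _ _ (nfg x Ux)).
move=> [df Df]; split=> [x Ux|v].
  exact: near_eq_differentiable (nfg _ Ux) (df x Ux).
apply: IH (Df v) => x Ux.
by apply: near_eq_derive; exact: nfg.
Qed.

Lemma smooth_on_eq U f g : open U -> (forall x, U x -> f x = g x) ->
  smooth_on U f -> smooth_on U g.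
Proof. by move=> oU fg sf k; exact: class_C_eq fg (sf k). Qed.

Lemma class_CW k U f : class_C k.+1 U f -> class_C k U f.
Proof.
elim: k f => [|k IH] f /= [df Df]; first by
  move=> x Ux; exact: differentiable_continuous (df x Ux).
by split=> // v; apply: IH; exact: Df.
Qed.

Lemma class_C_cst k U (a : R) : class_C k U (fun=> a).
Proof.
elim: k a => [|k IH] a; first by move=> x _; exact: cst_continuous.
split=> [x _|v]; first exact: differentiable_cst.
have -> : (fun x : 'rV[R]_n => 'D_v (fun=> a) x) = (fun=> 0).
  by apply/funext => x; exact: derive_cst.
exact: IH.
Qed.

Lemma class_CD k U f g : open U ->
  class_C k U f -> class_C k U g -> class_C k U (fun x => f x + g x).
Proof.
move=> oU; elim: k f g => [|k IH] f g.
  by move=> cf cg x Ux; exact: cvgD (cf x Ux) (cg x Ux).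
move=> [df Df] [dg Dg]; split=> [x Ux|v].
  exact: differentiableD (df x Ux) (dg x Ux).
apply: class_C_eq (IH _ _ (Df v) (Dg v)) => // x Ux.
by rewrite deriveD //; apply: diff_derivable; [exact: df|exact: dg].
Qed.

Lemma class_CM k U f g : open U ->
  class_C k U f -> class_C k U g -> class_C k U (fun x => f x * g x).
Proof.
move=> oU; elim: k f g => [|k IH] f g.
  by move=> cf cg x Ux; exact: cvgM (cf x Ux) (cg x Ux).
move=> Cf Cg; have [df Df] := Cf; have [dg Dg] := Cg; split=> [x Ux|v].
  exact: differentiableM (df x Ux) (dg x Ux).
have := class_CD oU (IH _ _ (class_CW Cf) (Dg v)) (IH _ _ (class_CW Cg) (Df v)).
apply: class_C_eq => // x Ux.
by rewrite deriveM //; apply: diff_derivable; [exact: df|exact: dg].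
Qed.

Lemma smooth_on_cst U (a : R) : smooth_on U (fun=> a).
Proof. by move=> k; exact: class_C_cst. Qed.

Lemma smooth_onD U f g : open U ->
  smooth_on U f -> smooth_on U g -> smooth_on U (fun x => f x + g x).
Proof. by move=> oU sf sg k; exact: class_CD. Qed.

Lemma smooth_onM U f g : open U ->
  smooth_on U f -> smooth_on U g -> smooth_on U (fun x => f x * g x).
Proof. by move=> oU sf sg k; exact: class_CM. Qed.

End SmoothOn.

Section Manifolds.
Context (R : realType).

(* [icoord] is a total extension of the inverse of [coord] on [dom]; only its
   values on [coord @` dom] are meaningful. *)
Record chart (n : nat) (T : Type) := Chart {
  dom : set T;
  coord : T -> 'rV[R]_n;
  icoord : 'rV[R]_n -> T
}.

Section Atlas.
Context (n : nat) (T : Type).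
Implicit Types c d : chart n T.

Definition is_chart c : Prop :=
  open (coord c @` dom c) /\ forall p, dom c p -> icoord c (coord c p) = p.

Definition smooth_transition c d : Prop :=
  let U := coord c @` (dom c `&` dom d) in
  open U /\ forall j, smooth_on U (fun z => coord d (icoord c z) 0 j).

Definition compatible c d : Prop :=
  smooth_transition c d /\ smooth_transition d c.

Definition atlas_open (atl : set (chart n T)) (A : set T) : Prop :=
  forall c, atl c -> open (coord c @` (dom c `&` A)).

Record smooth_structure := SmoothStructure {
  atlas : set (chart n T);
  atlas_chart : forall c, atlas c -> is_chart c;
  atlas_cover : forall p, exists2 c, atlas c & dom c p;
  atlas_compatible : forall c d, atlas c -> atlas d -> compatible c d;
  atlas_maximal : forall c, is_chart c ->
    (forall d, atlas d -> compatible c d) -> atlas c;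
  atlas_hausdorff : forall p q, p <> q -> exists A B : set T,
    [/\ atlas_open atlas A, atlas_open atlas B, A p, B q & A `&` B = set0];
  atlas_second_countable : exists B : nat -> set T,
    (forall i, atlas_open atlas (B i)) /\
    (forall A p, atlas_open atlas A -> A p -> exists2 i, B i p & B i `<=` A)
}.

End Atlas.

Record manifold (n : nat) := Manifold {
  carrier :> Type;
  structure : smooth_structure n carrier
}.

Definition charts n (M : manifold n) : set (chart n M) := atlas (structure M).
Arguments charts {n} M _.

Section SmoothFunctions.
Context (n : nat) (M : manifold n).

Definition smooth (f : M -> R) : Prop :=
  forall c, charts M c -> smooth_on (coord c @` dom c) (f \o icoord c).

Definition smooth_pred : {pred M -> R} := fun f => `[< smooth f >].

Lemma smooth_cst (a : R) : smooth (fun=> a).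
Proof. by move=> c _; exact: smooth_on_cst. Qed.

Lemma open_chart c : charts M c -> open (coord c @` dom c).
Proof. by case/atlas_chart. Qed.

Lemma smoothD f g : smooth f -> smooth g -> smooth (fun p => f p + g p).
Proof.
move=> sf sg c Mc.
exact: smooth_onD (open_chart Mc) (sf _ Mc) (sg _ Mc).
Qed.

Lemma smoothM f g : smooth f -> smooth g -> smooth (fun p => f p * g p).
Proof.
move=> sf sg c Mc.
exact: smooth_onM (open_chart Mc) (sf _ Mc) (sg _ Mc).
Qed.

Lemma smoothZ (k : R) f : smooth f -> smooth (fun p => k * f p).
Proof. by move=> sf; exact: smoothM (smooth_cst k) sf. Qed.

Lemma smooth_pred_subring : subring_closed smooth_pred.
Proof.
split=> [|f g /asboolP sf /asboolP sg|f g /asboolP sf /asboolP sg];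
  apply/asboolP.
- exact: (smooth_cst 1).
- have -> : f - g = (fun p => f p + (-1) * g p).
    by apply/funext => p; rewrite mulN1r.
  by apply: smoothD => //; exact: smoothZ.
- exact: smoothM.
Qed.

HB.instance Definition _ :=
  GRing.isSubringClosed.Build (M -> R) smooth_pred smooth_pred_subring.

Record Cinf := MkCinf { Cinf_val :> M -> R; Cinf_in : Cinf_val \in smooth_pred }.

HB.instance Definition _ := [isSub for Cinf_val].
HB.instance Definition _ := [Choice of Cinf by <:].
HB.instance Definition _ := GRing.SubChoice_isSubComPzRing.Build
  (M -> R) smooth_pred Cinf (subringClosedP _).

Lemma Cinf_smooth (f : Cinf) : smooth f.
Proof. exact/asboolP/Cinf_in. Qed.

Definition mkCinf f (sf : smooth f) : Cinf := MkCinf (asboolT sf).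

Lemma CinfP (f g : Cinf) : (forall p, f p = g p) -> f = g.
Proof. by move=> fg; apply: val_inj; apply/funext. Qed.

Definition cst_Cinf (k : R) : Cinf := mkCinf (smooth_cst k).

Fact scale_CinfA (a b : R) (f : Cinf) :
  cst_Cinf a * (cst_Cinf b * f) = cst_Cinf (a * b) * f.
Proof. by apply: CinfP => p /=; rewrite mulrA. Qed.
Fact scale_Cinf1 : left_id (1 : R) (fun k (f : Cinf) => cst_Cinf k * f).
Proof. by move=> f; apply: CinfP => p /=; rewrite mul1r. Qed.
Fact scale_CinfDr : right_distributive (fun k (f : Cinf) => cst_Cinf k * f) +%R.
Proof. by move=> k f g; rewrite mulrDr. Qed.
Fact scale_CinfDl (f : Cinf) : {morph (fun k => cst_Cinf k * f) : a b / a + b}.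
Proof. by move=> a b; apply: CinfP => p /=; rewrite mulrDl. Qed.

HB.instance Definition _ := GRing.Zmodule_isLmodule.Build R Cinf
  scale_CinfA scale_Cinf1 scale_CinfDr scale_CinfDl.

(* Tangent vectors at [p] are the point derivations of C^oo(M) at [p]. *)
Definition derivation_at (p : M) (v : Cinf -> R^o) : Prop :=
  linear v /\ forall f g, v (f * g) = f p * v g + g p * v f.

Definition tangent_pred (p : M) : {pred Cinf -> R^o} :=
  fun v => `[< derivation_at p v >].

Lemma tangent_pred_submod p : submod_closed (tangent_pred p).
Proof.
split=> [|a u v /asboolP[uZ uM] /asboolP[vZ vM]]; apply/asboolP; split.
- by move=> k f g; rewrite /= scaler0 addr0.
- by move=> f g; rewrite /= [0 g]/(0 : R) [0 f]/(0 : R) !mulr0 addr0.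
- have E x : (a *: u + v) x = a * u x + v x by [].
  move=> k f g; rewrite !E uZ vZ /GRing.scale /= !mulrDr addrACA.
  by congr (_ + _ + _); rewrite mulrCA.
- have E x : (a *: u + v) x = a * u x + v x by [].
  move=> f g; rewrite !E uM vM !mulrDr addrACA.
  by congr (_ + _ + (_ + _)); rewrite mulrCA.
Qed.

HB.instance Definition _ p := GRing.isSubmodClosed.Build R (Cinf -> R^o)
  (tangent_pred p) (tangent_pred_submod p).

Record tangent (p : M) := MkTangent {
  tangent_val :> Cinf -> R^o; tangent_in : tangent_val \in tangent_pred p }.

HB.instance Definition _ p := [isSub for @tangent_val p].
HB.instance Definition _ p := [Choice of tangent p by <:].
HB.instance Definition _ p := [SubChoice_isSubLmodule of tangent p by <:].

Lemma tangent_derivation p (v : tangent p) : derivation_at p v.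
Proof. exact/asboolP/tangent_in. Qed.

Definition mkTangent p v (dv : derivation_at p v) : tangent p :=
  MkTangent (asboolT dv).

Lemma tangentP p (u v : tangent p) : (forall f, u f = v f) -> u = v.
Proof. by move=> uv; apply: val_inj; apply/funext. Qed.

(* A family of vector spaces over M together with its C^oo(M)-module of smooth
   sections: the common language for TM, E and TM (+) E. Local triviality is not
   recorded here; it is part of [vector_bundle] below, and automatic for TM. *)
Record sbundle := SBundle {
  fiber :> M -> lmodType R;
  smooth_section : (forall p, fiber p) -> Prop;
  smooth_section0 : smooth_section (fun=> 0);
  smooth_sectionP : forall (f : Cinf) s t, smooth_section s ->
    smooth_section t -> smooth_section (fun p => f p *: s p + t p)
}.

Record sections (B : sbundle) := MkSection {
  section_val :> forall p, B p;
  section_smooth : smooth_section section_val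
}.

Section SectionModule.
Context (B : sbundle).
Implicit Types s t u : sections B.

Lemma sectionP s t : (forall p, s p = t p) -> s = t.
Proof.
case: s t => [s ss] [t st] /= st'.
have E : s = t by exact: functional_extensionality_dep.
by case: _ / E st st' => st _; congr MkSection; exact: Prop_irrelevance.
Qed.

HB.instance Definition _ := gen_eqMixin (sections B).
HB.instance Definition _ := gen_choiceMixin (sections B).

Lemma smooth_sectionD s t : smooth_section (fun p => s p + t p).
Proof.
have := smooth_sectionP (cst_Cinf 1) (section_smooth s) (section_smooth t).
by congr smooth_section; apply: functional_extensionality_dep => p /=; rewrite scale1r.
Qed.

Lemma smooth_sectionZ (f : Cinf) s : smooth_section (fun p => f p *: s p).
Proof.
have := smooth_sectionP f (section_smooth s) (smooth_section0 B).
by congr smooth_section; apply: functional_extensionality_dep => p; rewrite addr0.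
Qed.

Definition add_section s t : sections B := MkSection (smooth_sectionD s t).
Definition zero_section : sections B := MkSection (smooth_section0 B).

(* The action of C^oo(M); the [lmodType R] structure is its restriction to
   constants. *)
Definition mul_section (f : Cinf) s : sections B :=
  MkSection (smooth_sectionZ f s).

Definition opp_section s : sections B := mul_section (cst_Cinf (-1)) s.

Fact add_sectionA : associative add_section.
Proof. by move=> s t u; apply: sectionP => p /=; rewrite addrA. Qed.
Fact add_sectionC : commutative add_section.
Proof. by move=> s t; apply: sectionP => p /=; rewrite addrC. Qed.
Fact add_section0 : left_id zero_section add_section.
Proof. by move=> s; apply: sectionP => p /=; rewrite add0r. Qed.
Fact add_sectionN : left_inverse zero_section opp_section add_section.
Proof. by move=> s; apply: sectionP => p /=; rewrite scaleN1r addNr. Qed.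

HB.instance Definition _ := GRing.isZmodule.Build (sections B)
  add_sectionA add_sectionC add_section0 add_sectionN.

Definition scale_section (k : R) s : sections B := mul_section (cst_Cinf k) s.

Fact scale_sectionA (a b : R) s :
  scale_section a (scale_section b s) = scale_section (a * b) s.
Proof. by apply: sectionP => p /=; rewrite scalerA. Qed.
Fact scale_section1 : left_id 1 scale_section.
Proof. by move=> s; apply: sectionP => p /=; rewrite scale1r. Qed.
Fact scale_sectionDr : right_distributive scale_section +%R.
Proof. by move=> k s t; apply: sectionP => p /=; rewrite scalerDr. Qed.
Fact scale_sectionDl s : {morph scale_section^~ s : a b / a + b}.
Proof. by move=> a b; apply: sectionP => p /=; rewrite scalerDl. Qed.

HB.instance Definition _ := GRing.Zmodule_isLmodule.Build R (sections B)
  scale_sectionA scale_section1 scale_sectionDr scale_sectionDl.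

End SectionModule.

Definition smooth_vector_field (X : forall p, tangent p) : Prop :=
  forall f : Cinf, smooth (fun p => X p f : R).

Lemma smooth_vector_field0 : smooth_vector_field (fun=> 0).
Proof. by move=> f; exact: (smooth_cst 0). Qed.

Lemma smooth_vector_fieldP (f : Cinf) X Y : smooth_vector_field X ->
  smooth_vector_field Y -> smooth_vector_field (fun p => f p *: X p + Y p).
Proof.
by move=> sX sY g; apply: smoothD (sY g); apply: smoothM (sX g); exact: Cinf_smooth.
Qed.

Definition TM : sbundle := SBundle smooth_vector_field0 smooth_vector_fieldP.

Definition vector_field := sections TM.

Definition act (X : vector_field) (f : Cinf) : Cinf :=
  mkCinf (section_smooth X f).

Lemma lie_derivation (X Y : vector_field) p :
  derivation_at p (fun f => X p (act Y f) - Y p (act X f)).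
Proof.
have actZ (Z : vector_field) k f g : act Z (k *: f + g) = k *: act Z f + act Z g.
  by apply: CinfP => q /=; have [-> _] := tangent_derivation (Z q).
have actM (Z : vector_field) f g : act Z (f * g) = f * act Z g + g * act Z f.
  by apply: CinfP => q /=; have [_ ->] := tangent_derivation (Z q).
have [XZ XM] := tangent_derivation (X p).
have [YZ YM] := tangent_derivation (Y p).
have XD u v : X p (u + v) = X p u + X p v by have := XZ 1 u v; rewrite !scale1r.
have YD u v : Y p (u + v) = Y p u + Y p v by have := YZ 1 u v; rewrite !scale1r.
split=> [k f g|f g].
  by rewrite !actZ XZ YZ opprD addrACA -scalerBr.
rewrite !actM XD YD !XM !YM /=; ring.
Qed.

Definition lie_at (X Y : vector_field) p : tangent p :=
  mkTangent (lie_derivation X Y p).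

Lemma lie_smooth X Y : smooth_vector_field (lie_at X Y).
Proof.
move=> f.
suff -> : (fun p => lie_at X Y p f : R) = (act X (act Y f) - act Y (act X f) : Cinf).
  exact: Cinf_smooth.
by [].
Qed.

Definition lie (X Y : vector_field) : vector_field := @MkSection TM _ (lie_smooth X Y).

Section WhitneySum.
Variables B C : sbundle.

Definition smooth_pair (s : forall p, (B p * C p)%type) : Prop :=
  smooth_section (fun p => (s p).1) /\ smooth_section (fun p => (s p).2).

Lemma smooth_pair0 : smooth_pair (fun=> 0).
Proof. by split; exact: smooth_section0. Qed.

Lemma smooth_pairP (f : Cinf) s t : smooth_pair s -> smooth_pair t ->
  smooth_pair (fun p => f p *: s p + t p).
Proof. by move=> [s1 s2] [t1 t2]; split; exact: smooth_sectionP. Qed.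

Definition whitney_sum : sbundle :=
  @SBundle (fun p => (B p * C p)%type) smooth_pair smooth_pair0 smooth_pairP.

Definition fst_section (s : sections whitney_sum) : sections B :=
  MkSection (section_smooth s).1.
Definition snd_section (s : sections whitney_sum) : sections C :=
  MkSection (section_smooth s).2.

End WhitneySum.

Lemma differential_linear (f : Cinf) p : linear (fun v : tangent p => v f : R^o).
Proof. by []. Qed.

Definition differential (f : Cinf) p (v : tangent p) : R^o := v f.

HB.instance Definition _ (f : Cinf) p :=
  GRing.isLinear.Build R (tangent p) R^o *:%R (@differential f p)
    (differential_linear f (p := p)).

End SmoothFunctions.

Arguments Cinf {n} M.
Arguments tangent {n M} p.
Arguments TM {n} M.
Arguments vector_field {n} M.
Arguments sbundle {n} M.
Arguments differential {n M} f p.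

Section VectorBundles.
Context (n : nat) (M : manifold n) (r : nat).

(* The chart of the total space induced by a chart of the base and a fibrewise
   trivialization [t] with inverse [t']. *)
Definition bundle_chart (F : M -> lmodType R) (c : chart n M)
    (t : forall m, F m -> 'rV[R]_r) (t' : forall m, 'rV[R]_r -> F m) :
    chart (n + r) {m : M & F m} :=
  Chart [set q | dom c (projT1 q)]
    (fun q => row_mx (coord c (projT1 q)) (t (projT1 q) (projT2 q)))
    (fun z => existT (fun m => F m) (icoord c (lsubmx z))
                (t' (icoord c (lsubmx z)) (rsubmx z))).

Definition local_trivialization (F : M -> lmodType R)
    (S : smooth_structure (n + r) {m : M & F m}) (c : chart n M)
    (t : forall m, F m -> 'rV[R]_r) (t' : forall m, 'rV[R]_r -> F m) : Prop :=
  [/\ charts M c,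
      forall m, dom c m -> [/\ linear (t m), cancel (t m) (t' m)
                              & cancel (t' m) (t m)] &
      atlas S (bundle_chart c t t')].

Record vector_bundle := VectorBundle {
  vfiber : M -> lmodType R;
  total_structure : smooth_structure (n + r) {m : M & vfiber m};
  locally_trivial : forall m, exists c t t',
    local_trivialization total_structure c t t' /\ dom c m
}.

Context (E : vector_bundle).

Definition total_space : manifold (n + r) := Manifold (total_structure E).

Definition smooth_vsection (s : forall m, vfiber E m) : Prop :=
  forall c t t', local_trivialization (total_structure E) c t t' ->
  forall j, smooth_on (coord c @` dom c)
              (fun z => t (icoord c z) (s (icoord c z)) 0 j).

Lemma smooth_vsection0 : smooth_vsection (fun=> 0).
Proof.
move=> c t t' [Mc tl _] j.
apply: smooth_on_eq (smooth_on_cst _ 0); first exact: open_chart.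
move=> _ [p cp <-]; have [_ cK] := atlas_chart Mc; rewrite cK //.
have [tL _ _] := tl _ cp.
have := tL (-1) 0 0; rewrite scaler0 addr0 scaleN1r addNr => ->.
by rewrite mxE.
Qed.

Lemma smooth_vsectionP (f : Cinf M) s u : smooth_vsection s ->
  smooth_vsection u -> smooth_vsection (fun m => f m *: s m + u m).
Proof.
move=> ss su c t t' lt j; have [Mc tl _] := lt.
have oc := open_chart Mc.
apply: smooth_on_eq (smooth_onD oc
  (smooth_onM oc (Cinf_smooth f Mc) (ss _ _ _ lt j)) (su _ _ _ lt j)) => //.
move=> _ [p cp <-] /=; have [_ cK] := atlas_chart Mc; rewrite cK //.
by have [tL _ _] := tl _ cp; rewrite tL !mxE.
Qed.

Definition vsbundle : sbundle M := SBundle smooth_vsection0 smooth_vsectionP.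

Record connection := Connection {
  nabla :> vector_field M -> sections vsbundle -> sections vsbundle;
  connectionXl : forall (f : Cinf M) X Y s,
    nabla (mul_section f X + Y) s = mul_section f (nabla X s) + nabla Y s;
  connectionDr : forall X s u, nabla X (s + u) = nabla X s + nabla X u;
  connectionMr : forall X (f : Cinf M) s,
    nabla X (mul_section f s) = mul_section (act X f) s + mul_section f (nabla X s)
}.

Definition curvature (D : connection) (X Y : vector_field M)
    (s : sections vsbundle) : sections vsbundle :=
  D X (D Y s) - D Y (D X s) - D (lie X Y) s.

Definition is_vertical_lift (s : sections vsbundle)
    (V : vector_field total_space) : Prop :=
  forall m (e : vfiber E m) (f : Cinf total_space),
    V (existT _ m e) f =
    derive1 (fun t : R => f (existT _ m (e + t *: s m)) : R^o) 0.

(* The horizontal lift at [s m] is the image of [X m] under the differential of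
   any section [s] that is parallel at [m]; [g] is the pull-back of [f] by [s]. *)
Definition is_horizontal_lift (D : connection) (X : vector_field M)
    (V : vector_field total_space) : Prop :=
  forall m (s : sections vsbundle), (forall Y, D Y s m = 0) ->
  forall (f : Cinf total_space) (g : Cinf M),
    (forall m', g m' = f (existT _ m' (s m'))) -> V (existT _ m (s m)) f = X m g.

(* Both lifts exist and are unique, so the default value 0 is never used. *)
Definition vertical_lift (s : sections vsbundle) : vector_field total_space :=
  xget 0 [set V | is_vertical_lift s V].

Definition horizontal_lift (D : connection) (X : vector_field M) :
    vector_field total_space :=
  xget 0 [set V | is_horizontal_lift D X V].

End VectorBundles.

Section Algebroids.
Context (n : nat) (M : manifold n) (B : sbundle M).

Record pairing := Pairing {
  pair_at :> forall p, B p -> B p -> R;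
  pair_linear : forall p (x : B p), linear (pair_at x : B p -> R^o);
  pair_sym : forall p (x y : B p), pair_at x y = pair_at y x;
  pair_nondegenerate : forall p (x : B p), (forall y, pair_at x y = 0) -> x = 0;
  pair_smooth : forall a b : sections B, smooth (fun p => pair_at (a p) (b p))
}.

Record anchor := Anchor {
  anchor_at :> forall p, {linear B p -> tangent p};
  anchor_smooth : forall a : sections B,
    smooth_vector_field (fun p => anchor_at p (a p))
}.

Record algebroid := Algebroid {
  metric : pairing;
  rho : anchor;
  bracket : sections B -> sections B -> sections B;
  bracket_linearl : forall b, linear (bracket^~ b);
  bracket_linearr : forall a, linear (bracket a)
}.

Context (A : algebroid).

Definition pair_sections (a b : sections B) : Cinf M :=
  mkCinf (pair_smooth (metric A) a b).

Definition rho_section (a : sections B) : vector_field M :=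
  @MkSection _ _ (TM M) _ (anchor_smooth (rho A) a).

(* For the finite-rank bundles TM (+) E and TM such an [x] exists and is unique, by
   non-degeneracy of the pairing. *)
Definition rho_dual p (alpha : {linear tangent p -> R^o}) : B p :=
  xget 0 [set x | forall y, metric A p x y = alpha (rho A p y)].

Local Notation "<| a , b |>" := (pair_sections a b).
Local Notation "[| a , b |]" := (bracket A a b).
Local Notation d f p := (differential f p : {linear tangent p -> R^o}).

Definition Ca1 : Prop := forall a b p,
  [| a, b |] p + [| b, a |] p = rho_dual (d <| a, b |> p).

Definition Ca2 : Prop := forall a b c,
  act (rho_section a) <| b, c |> = <| [| a, b |], c |> + <| b, [| a, c |] |>.

Definition Ca3 : Prop := forall a b c,
  [| a, [| b, c |] |] = [| [| a, b |], c |] + [| b, [| a, c |] |].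

Definition Ca4 : Prop := forall a b (f : Cinf M),
  [| a, mul_section f b |] =
  mul_section (act (rho_section a) f) b + mul_section f [| a, b |].

Definition Ca5 : Prop := forall a b (f : Cinf M) p,
  [| mul_section f a, b |] p =
  - (act (rho_section b) f p *: a p) + f p *: [| a, b |] p
  + <| a, b |> p *: rho_dual (d f p).

Definition metric_algebroid : Prop := Ca1 /\ Ca2.

Definition courant_algebroid : Prop := [/\ Ca1, Ca2 & Ca3].

Definition anchor_defect (a b : sections B) : vector_field M :=
  rho_section [| a, b |] - lie (rho_section a) (rho_section b).

(* [Phi] is [anchor_defect] as a section of wedge^2 B^* (x) TM; it is smooth because
   [anchor_defect] takes values in smooth vector fields. *)
Definition curved_courant_algebroid : Prop :=
  metric_algebroid /\
  exists Phi : forall p, B p -> B p -> tangent p,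
    [/\ forall p x, linear (Phi p x), forall p y, linear ((Phi p)^~ y),
        forall p x, Phi p x x = 0,
        forall a b p, anchor_defect a b p = Phi p (a p) (b p) &
        forall p x y, rho A p x = 0 -> Phi p x y = 0].

End Algebroids.

Section CourantLift.
Context (n : nat) (M : manifold n) (r : nat) (E : vector_bundle M r).
Context (D : connection E).

Definition lift_section (a : sections (whitney_sum (TM M) (vsbundle E))) :
    vector_field (total_space E) :=
  horizontal_lift D (fst_section a) + vertical_lift (snd_section a).

Definition is_courant_lift
    (A : algebroid (whitney_sum (TM M) (vsbundle E)))
    (L : algebroid (TM (total_space E))) : Prop :=
  [/\ forall a b q,
        metric L q (lift_section a q) (lift_section b q) =
        pair_sections A a b (projT1 q),
      forall a, rho_section L (lift_section a) =
        horizontal_lift D (rho_section A a),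
      forall a b, bracket L (lift_section a) (lift_section b) =
        lift_section (bracket A a b),
      Ca4 L & Ca5 L].

End CourantLift.
End Manifolds.

(* Main.v *)
From HB Require Import structures.
From mathcomp Require Import all_boot all_order all_algebra.
From mathcomp Require Import boolp classical_sets functions reals.
From mathcomp Require Import topology normedtype landau derive realfun.
From mathcomp Require Import sequences exp ereal measure lebesgue_measure.
From mathcomp Require Import lebesgue_integral ftc.
From mathcomp Require Import ring lra.
Require Import Defs.

Set Implicit Arguments.
Unset Strict Implicit.
Unset Printing Implicit Defensive.

Import Order.TTheory GRing.Theory Num.Theory.
Import numFieldNormedType.Exports.

Local Open Scope classical_set_scope.
Local Open Scope ring_scope.

(** Why the theorem holds. The lifts of the sections of TM (+) E span the
    tangent spaces of the total space of E, and locally they generate its vector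
    fields over the smooth functions ([lift_generate]). Hence an identity that is
    linear over smooth functions in each argument holds for the lifted algebroid
    [L] as soon as it holds on lifts ([tensorial_lift0]), where it is the lift of
    the identity for [A]. This settles (Ca1) and (Ca2) for [L].

    The Jacobiator J is tied to the anchor defect F (a, b) = rho [a, b] -
    [rho a, rho b]: by the Leibniz rule, J (a, b, f c) = f J (a, b, c) -
    (F (a, b) f) c ([jacobiatorMr]). So F vanishes in a Courant algebroid of the
    kind considered here ([courant_anchor_morphism_TM],
    [courant_anchor_morphism_TE]). On lifts, the formula
    [X^h, Z^h] = [X, Z]^h - (R (X, Z) q)^v at a point q ([lie_hlift]) shows that
    the defect of [L] has the defect of [A] as horizontal part and
    R (rho a, rho b) q as vertical part ([anchor_defect_lift]).

    If [L] is Courant, its defect vanishes, hence so does R (rho a, rho b); and J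
    vanishes for [A] because the lift is injective and J is compatible with it.

    Conversely, if [A] is Courant and R (rho a, rho b) = 0, then the defect of [L]
    vanishes on lifts. It is linear over smooth functions in its second argument,
    and its two arguments may be exchanged up to the anchor of rho^* d<x, y>,
    which is zero for [A] ([rho_rho_dual]) and then for [L]
    ([lifted_rho_rho_dual]). So the defect of [L] is zero
    ([lifted_anchor_morphism]); this makes its Jacobiator antisymmetric in the
    first two arguments and linear over smooth functions, and it vanishes on
    lifts ([lifted_jacobi]).

    Tangent vectors being derivations, the geometric input rests on bump functions
    ([bump]) and on Hadamard's lemma ([hadamard]), by which a tangent vector is
    determined by its values on coordinates ([tangent_coord]), and on the total
    space by its values on base functions and fibre coordinates
    ([tangent_total_ext]). By this test the differential of a section [s] of E
    sends [X] to X^h + (nabla_X s)^v ([push_split]). Since through every point of E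
    there is a section parallel at that point ([parallel_through]), this gives
    the existence and uniqueness of horizontal lifts and their Lie bracket. *)

(** * Calculus of smooth functions on row vectors *)

Section SmoothCalculus.
Context {R : realType}.

Lemma class_CS n (U V : set 'rV[R]_n) k f : V `<=` U ->
  class_C k U f -> class_C k V f.
Proof.
move=> VU; elim: k f => [|k IH] f /=; first by move=> cf x /VU; exact: cf.
by move=> [df Df]; split=> [x /VU|v]; [exact: df|exact: IH].
Qed.

Lemma smooth_onS n (U V : set 'rV[R]_n) f : V `<=` U ->
  smooth_on U f -> smooth_on V f.
Proof. by move=> VU sf k; exact: class_CS VU (sf k). Qed.

Lemma class_C_local n (U : set 'rV[R]_n) k f :
  (forall x, U x -> exists2 V, V x & class_C k V f) -> class_C k U f.
Proof.
elim: k f => [|k IH] f loc.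
  by move=> x /loc[V Vx cf]; exact: cf.
split=> [x /loc[V Vx [df _]]|v]; first exact: df.
by apply: IH => x /loc[V Vx [_ Df]]; exists V => //; exact: Df.
Qed.

Lemma smooth_on_local n (U : set 'rV[R]_n) f :
  (forall x, U x -> exists2 V, V x & smooth_on V f) -> smooth_on U f.
Proof.
move=> loc k; apply: class_C_local => x /loc[V Vx sf].
by exists V => //; exact: sf.
Qed.

Lemma smooth_on_differentiable n (U : set 'rV[R]_n) f x :
  smooth_on U f -> U x -> differentiable f x.
Proof. by move=> sf Ux; case: (sf 1%N) => df _; exact: df. Qed.

Lemma smooth_on_derive n (U : set 'rV[R]_n) f v :
  smooth_on U f -> smooth_on U (fun x => 'D_v f x).
Proof. by move=> sf k; case: (sf k.+1) => _ Df; exact: Df. Qed.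

Lemma smooth_on_continuous n (U : set 'rV[R]_n) f x :
  smooth_on U f -> U x -> {for x, continuous f}.
Proof. by move=> sf Ux; exact: sf 0%N x Ux. Qed.

Lemma is_derive_coord n (j : 'I_n) (x v : 'rV[R]_n) :
  is_derive x v (fun y : 'rV[R]_n => y 0 j) (v 0 j).
Proof.
have d : derivable (id : 'rV[R]_n -> 'rV[R]_n) x v by exact: derivable_id.
have dj := (derivable_mxP _ _ _).1 d 0 j.
apply: DeriveDef; first exact: dj.
by have := derive_mx d; rewrite derive_id => /matrixP/(_ 0 j) ->; rewrite mxE.
Qed.

Lemma derive_coord n (j : 'I_n) (x v : 'rV[R]_n) :
  'D_v (fun y : 'rV[R]_n => y 0 j) x = v 0 j.
Proof. by have [] := is_derive_coord j x v. Qed.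

Lemma smooth_on_coord n (U : set 'rV[R]_n) (j : 'I_n) :
  smooth_on U (fun x => x 0 j).
Proof.
case=> [|k]; first by move=> x _; exact: coord_continuous.
split=> [x _|v]; first exact: differentiable_coord.
rewrite [X in class_C _ _ X](_ : _ = fun=> v 0 j); first exact: class_C_cst.
by apply/funext => x; rewrite derive_coord.
Qed.

Lemma smooth_on_prod n (U : set 'rV[R]_n) (I : Type) (r : seq I) (P : pred I)
    (F : I -> 'rV[R]_n -> R) : open U -> (forall i, smooth_on U (F i)) ->
  smooth_on U (fun x => \prod_(i <- r | P i) F i x).
Proof.
move=> oU sF; elim: r => [|i r IH].
  apply: smooth_on_eq (smooth_on_cst U 1) => // x _; by rewrite big_nil.
have [Pi|nPi] := boolP (P i).
  apply: smooth_on_eq (smooth_onM oU (sF i) IH) => // x _.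
  by rewrite big_cons Pi.
by apply: smooth_on_eq IH => // x _; rewrite big_cons (negbTE nPi).
Qed.

Lemma smooth_onN n (U : set 'rV[R]_n) f : open U -> smooth_on U f ->
  smooth_on U (fun x => - f x).
Proof.
move=> oU sf; apply: smooth_on_eq (smooth_onM oU (smooth_on_cst U (-1)) sf) => //.
by move=> x _; rewrite mulN1r.
Qed.

Lemma smooth_onB n (U : set 'rV[R]_n) f g : open U -> smooth_on U f ->
  smooth_on U g -> smooth_on U (fun x => f x - g x).
Proof. by move=> oU sf sg; apply: smooth_onD => //; exact: smooth_onN. Qed.

Lemma derive_basis n (f : 'rV[R]_n -> R) x v : differentiable f x ->
  'D_v f x = \sum_j v 0 j * 'D_(delta_mx 0 j) f x.
Proof.
move=> df; rewrite deriveE // {1}(row_sum_delta v) linear_sum /=.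
by apply: eq_bigr => j _; rewrite linearZ /= deriveE.
Qed.

Lemma differentiable_rV m n (p : 'rV[R]_m -> 'rV[R]_n) x :
  (forall j, differentiable (fun z => p z 0 j) x) -> differentiable p x.
Proof.
move=> dp.
have -> : p = \sum_(j < n) (fun z => p z 0 j *: (delta_mx 0 j : 'rV[R]_n)).
  apply/funext => z; rewrite {1}(row_sum_delta (p z)).
  by elim/big_ind2 : _ => // u f v g -> ->.
apply: differentiable_sum => j.
exact: differentiableZl (dp j).
Qed.

Lemma derive_comp_rV m n (p : 'rV[R]_m -> 'rV[R]_n) (f : 'rV[R]_n -> R) x v :
  (forall j, differentiable (fun z => p z 0 j) x) -> differentiable f (p x) ->
  'D_v (f \o p) x =
  \sum_j 'D_v (fun z => p z 0 j) x * 'D_(delta_mx 0 j) f (p x).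
Proof.
move=> dp df; have dpx := differentiable_rV dp.
rewrite deriveE; last exact: differentiable_comp.
rewrite diff_comp //= -deriveE // -deriveE // derive_mx; last exact: diff_derivable.
by rewrite derive_basis //; apply: eq_bigr => j _; rewrite mxE.
Qed.

(** Induction on [k]: by the chain rule the derivatives of [f \o p] are sums
    of products of derivatives of [p] with partial derivatives of [f] composed
    with [p], and the latter are of class [k] by induction. *)
Lemma class_C_comp m n k (U : set 'rV[R]_m) (V : set 'rV[R]_n)
    (p : 'rV[R]_m -> 'rV[R]_n) (f : 'rV[R]_n -> R) : open U ->
  (forall x, U x -> V (p x)) -> (forall j, smooth_on U (fun z => p z 0 j)) ->
  smooth_on V f -> class_C k U (f \o p).
Proof.
move=> oU UV sp; elim: k f => [|k IH] f sf.
  move=> x Ux; apply: continuous_comp; last exact: smooth_on_continuous sf (UV _ Ux).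
  apply: differentiable_continuous; apply: differentiable_rV => j.
  exact: smooth_on_differentiable (sp j) Ux.
split=> [x Ux|v].
  apply: differentiable_comp; last exact: smooth_on_differentiable sf (UV _ Ux).
  by apply: differentiable_rV => j; exact: smooth_on_differentiable (sp j) Ux.
apply: (@class_C_eq _ _ _ _ (fun x => \sum_j
    'D_v (fun z => p z 0 j) x * ('D_(delta_mx 0 j) f \o p) x)) => //.
  move=> x Ux; rewrite derive_comp_rV //.
    by move=> j; exact: smooth_on_differentiable (sp j) Ux.
  exact: smooth_on_differentiable sf (UV _ Ux).
elim: (index_enum _) => [|j r IHr].
  by apply: class_C_eq (@class_C_cst R m k U 0) => // x _; rewrite big_nil.
apply: class_C_eq (class_CD oU (class_CM oU (smooth_on_derive v (sp j) k)
  (IH _ (smooth_on_derive (delta_mx 0 j) sf))) IHr) => // x _.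
by rewrite big_cons.
Qed.

Lemma smooth_on_comp m n (U : set 'rV[R]_m) (V : set 'rV[R]_n)
    (p : 'rV[R]_m -> 'rV[R]_n) (f : 'rV[R]_n -> R) : open U ->
  (forall x, U x -> V (p x)) -> (forall j, smooth_on U (fun z => p z 0 j)) ->
  smooth_on V f -> smooth_on U (f \o p).
Proof. by move=> oU UV sp sf k; exact: class_C_comp UV sp sf. Qed.

Lemma smooth_onV n (U : set 'rV[R]_n) f : open U -> (forall x, U x -> f x != 0) ->
  smooth_on U f -> smooth_on U (fun x => (f x)^-1).
Proof.
move=> oU f0 sf; elim=> [|k IH].
  by move=> x Ux; exact: cvgV (f0 _ Ux) (smooth_on_continuous sf Ux).
split=> [x Ux|v].
  apply: differentiableV; [exact: smooth_on_differentiable sf Ux|exact: f0].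
apply: (@class_C_eq _ _ _ _ (fun x => - 'D_v f x * ((f x)^-1 * (f x)^-1))) => //.
  move=> x Ux; rewrite deriveV ?f0 //; first by rewrite /GRing.scale /= expr2 invfM !mulNr mulrC.
  by apply: diff_derivable; exact: smooth_on_differentiable sf Ux.
apply: class_CM => //; last exact: class_CM.
exact: smooth_onN oU (smooth_on_derive v sf) k.
Qed.

End SmoothCalculus.

(** * Bump functions on row vectors *)

Section FlatFunction.
Context {R : realType}.

(** The functions t^-k exp (-1/t), all together because the derivative of
    one is a combination of others: this is what makes the induction on the
    order of differentiability of exp (-1/t) go through. *)
Definition flat (k : nat) (t : R) : R :=
  if 0 < t then t^-1 ^+ k * expR (- t^-1) else 0.

(** With u = 1/t this is u^(k+1) / (k+1)! <= exp u. As the difference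
    quotient of [flat k] at 0 is [flat k.+1], it gives the derivative 0 there. *)
Lemma flat_bound k t : `|flat k t| <= k.+1`!%:R * `|t|.
Proof.
rewrite /flat; case: ltP => [t0|_]; last by rewrite normr0 mulr_ge0.
have u0 : 0 < t^-1 by rewrite invr_gt0.
have fge0 : 0 <= t^-1 ^+ k * expR (- t^-1).
  by rewrite mulr_ge0 ?expR_ge0 // exprn_ge0 // ltW.
rewrite (ger0_norm fge0) (gtr0_norm t0).
rewrite -[X in _ <= _ * X]invrK; set u := t^-1 in u0 *.
have /(le_trans _) := expR_ge1Dxn k (ltW u0) => /(_ (u ^+ k.+1 / k.+1`!%:R)).
rewrite lerDr ler01 => /(_ isT).
rewrite ler_pdivrMr ?ltr0n ?fact_gt0 // exprSr => le.
rewrite expRN ler_pdivrMr ?expR_gt0 // -(ler_pM2r u0).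
rewrite (_ : _ * _^-1 * _ * _ = expR u * k.+1`!%:R) //.
by field; rewrite gt_eqF.
Qed.

Lemma is_derive_flat k (t : R) :
  is_derive t (1 : R) (flat k) (flat k.+2 t - k%:R * flat k.+1 t).
Proof.
have [t0|t0|<-] := ltgtP 0 t.
- have E : {near t, (fun u => expR (- u)* u ^+ k) \o (fun t => t^-1) =1 flat k}.
    have : nbhs t [set u : R | 0 < u] by exact: lt_nbhsr.
    by apply: filterS => u /= u0; rewrite /flat u0 mulrC.
  have tn0 : t != 0 by rewrite gt_eqF.
  apply: near_eq_is_derive E _.
  rewrite /flat t0.
  have di : is_derive t (1 : R) (fun t : R => t^-1) (- t ^- 2 *: 1).
    exact: is_deriveV.
  have dX : is_derive t^-1 (1 : R) (fun u : R => u ^+ k) (k%:R * t^-1 ^+ k.-1).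
    apply: DeriveDef; first exact: exprn_derivable.
    by rewrite exp_derive /GRing.scale /= mulr1.
  have dN : is_derive t^-1 (1 : R) (fun u : R => expR (- u)) (- expR (- t^-1)).
    rewrite -mulrN1.
    have dN1 : is_derive t^-1 (1 : R) (fun u : R => - u) (- 1).
      exact: (is_deriveN (is_derive_id _ _)).
    exact: (is_derive1_comp (is_derive_expR _) dN1).
  have dM : is_derive t^-1 (1 : R) (fun u => expR (- u) * u ^+ k) _ :=
    is_deriveM dN dX.
  have dC := is_derive1_comp dM di.
  apply: (is_derive_eq dC).
  rewrite /GRing.scale /= !mulr1.
  by case: k {dX dM dC} => [|k]; rewrite !exprS /=; field; exact: tn0.
- have E : {near t, cst 0 =1 flat k}.
    have : nbhs t [set u : R | u < 0] by exact: lt_nbhsl.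
    by apply: filterS => u /= u0; rewrite /flat ltNge ltW.
  apply: near_eq_is_derive E _.
  by rewrite /flat ltNge ltW //= mulr0 subr0; exact: is_derive_cst.
- rewrite /flat ltxx mulr0 subr0.
  have L : (fun h : R => h^-1 *: (flat k (h *: 1 + 0) - flat k 0)) @ 0^' --> (0 : R).
    apply/cvgrPdist_le => e e0; near=> h.
    have hn0 : h != 0 by near: h; exact: nbhs_dnbhs_neq.
    rewrite sub0r normrN [flat k 0]/flat ltxx subr0 addr0.
    rewrite /GRing.scale /= mulr1.
    have -> : h^-1 * flat k h = flat k.+1 h.
      by rewrite /flat; case: ifP; rewrite ?mulr0 // exprS mulrA.
    apply: le_trans (flat_bound _ _) _.
    rewrite -ler_pdivlMl ?ltr0n ?fact_gt0 //.
    near: h; apply: dnbhs0_le.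
    by rewrite mulr_gt0 // invr_gt0 ltr0n fact_gt0.
  apply: DeriveDef; first by apply/cvg_ex; exists 0.
  exact: cvg_lim L.
Unshelve. all: by end_near. Qed.

Lemma differentiable_flat k (t : R) : differentiable (flat k) t.
Proof. by apply/derivable1_diffP; case: (is_derive_flat k t). Qed.

Lemma smooth_on_flat n (U : set 'rV[R]_n) f k : open U -> smooth_on U f ->
  smooth_on U (fun x => flat k (f x)).
Proof.
move=> oU sf l; elim: l k => [|l IH] k.
  move=> x Ux; apply: continuous_comp; first exact: smooth_on_continuous sf Ux.
  exact: differentiable_continuous (differentiable_flat _ _).
split=> [x Ux|v].
  apply: (@differentiable_comp _ _ _ _ f (flat k)).
    exact: smooth_on_differentiable sf Ux.
  exact: differentiable_flat.
apply: (@class_C_eq _ _ _ _ (fun x =>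
   (flat k.+2 (f x) + - k%:R * flat k.+1 (f x)) * 'D_v f x)) => //.
  move=> x Ux; have df := smooth_on_differentiable sf Ux.
  have dF := differentiable_flat k (f x).
  rewrite [RHS]deriveE; last exact: (differentiable_comp df dF).
  rewrite (diff_comp df dF) /= -(deriveE v df).
  set a := 'D_v f x; have E : a = a *: (1 : R) by rewrite /GRing.scale /= mulr1.
  rewrite [X in 'd _ _ X]E linearZ /= -deriveE //.
  by have [_ ->] := is_derive_flat k (f x); rewrite mulNr mulrC.
apply: class_CM => //; last exact: smooth_on_derive v sf l.
apply: class_CD => //; apply: class_CM => //; exact: class_C_cst.
Qed.

Definition plateau (a b t : R) : R :=
  flat 0 (b - t) * (flat 0 (b - t) + flat 0 (t - a))^-1.

Lemma flat0_ge0 t : 0 <= flat 0 t.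
Proof. by rewrite /flat; case: ifP => // _; rewrite expr0 mul1r expR_ge0. Qed.

Lemma flat0_gt0 t : (0 < flat 0 t) = (0 < t).
Proof. by rewrite /flat; case: ifP => // _; rewrite ?ltxx // expr0 mul1r expR_gt0. Qed.

Lemma plateau_den a b t : a < b -> 0 < flat 0 (b - t) + flat 0 (t - a).
Proof.
move=> ab; have [tb|bt] := ltP t b.
  by rewrite ltr_wpDr ?flat0_ge0 // flat0_gt0 subr_gt0.
by rewrite ltr_wpDl ?flat0_ge0 // flat0_gt0 subr_gt0 (lt_le_trans ab).
Qed.

Lemma plateau1 a b t : a < b -> t <= a -> plateau a b t = 1.
Proof.
move=> ab ta; rewrite /plateau [flat 0 (t - a)](_ : _ = 0) ?addr0.
  by rewrite divff // gt_eqF // flat0_gt0 subr_gt0 (le_lt_trans ta).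
by rewrite /flat subr_gt0 ltNge ta.
Qed.

Lemma plateau0 a b t : b <= t -> plateau a b t = 0.
Proof. by move=> bt; rewrite /plateau {1}/flat subr_gt0 ltNge bt mul0r. Qed.

Lemma smooth_on_plateau n (U : set 'rV[R]_n) f a b : a < b -> open U ->
  smooth_on U f -> smooth_on U (fun x => plateau a b (f x)).
Proof.
move=> ab oU sf.
have sb : smooth_on U (fun x => flat 0 (b - f x)).
  by apply: smooth_on_flat => //; apply: smooth_onB => //; exact: smooth_on_cst.
have sa : smooth_on U (fun x => flat 0 (f x - a)).
  by apply: smooth_on_flat => //; apply: smooth_onB => //; exact: smooth_on_cst.
apply: smooth_onM => //; apply: smooth_onV => //; last exact: smooth_onD.
by move=> x _; rewrite gt_eqF // plateau_den.
Qed.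

Lemma norm_coord_le n (x : 'rV[R]_n) j : `|x 0 j| <= `|x|.
Proof.
rewrite [leRHS]/Num.Def.normr /= mx_normrE.
exact: (le_bigmax _ (fun i : 'I_1 * 'I_n => `|x i.1 i.2|) (0, j)).
Qed.

Lemma norm_rV_lt n (x : 'rV[R]_n) e : 0 < e ->
  (forall j, `|x 0 j| < e) -> `|x| < e.
Proof.
move=> e0 xe; rewrite [ltLHS]/Num.Def.normr /= mx_normrE.
by apply/bigmax_ltP; split=> // -[i j] _ /=; rewrite ord1.
Qed.

(** Balls of the maximum norm are products of intervals, so one-variable
    plateaus in the squared coordinate differences can be multiplied. *)
Lemma bump_rV n (z0 : 'rV[R]_n) (e : R) : 0 < e ->
  exists b : 'rV[R]_n -> R, [/\ smooth_on setT b,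
    forall z, `|z - z0| <= e -> b z = 1 &
    forall z, b z != 0 -> `|z - z0| < e *+ 2].
Proof.
move=> e0.
have lt4 : e ^+ 2 < (e *+ 2) ^+ 2 by rewrite ltr_pXn2r ?nnegrE ?ltW ?mulrn_wgt0 // mulr2n ltrDl.
exists (fun z => \prod_(j < n) plateau (e ^+ 2) ((e *+ 2) ^+ 2) ((z 0 j - z0 0 j) ^+ 2)).
split=> [|z ze|z].
- have oT : open (setT : set 'rV[R]_n) by exact: openT.
  apply: smooth_on_prod => // j; apply: smooth_on_plateau => //.
  by apply: smooth_onM => //; apply: smooth_onB (smooth_on_coord _ _) (smooth_on_cst _ _).
- rewrite big1 // => j _; apply: plateau1 => //.
  rewrite -ler_sqrt ?exprn_even_ge0 // !sqrtr_sqr (ger0_norm (ltW e0)).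
  by have := norm_coord_le (z - z0) j; rewrite !mxE => /le_trans; exact.
- move=> b0; apply: norm_rV_lt => [|j]; first by rewrite mulrn_wgt0.
  rewrite ltNge; apply: contraNN b0 => le2.
  rewrite (bigD1 j) //= plateau0 ?mul0r //.
  rewrite !mxE in le2.
  by rewrite -[leRHS]real_normK ?num_real // ler_pXn2r // nnegrE ?mulrn_wge0 // ltW.
Qed.

End FlatFunction.

(** * Integration over the unit interval *)

Section MeanIntegral.
Context {R : realType}.
Implicit Types f g : R -> R.

(** Continuity is two-sided also at 0 and 1: the integrands below are defined
    around the unit interval. *)
Definition continuous01 f := forall t, 0 <= t <= 1 -> {for t, continuous f}.

Definition integral01 f : R := \int[lebesgue_measure]_(t in `[0, 1]) f t.

Lemma continuous01_within f : continuous01 f -> {within `[0, 1], continuous f}.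
Proof.
move=> cf; apply: continuous_in_subspaceT => t.
by rewrite inE /= in_itv /= => /cf.
Qed.

Lemma continuous01_integrable f : continuous01 f ->
  lebesgue_measure.-integrable `[0, 1] (EFin \o f).
Proof.
move=> cf; apply: continuous_compact_integrable; first exact: segment_compact.
exact: continuous01_within.
Qed.

Lemma integral01D f g : continuous01 f -> continuous01 g ->
  integral01 (fun t => f t + g t) = integral01 f + integral01 g.
Proof. by move=> cf cg; apply: RintegralD => //; exact: continuous01_integrable. Qed.

Lemma integral01Z a f : continuous01 f ->
  integral01 (fun t => a * f t) = a * integral01 f.
Proof. by move=> cf; apply: RintegralZl => //; exact: continuous01_integrable. Qed.

Lemma integral01_cst a : integral01 (fun=> a) = a.
Proof.
rewrite /integral01 Rintegral_cst //= lebesgue_measure_itv /= lte_fin ltr01.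
by rewrite sube0 /= mulr1.
Qed.

Lemma eq_integral01 f g : (forall t, 0 <= t <= 1 -> f t = g t) ->
  integral01 f = integral01 g.
Proof. by move=> fg; apply: eq_Rintegral => t; rewrite inE /= in_itv /= => /fg. Qed.

Lemma continuous01D f g : continuous01 f -> continuous01 g ->
  continuous01 (fun t => f t + g t).
Proof. by move=> cf cg t t01; exact: cvgD (cf _ t01) (cg _ t01). Qed.

Lemma continuous01M f g : continuous01 f -> continuous01 g ->
  continuous01 (fun t => f t * g t).
Proof. by move=> cf cg t t01; exact: cvgM (cf _ t01) (cg _ t01). Qed.

Lemma continuous01_cst a : continuous01 (fun=> a).
Proof. by move=> t _; exact: cvg_cst. Qed.

Lemma continuous01_exp k : continuous01 (fun t => t ^+ k).
Proof. by move=> t _; exact: exprn_continuous. Qed.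

Lemma continuous01_sum (J : Type) (r : seq J) (F : J -> R -> R) :
  (forall j, continuous01 (F j)) -> continuous01 (fun t => \sum_(j <- r) F j t).
Proof.
move=> cF; elim: r => [|j r IH].
  rewrite [X in continuous01 X](_ : _ = fun=> 0); first exact: continuous01_cst.
  by apply/funext => t; rewrite big_nil.
rewrite [X in continuous01 X](_ : _ = fun t => F j t + \sum_(j <- r) F j t).
  exact: continuous01D.
by apply/funext => t; rewrite big_cons.
Qed.

Lemma integral01_sum (J : Type) (r : seq J) (F : J -> R -> R) :
  (forall j, continuous01 (F j)) ->
  integral01 (fun t => \sum_(j <- r) F j t) = \sum_(j <- r) integral01 (F j).
Proof.
move=> cF; elim: r => [|j r IH].
  rewrite big_nil -[RHS](integral01_cst 0); apply: eq_integral01 => t _.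
  by rewrite big_nil.
rewrite big_cons -IH -integral01D //; last exact: continuous01_sum.
by apply: eq_integral01 => t _; rewrite big_cons.
Qed.

Lemma integral01_norm_le f C : continuous01 f ->
  (forall t, 0 <= t <= 1 -> `|f t| <= C) -> `|integral01 f| <= C.
Proof.
move=> cf fC.
apply: (le_trans (le_normr_Rintegral _ (continuous01_integrable cf))) => //.
rewrite -[leRHS]integral01_cst; apply: le_Rintegral => //.
- apply: (@continuous01_integrable (fun t => `|f t|)) => t t01.
  apply: (@continuous_comp _ _ _ f Num.norm); first exact: cf.
  exact: norm_continuous.
- exact: continuous01_integrable (@continuous01_cst C).
Qed.

Lemma integral01_derive F f : continuous01 f ->
  (forall t : R, 0 <= t <= 1 -> is_derive t (1 : R) F (f t)) ->
  integral01 f = F 1 - F 0.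
Proof.
move=> cf dF; have cF : {within `[0, 1], continuous F}.
  apply: continuous_in_subspaceT => t; rewrite inE /= in_itv /= => /dF[d _].
  by apply: differentiable_continuous; exact/derivable1_diffP.
have dFoo : derivable_oo_LRcontinuous F 0 1.
  have [_ c0 c1] := (continuous_within_itvP _ ltr01).1 cF.
  split=> // t; rewrite in_itv /= => /andP[t0 t1].
  by have /dF[] : 0 <= t <= 1 by rewrite !ltW.
rewrite /integral01 /Rintegral (continuous_FTC2 ltr01 (continuous01_within cf) dFoo) //.
move=> t; rewrite in_itv /= => /andP[t0 t1].
rewrite derive1E; have /dF[_ dFt] : 0 <= t <= 1 by rewrite !ltW.
exact: dFt.
Qed.

End MeanIntegral.

(** * Hadamard's lemma *)

Section Hadamard.
Context {R : realType} {n : nat}.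
Implicit Types (f h : 'rV[R]_n -> R) (p x y z w : 'rV[R]_n).

Local Notation "B[ p , e ]" := [set z | `|z - p| < e].

Lemma segment_in_ball p y w (e t : R) : `|y - p| < e -> `|y + w - p| < e ->
  0 <= t <= 1 -> `|y + t *: w - p| < e.
Proof.
move=> ye we /andP[t0 t1].
have -> : y + t *: w - p = (1 - t) *: (y - p) + t *: (y + w - p).
  by apply/rowP => i; rewrite !mxE; ring.
apply: le_lt_trans (ler_normD _ _) _; rewrite !normrZ.
rewrite !ger0_norm ?subr_ge0 //.
have [->|tn0] := eqVneq t 0; first by rewrite subr0 mul1r mul0r addr0.
have -> : e = (1 - t) * e + t * e by ring.
apply: ler_ltD; first by rewrite ler_wpM2l ?subr_ge0 // ltW.
by rewrite ltr_pM2l // lt_neqAle eq_sym tn0.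
Qed.

Lemma ray_in_ball p x (e t : R) : `|x - p| < e -> 0 <= t <= 1 ->
  `|p + t *: (x - p) - p| < e.
Proof.
move=> xe /andP[t0 t1]; rewrite addrAC subrr add0r normrZ (ger0_norm t0).
by apply: le_lt_trans xe; rewrite ler_piMl.
Qed.

Lemma is_derive_line f y w (t : R) : differentiable f (y + t *: w) ->
  is_derive t (1 : R) (fun s => f (y + s *: w)) ('D_w f (y + t *: w)).
Proof.
move=> df.
have E : (fun h : R => h^-1 *: ((f \o shift (y + t *: w)) (h *: w) - f (y + t *: w)))
  = (fun h : R => h^-1 *: (((fun s => f (y + s *: w)) \o shift t) (h *: 1) - f (y + t *: w))).
  apply/funext => h /=; congr (_ *: (f _ - _)).
  by apply/rowP => i; rewrite !mxE /GRing.scale /=; ring.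
have := @diff_derivable _ _ _ _ _ w df; rewrite /derivable E => d.
by apply: DeriveDef => //; rewrite /derive E.
Qed.

(** A ball is convex, so the segment stays where [f] is smooth. *)
Lemma mean_value_line f p (e : R) y w : smooth_on B[p, e] f ->
  `|y - p| < e -> `|y + w - p| < e ->
  exists2 t : R, 0 <= t <= 1 & f (y + w) - f y = 'D_w f (y + t *: w).
Proof.
move=> sf ye we.
have dl (t : R) : 0 <= t <= 1 -> is_derive t (1 : R) (fun s => f (y + s *: w)) ('D_w f (y + t *: w)).
  move=> t01; apply: is_derive_line; apply: smooth_on_differentiable sf _.
  exact: segment_in_ball.
have cl : {within `[0, 1], continuous (fun s => f (y + s *: w))}.
  apply: derivable_within_continuous => t; rewrite in_itv /= => t01.
  by have [] := dl _ t01.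
have [|t] := @MVT_segment _ (fun s => f (y + s *: w)) (fun t : R => 'D_w f (y + t *: w)) 0 1 ler01 _ cl.
  by move=> t; rewrite in_itv /= => /andP[t0 t1]; apply: dl; rewrite !ltW.
rewrite in_itv /= scale1r scale0r addr0 subr0 mulr1 => t01 E.
by exists t.
Qed.

Lemma compact_closed_ball p (d : R) : compact [set z | `|z - p| <= d].
Proof.
apply: bounded_closed_compact.
  exists (`|p| + d); split; first exact: num_real.
  move=> M ltM z /= zd; apply: le_trans _ (ltW ltM).
  have := ler_normD p (z - p); rewrite addrC subrK => /le_trans; apply.
  by rewrite lerD2l.
rewrite (_ : mkset _ = closed_ball_ Num.norm p d); first exact: closed_closed_ball_.
by apply/seteqP; split=> z; rewrite /closed_ball_ /= distrC.
Qed.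

Lemma bounded_on_ball f p (e d : R) : d < e -> smooth_on B[p, e] f ->
  exists C : R, forall z, `|z - p| <= d -> `|f z| <= C.
Proof.
move=> de sf; pose K := [set z | `|z - p| <= d].
have cK : compact K by exact: compact_closed_ball.
have cf : {within K, continuous f}.
  apply: continuous_in_subspaceT => z; rewrite inE => Kz.
  by apply: smooth_on_continuous sf _; exact: le_lt_trans Kz de.
have [M [_ bM]] := compact_bounded (continuous_compact cf cK).
by exists (M + 1) => z Kz; apply: bM; [rewrite ltrDl|exists z].
Qed.

Lemma lipschitz_on_ball f p (e d : R) : d < e -> smooth_on B[p, e] f ->
  exists C : R, 0 <= C /\ forall y w, `|y - p| < d -> `|y + w - p| < d ->
    `|f (y + w) - f y| <= C * `|w|.
Proof.
move=> de sf.
have /choice[C bC] (j : 'I_n) := bounded_on_ball de (smooth_on_derive (delta_mx 0 j) sf).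
exists (\sum_j `|C j|); split; first exact: sumr_ge0.
move=> y w yd wd.
have sd : smooth_on B[p, d] f.
  by apply: smooth_onS sf => z /= /lt_trans; exact.
have [t t01 ->] := mean_value_line sd yd wd.
have ztd := segment_in_ball yd wd t01.
rewrite derive_basis; last exact: smooth_on_differentiable sd ztd.
apply: le_trans (ler_norm_sum _ _ _) _; rewrite mulr_suml; apply: ler_sum => j _.
rewrite normrM mulrC ler_pM //; last exact: norm_coord_le.
by apply: le_trans (ler_norm _); apply: bC; exact: ltW.
Qed.

(** By the mean value theorem the remainder is a difference of first
    derivatives of [f], and these are Lipschitz. *)
Lemma taylor2_on_ball f p (e d : R) : d < e -> smooth_on B[p, e] f ->
  exists2 C : R, 0 <= C & forall y w, `|y - p| < d -> `|y + w - p| < d ->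
    `|f (y + w) - f y - 'D_w f y| <= C * `|w| ^+ 2.
Proof.
move=> de sf.
have /choice[C bC] (j : 'I_n) := lipschitz_on_ball de (smooth_on_derive (delta_mx 0 j) sf).
exists (\sum_j C j); first by apply: sumr_ge0 => j _; case: (bC j).
move=> y w yd wd.
have sd : smooth_on B[p, d] f.
  by apply: smooth_onS sf => z /= /lt_trans; exact.
have [t t01 ->] := mean_value_line sd yd wd.
have ztd := segment_in_ball yd wd t01.
rewrite !derive_basis; [|exact: smooth_on_differentiable sd yd|exact: smooth_on_differentiable sd ztd].
rewrite -sumrB mulr_suml; apply: le_trans (ler_norm_sum _ _ _) _.
apply: ler_sum => j _; rewrite -mulrBr normrM expr2 mulrCA ler_pM //.
  exact: norm_coord_le.
have [C0 /(_ _ _ yd ztd)] := bC j; move/le_trans; apply.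
have /andP[t0 t1] := t01.
rewrite normrZ ler_wpM2l // (ger0_norm t0).
by rewrite ler_piMl.
Qed.

(** The candidate for a differential with partial derivatives [a]. *)
Definition lincomb (a : 'I_n -> R) w : R := \sum_j w 0 j * a j.

Lemma lincomb_linear a : linear (lincomb a : _ -> R^o).
Proof.
move=> k u v; rewrite /lincomb scaler_sumr -big_split; apply: eq_bigr => j _.
by rewrite !mxE /GRing.scale /=; ring.
Qed.

HB.instance Definition _ a :=
  GRing.isLinear.Build R 'rV[R]_n R^o *:%R (lincomb a) (lincomb_linear a).

Lemma differentiable_quadratic f x (a : 'I_n -> R) (C r : R) : 0 < r ->
  (forall w, `|w| < r -> `|f (x + w) - f x - \sum_j w 0 j * a j| <= C * `|w| ^+ 2) ->
  differentiable f x /\ forall v, 'D_v f x = \sum_j v 0 j * a j.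
Proof.
move=> r0 fC; pose L : {linear 'rV[R]_n -> R^o} := lincomb a.
have cL : continuous L.
  have -> : (L : _ -> _) = \sum_j (fun w : 'rV[R]_n => w 0 j *: L (delta_mx 0 j)).
    apply/funext => w; rewrite {1}(row_sum_delta w) linear_sum fct_sumE.
    by apply: eq_bigr => j _; rewrite linearZ.
  move=> w; apply: differentiable_continuous; apply: differentiable_sum => j.
  by apply: differentiableZl; exact: differentiable_coord.
have eg : f \o shift x = cst (f x) + L +o_ (0 : 'rV[R]_n) id.
  apply/eqaddoP => e e0.
  have n1 : \forall w \near (0 : 'rV[R]_n), `|w| < r.
    exact: pseudometric_normed_Zmodule.nbhs0_lt.
  have n2 : \forall w \near (0 : 'rV[R]_n), `|w| <= (1 + `|C|)^-1 * e.
    by apply: pseudometric_normed_Zmodule.nbhs0_le; rewrite mulr_gt0 // invr_gt0 ltr_pwDl.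
  apply: filterS2 n1 n2 => w wr we; rewrite !fctE /= [w + x]addrC opprD addrA.
  apply: le_trans (fC _ wr) _; rewrite expr2 mulrA ler_wpM2r //.
  move: we; rewrite ler_pdivlMl ?ltr_pwDl // => we'; apply: le_trans we'.
  by rewrite ler_wpM2r // (le_trans (ler_norm _)) // lerDr.
have dE := diff_unique cL eg.
have df : differentiable f x by apply/diff_locallyP; rewrite dE.
by split=> // v; rewrite deriveE // dE.
Qed.

Lemma continuous01_ray h p (e : R) x : smooth_on B[p, e] h -> `|x - p| < e ->
  continuous01 (fun t => h (p + t *: (x - p))).
Proof.
move=> sh xe t t01; apply: differentiable_continuous; apply/derivable1_diffP.
have dh : differentiable h (p + t *: (x - p)).
  by apply: smooth_on_differentiable sh _; exact: ray_in_ball.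
by have [] := is_derive_line dh.
Qed.

(** The moments of [h] along the segment from [p] to [x]. Differentiation in
    [x] brings out one factor t, so the weights t^k close the family under
    derivatives. *)
Definition mean k h p x := integral01 (fun t => t ^+ k * h (p + t *: (x - p))).

(** The remainder of order two in Taylor's formula is uniform along the
    segment, hence can be integrated. *)
Lemma derive_mean k h p (e d : R) x : d < e -> smooth_on B[p, e] h ->
  `|x - p| < d ->
  differentiable (mean k h p) x /\
  forall v, 'D_v (mean k h p) x = mean k.+1 (fun z => 'D_v h z) p x.
Proof.
move=> de sh xd; have xe := lt_trans xd de.
have [C C0 bC] := taylor2_on_ball de sh.
have cD j : continuous01 (fun t => t ^+ k.+1 * 'D_(delta_mx 0 j) h (p + t *: (x - p))).
  apply: continuous01M; first exact: continuous01_exp.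
  exact: (continuous01_ray (smooth_on_derive _ sh)).
have c0 z : `|z - p| < e -> continuous01 (fun t => t ^+ k * h (p + t *: (z - p))).
  move=> ze; apply: continuous01M; first exact: continuous01_exp.
  exact: continuous01_ray sh ze.
have d0 : 0 < d by exact: le_lt_trans xd.
have ball t z : 0 <= t <= 1 -> `|z - p| < d -> `|p + t *: (z - p) - p| < d.
  by move=> t01 zd; exact: ray_in_ball.
have key := @differentiable_quadratic (mean k h p) x
   (fun j => mean k.+1 (fun z => 'D_(delta_mx 0 j) h z) p x) C (d - `|x - p|).
have [|w wr|dm Dm] := key.
- by rewrite subr_gt0.
- have xwd : `|x + w - p| < d.
    rewrite addrAC; apply: le_lt_trans (ler_normD _ _) _.
    by rewrite -ltrBrDl.
  pose F t := t ^+ k * h (p + t *: (x + w - p)) -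
     t ^+ k * h (p + t *: (x - p)) -
     \sum_j w 0 j * (t ^+ k.+1 * 'D_(delta_mx 0 j) h (p + t *: (x - p))).
  have E : mean k h p (x + w) - mean k h p x - \sum_j
      w 0 j * mean k.+1 (fun z => 'D_(delta_mx 0 j) h z) p x = integral01 F.
    rewrite /F (_ : (fun _ => _) = fun t =>
      (t ^+ k * h (p + t *: (x + w - p)) + -1 * (t ^+ k * h (p + t *: (x - p)))) +
      -1 * \sum_j w 0 j * (t ^+ k.+1 * 'D_(delta_mx 0 j) h (p + t *: (x - p)))).
      rewrite integral01D ?integral01D ?integral01Z ?integral01_sum.
      + rewrite !mulN1r; congr (_ - _); apply: eq_bigr => j _.
        by rewrite integral01Z.
      + move=> j; apply: continuous01M => //; exact: continuous01_cst.
      + apply: continuous01_sum => j; apply: continuous01M => //; exact: continuous01_cst.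
      + exact: c0.
      + exact: c0 (lt_trans xwd de).
      + by apply: continuous01M; [exact: continuous01_cst|exact: c0].
      + apply: continuous01D; first exact: c0 (lt_trans xwd de).
        by apply: continuous01M; [exact: continuous01_cst|exact: c0].
      + apply: continuous01M; first exact: continuous01_cst.
        apply: continuous01_sum => j; apply: continuous01M => //; exact: continuous01_cst.
    by apply/funext => t; ring.
  rewrite E; apply: integral01_norm_le.
    apply: continuous01D.
      apply: continuous01D; first exact: c0 (lt_trans xwd de).
      by move=> t t01; apply: cvgN; exact: c0.
    move=> t t01; apply: cvgN; apply: continuous01_sum t01 => j.
    by apply: continuous01M => //; exact: continuous01_cst.
  move=> t t01; have /andP[t0 t1] := t01.
  have Ew : p + t *: (x - p) + t *: w = p + t *: (x + w - p).
    by rewrite -addrA -scalerDr [x - p + w]addrAC.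
  have -> : F t = t ^+ k * (h ((p + t *: (x - p)) + t *: w) - h (p + t *: (x - p))
      - 'D_(t *: w) h (p + t *: (x - p))).
    rewrite [in RHS]derive_basis; last first.
      apply: smooth_on_differentiable sh _; rewrite /=.
      exact: lt_trans (ball _ _ t01 xd) de.
    rewrite /F !mulrBr Ew; congr (_ - _).
    rewrite mulr_sumr; apply: eq_bigr => j _; rewrite !mxE exprS; ring.
  rewrite normrM ger0_norm ?exprn_ge0 //.
  have yw : `|p + t *: (x - p) + t *: w - p| < d.
    by rewrite Ew; exact: ball.
  apply: (@le_trans _ _ (1 * (C * `|t *: w| ^+ 2))).
    apply: ler_pM => //; first exact: exprn_ge0.
      exact: exprn_ile1.
    exact: bC (ball _ _ t01 xd) yw.
  rewrite mul1r ler_wpM2l // normrZ (ger0_norm t0) lerXn2r ?nnegrE ?mulr_ge0 //.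
  by rewrite ler_piMl.
split=> // v; rewrite Dm /mean.
under eq_bigr do rewrite -integral01Z //.
rewrite -integral01_sum => [|j]; last first.
  by apply: continuous01M => //; exact: continuous01_cst.
apply: eq_integral01 => t t01; rewrite derive_basis; last first.
  apply: smooth_on_differentiable sh _; rewrite /=.
  exact: lt_trans (ball _ _ t01 xd) de.
by rewrite mulr_sumr; apply: eq_bigr => j _; rewrite mulrCA.
Qed.

Lemma smooth_on_mean k h p (e d : R) : d < e -> smooth_on B[p, e] h ->
  smooth_on B[p, d] (mean k h p).
Proof.
move=> de sh l.
have oB : open B[p, d].
  rewrite (_ : mkset _ = ball p d); first exact: ball_open.
  by apply/seteqP; split=> z; rewrite -ball_normE /= distrC.
elim: l k h sh => [|l IH] k h sh.
  by move=> x xd; apply: differentiable_continuous; have [] := derive_mean k de sh xd.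
split=> [x xd|v]; first by have [] := derive_mean k de sh xd.
apply: class_C_eq (IH k.+1 _ (smooth_on_derive v sh)) => // x xd.
by have [_ ->] := derive_mean k de sh xd.
Qed.

(** Integrate the derivative of t |-> f (p + t (z - p)) over [0, 1]: the
    function [g i] is the mean of the i-th partial derivative. *)
Lemma hadamard f p (e d : R) : d < e -> smooth_on B[p, e] f ->
  exists g : 'I_n -> 'rV[R]_n -> R,
  [/\ forall i, smooth_on B[p, d] (g i),
      forall z, `|z - p| < d -> f z = f p + \sum_i (z - p) 0 i * g i z &
      forall i, g i p = 'D_(delta_mx 0 i) f p].
Proof.
move=> de sf.
exists (fun i => mean 0 (fun z => 'D_(delta_mx 0 i) f z) p); split=> [i|z zd|i].
- exact: smooth_on_mean de (smooth_on_derive _ sf).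
- have ze := lt_trans zd de; have e0 : 0 < e by exact: le_lt_trans ze.
  have cg i : continuous01 (fun t => 'D_(delta_mx 0 i) f (p + t *: (z - p))).
    exact: (continuous01_ray (smooth_on_derive _ sf)).
  have cw i : continuous01 (fun t => (z - p) 0 i * 'D_(delta_mx 0 i) f (p + t *: (z - p))).
    by apply: continuous01M => //; exact: continuous01_cst.
  have dl (t : R) : 0 <= t <= 1 -> is_derive t (1 : R) (fun s => f (p + s *: (z - p)))
      (\sum_i (z - p) 0 i * 'D_(delta_mx 0 i) f (p + t *: (z - p))).
    move=> t01; have dft : differentiable f (p + t *: (z - p)).
      apply: smooth_on_differentiable sf _; rewrite /=.
      exact: ray_in_ball.
    by rewrite -derive_basis //; exact: is_derive_line.
  have := integral01_derive (@continuous01_sum _ _ (index_enum _) _ cw) dl.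
  rewrite scale1r scale0r addr0 [p + _]addrC subrK integral01_sum // => E.
  apply/eqP; rewrite addrC -subr_eq -E; apply/eqP; apply: eq_bigr => i _.
  rewrite integral01Z // /mean; congr (_ * _).
  by apply: eq_integral01 => t _; rewrite mul1r.
- rewrite /mean -[RHS]integral01_cst; apply: eq_integral01 => t _.
  by rewrite subrr scaler0 addr0 mul1r.
Qed.

End Hadamard.

(** * Smooth functions and bump functions on a manifold *)

Notation atlas_of M := (@charts _ _ M).

Section ManifoldTopology.
Context {R : realType} {n : nat} {M : manifold R n}.
Implicit Types (c d : chart R n M) (p q x y : M) (A B : set M) (f g : M -> R).

Definition mopen A := atlas_open (atlas_of M) A.

Lemma coordK c p : atlas_of M c -> dom c p -> icoord c (coord c p) = p.
Proof. by case/atlas_chart => _; exact. Qed.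

Lemma icoordP c z : atlas_of M c -> (coord c @` dom c) z ->
  dom c (icoord c z) /\ coord c (icoord c z) = z.
Proof. by move=> Mc [p cp <-]; rewrite coordK. Qed.

Lemma mopen_setT : mopen setT.
Proof. by move=> c Mc; rewrite setIT; exact: open_chart. Qed.

Lemma mopenI A B : mopen A -> mopen B -> mopen (A `&` B).
Proof.
move=> oA oB c Mc.
rewrite [X in open X](_ : _ = coord c @` (dom c `&` A) `&` coord c @` (dom c `&` B)).
  exact: openI (oA _ Mc) (oB _ Mc).
apply/seteqP; split=> [_ [p [cp [Ap Bp]] <-]|z [[p [cp Ap] pz] [q [cq Bq] qz]]].
  by split; exists p.
exists p => //; split=> //; split=> //.
by rewrite -(coordK Mc cp) pz -qz coordK.
Qed.

(** Read in another chart, the set is the preimage of [V] under a transition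
    map. *)
Lemma mopen_chart c V : atlas_of M c -> open V ->
  mopen [set x | dom c x /\ V (coord c x)].
Proof.
move=> Mc oV d Md; have [[oU sU] _] := atlas_compatible Md Mc.
rewrite [X in open X](_ : _ = coord d @` (dom d `&` dom c) `&`
    [set z | V (coord c (icoord d z))]); last first.
  apply/seteqP; split=> [_ [p [dp [cp Vp]] <-]|_ [[p [dp cp] <-]] /=].
    by split=> /=; [exists p|rewrite coordK].
  by rewrite coordK // => Vp; exists p.
rewrite openE => z [Uz Vz].
have cz : {for z, continuous (fun z => coord c (icoord d z))}.
  apply: differentiable_continuous; apply: differentiable_rV => j.
  exact: smooth_on_differentiable (sU j) Uz.
apply: filterI; first exact: open_nbhs_nbhs.
by apply: cz; exact: open_nbhs_nbhs.
Qed.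

Lemma mopen_dom c : atlas_of M c -> mopen (dom c).
Proof.
move=> Mc; have := mopen_chart Mc openT; congr mopen.
by apply/seteqP; split=> [x []|x cx].
Qed.

Lemma chart_at p : exists2 c, atlas_of M c & dom c p.
Proof. exact: atlas_cover. Qed.

(** Smoothness in a neighbourhood of [p], tested in one chart; by
    [smooth_at_chart] every chart around [p] gives the same notion. *)
Definition smooth_at f p := exists c V,
  [/\ atlas_of M c, dom c p, open V, V (coord c p) /\ V `<=` coord c @` dom c &
      smooth_on V (f \o icoord c)].

Lemma smooth_at_chart f p d A : smooth_at f p -> atlas_of M d -> dom d p ->
  mopen A -> A p -> exists V,
  [/\ open V, V (coord d p), V `<=` coord d @` (dom d `&` A) &
      smooth_on V (f \o icoord d)].
Proof.
move=> [c [V [Mc cp oV [Vp Vc] sf]]] Md dp oA Ap.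
have oW := mopenI oA (mopen_chart Mc oV).
set B := [set x | _ /\ _] in oW.
exists (coord d @` (dom d `&` (A `&` B))); split.
- exact: oW.
- by exists p.
- by move=> _ [x [dx [Ax Bx]] <-]; exists x.
have [[oU sU] _] := atlas_compatible Md Mc.
have oWd := oW _ Md.
apply: (@smooth_on_eq _ _ _ ((f \o icoord c) \o (coord c \o icoord d))) => //.
  move=> _ [x [dx [Ax [cx Vx]]] <-] /=.
  by rewrite (coordK Md dx) (coordK Mc cx).
apply: smooth_on_comp oWd _ _ sf => [_ [x [dx [Ax [cx Vx]]] <-] /=|j].
  by rewrite (coordK Md dx).
apply: smooth_onS (sU j) => _ [x [dx [Ax [cx Vx]]] <-].
by exists x.
Qed.

Lemma smoothP f : smooth f <-> forall p, smooth_at f p.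
Proof.
split=> [sf p|sf c Mc].
  have [c Mc cp] := chart_at p; exists c, (coord c @` dom c); split=> //.
  - exact: open_chart.
  - by split=> //; exists p.
  - exact: sf.
apply: smooth_on_local => _ [p cp <-].
have [V [oV Vp _ sV]] := smooth_at_chart (sf p) Mc cp mopen_setT I.
by exists V.
Qed.

Lemma smooth_smooth_at f p : smooth f -> smooth_at f p.
Proof. by move/smoothP. Qed.

Lemma smooth_at_eq A f g p : mopen A -> A p -> (forall x, A x -> f x = g x) ->
  smooth_at f p -> smooth_at g p.
Proof.
move=> oA Ap fg sf; have [c Mc cp] := chart_at p.
have [V [oV Vp VA sV]] := smooth_at_chart sf Mc cp oA Ap.
exists c, V; split=> //; first by split=> // z /VA[x [cx _] <-]; exists x.
apply: smooth_on_eq sV => // z /VA[x [cx Ax] <-] /=.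
by rewrite coordK // fg.
Qed.

Lemma smooth_at_comp k (F : 'rV[R]_k -> R) (V : set 'rV[R]_k) (u : M -> 'rV[R]_k) p :
  open V -> V (u p) -> smooth_on V F ->
  (forall j, smooth_at (fun x => u x 0 j) p) -> smooth_at (F \o u) p.
Proof.
move=> oV Vp sF su; have [c Mc cp] := chart_at p.
have /choice[W HW] j := smooth_at_chart (su j) Mc cp mopen_setT I.
pose S := [set z | forall j, W j z].
have nS : nbhs (coord c p) S.
  apply: (@filter_forall _ 'I_k W (nbhs (coord c p)) (nbhs_filter _)) => j.
  by case: (HW j) => oW Wp _ _; exact: open_nbhs_nbhs.
pose W0 := coord c @` dom c `&` S^°.
have oW0 : open W0 by apply: openI; [exact: open_chart|exact: open_interior].
have W0p : W0 (coord c p) by split=> //; exists p.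
have sW0 j : smooth_on W0 (fun z => u (icoord c z) 0 j).
  by case: (HW j) => _ _ _; apply: smooth_onS => z [_ /interior_subset].
have cu z : W0 z -> {for z, continuous (u \o icoord c)}.
  move=> Wz; apply: differentiable_continuous; apply: differentiable_rV => j.
  exact: smooth_on_differentiable (sW0 j) Wz.
pose W1 := W0 `&` (u \o icoord c) @^-1` V.
have oW1 : open W1.
  rewrite openE => z [Wz Vz]; apply: filterI; first exact: open_nbhs_nbhs.
  by apply: cu => //; exact: open_nbhs_nbhs.
exists c, W1; split=> //.
- split; last by move=> z [[]].
  by split=> //=; rewrite coordK.
- apply: (smooth_on_comp (p := u \o icoord c) oW1 _ _ sF) => [z []//|j].
  by apply: smooth_onS (sW0 j) => z [].
Qed.

Lemma smooth_at_cst a p : smooth_at (fun=> a) p.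
Proof. by apply: smooth_smooth_at; exact: smooth_cst. Qed.

Lemma smooth_atD f g p : smooth_at f p -> smooth_at g p ->
  smooth_at (fun x => f x + g x) p.
Proof.
move=> sf sg; have [c Mc cp] := chart_at p.
have [V [oV Vp Vc sV]] := smooth_at_chart sf Mc cp mopen_setT I.
have [W [oW Wp _ sW]] := smooth_at_chart sg Mc cp mopen_setT I.
have oVW := openI oV oW; exists c, (V `&` W); split=> //.
  by split=> // z [/Vc[x [cx _] <-] _]; exists x.
by apply: smooth_onD => //; [apply: smooth_onS sV|apply: smooth_onS sW] => z [].
Qed.

Lemma smooth_atM f g p : smooth_at f p -> smooth_at g p ->
  smooth_at (fun x => f x * g x) p.
Proof.
move=> sf sg; have [c Mc cp] := chart_at p.
have [V [oV Vp Vc sV]] := smooth_at_chart sf Mc cp mopen_setT I.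
have [W [oW Wp _ sW]] := smooth_at_chart sg Mc cp mopen_setT I.
have oVW := openI oV oW; exists c, (V `&` W); split=> //.
  by split=> // z [/Vc[x [cx _] <-] _]; exists x.
by apply: smooth_onM => //; [apply: smooth_onS sV|apply: smooth_onS sW] => z [].
Qed.

Lemma smooth_at_sum (J : Type) (r : seq J) (F : J -> M -> R) p :
  (forall i, smooth_at (F i) p) -> smooth_at (fun x => \sum_(i <- r) F i x) p.
Proof.
move=> sF; elim: r => [|i r IH].
  apply: smooth_at_eq mopen_setT I _ (smooth_at_cst 0 p) => x _.
  by rewrite big_nil.
apply: (smooth_at_eq (A := setT) mopen_setT I _ (smooth_atD (sF i) IH)) => x _.
by rewrite big_cons.
Qed.

Lemma smooth_at_coord c p j : atlas_of M c -> dom c p ->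
  smooth_at (fun x => coord c x 0 j) p.
Proof.
move=> Mc cp; exists c, (coord c @` dom c); split=> //.
- exact: open_chart.
- by split=> //; exists p.
- apply: smooth_on_eq (smooth_on_coord _ j); first exact: open_chart.
  by move=> _ [x cx <-] /=; rewrite coordK.
Qed.

(** The closed support of [f] lies in [A]: the complement of the support is
    the set of points near which [f] vanishes. *)
Definition supp_in f A := forall x, ~ A x ->
  exists B, [/\ mopen B, B x & forall y, B y -> f y = 0].

Lemma supp_in0 f A x : supp_in f A -> ~ A x -> f x = 0.
Proof. by move=> sA /sA[B [_ Bx]]; exact. Qed.

Lemma supp_inW f A x : supp_in f A -> f x != 0 -> A x.
Proof. by move=> sA fx; apply: contrapT => /(supp_in0 sA)/eqP; exact/negP. Qed.

Lemma cutoff_smooth (h g : M -> R) A : smooth h -> supp_in h A ->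
  (forall x, A x -> smooth_at g x) -> smooth (fun x => h x * g x).
Proof.
move=> sh sA sg; apply/smoothP => p; have [Ap|/sA[B [oB Bp B0]]] := pselect (A p).
  by apply: smooth_atM (sg _ Ap); exact: smooth_smooth_at.
apply: smooth_at_eq oB Bp _ (smooth_at_cst 0 p) => x /B0 ->.
by rewrite mul0r.
Qed.

(** The filter of neighbourhoods, which lets the compactness of a subset of a
    chart act on points of the manifold. *)
Definition mnbhs p : set_system M := fun B => exists A, [/\ mopen A, A p & A `<=` B].

Lemma mnbhs_filter p : Filter (mnbhs p).
Proof.
split.
- by exists setT; split => //; exact: mopen_setT.
- move=> A B [A' [oA Ap sA]] [B' [oB Bp sB]]; exists (A' `&` B'); split=> //.
    exact: mopenI.
  by move=> x [/sA ? /sB ?].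
- by move=> A B AB [A' [oA Ap sA]]; exists A'; split=> // x /sA /AB.
Qed.

(** A compact subset of a chart domain is closed in the manifold. The
    Hausdorff axiom separates [p] from each point of the set, and compactness
    makes one neighbourhood of [p] serve for all of them. *)
Lemma chart_compact_closed c (K : set 'rV[R]_n) p : atlas_of M c -> compact K ->
  K `<=` coord c @` dom c -> (forall z, K z -> icoord c z <> p) ->
  exists A, [/\ mopen A, A p & forall x, A x -> dom c x -> ~ K (coord c x)].
Proof.
move=> Mc /compact_near_coveringP cK Kc Kp.
have [|A [oA Ap AK]] := cK M (mnbhs p) (fun x z => icoord c z <> x) (mnbhs_filter p).
  move=> z Kz; have [A [B [oA oB Ap Bz AB]]] := atlas_hausdorff (structure M) (nesym (Kp _ Kz)).
  exists (coord c @` (dom c `&` B), A).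
    split=> /=; last by exists A; split.
    apply: open_nbhs_nbhs; split; first exact: oB.
    by have [cz zE] := icoordP Mc (Kc _ Kz); exists (icoord c z).
  move=> [w x] /= [[y [cy By] <-] Ax]; rewrite coordK // => yx.
  have ABx : (A `&` B) x by split=> //; case: _ / yx.
  by rewrite AB in ABx.
exists A; split=> // x Ax cx Kx; apply: (AK _ Ax _ Kx).
by rewrite coordK.
Qed.

(** The bump of [bump_rV] read in a chart and extended by 0. The extension is
    smooth at the boundary of the chart because the support, being compact, is
    closed in the whole manifold. *)
Lemma bump p A : mopen A -> A p -> exists (h : Cinf M) B,
  [/\ mopen B, B p, B `<=` A, forall x, B x -> h x = 1 & supp_in h A].
Proof.
move=> oA Ap; have [c Mc cp] := chart_at p.
have : nbhs (coord c p) (coord c @` (dom c `&` A)).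
  by apply: open_nbhs_nbhs; split; [exact: oA|exists p].
move=> /nbhs_normP[e /= e0 eA].
have e3 : 0 < e / 3 by rewrite divr_gt0.
have [b [sb b1 b0]] := bump_rV (coord c p) e3.
(* The radius 2 e / 3 keeps [K] inside the ball of radius e, itself in the image of [A]. *)
pose K := [set z | `|z - coord c p| <= (e / 3) *+ 2].
have KA : K `<=` coord c @` (dom c `&` A).
  move=> z Kz; apply: eA; rewrite /= distrC; apply: le_lt_trans Kz _.
  by rewrite mulr2n; lra.
have cK : compact K by exact: compact_closed_ball.
have zero x : ~ (dom c x /\ K (coord c x)) ->
    exists A0, [/\ mopen A0, A0 x & forall y, A0 y -> dom c y -> ~ K (coord c y)].
  move=> ncK; apply: chart_compact_closed => //.
    by move=> z /KA[y [cy _] <-]; exists y.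
  move=> z Kz zx; apply: ncK; rewrite -zx.
  have [|cz ->] := @icoordP c z Mc; first by have [y [cy _] <-] := KA _ Kz; exists y.
  by [].
pose h x := if `[< dom c x >] then b (coord c x) else 0.
have hK x : ~ (dom c x /\ K (coord c x)) -> h x = 0.
  rewrite /h; case: asboolP => // cx nK; apply/eqP; apply: contrapT => /negP /b0 bx.
  by apply: nK; split=> //; exact: ltW.
have hs : supp_in h (dom c `&` A).
  move=> x nx; have [|A0 [oA0 A0x A0K]] := zero x.
    move=> [cx Kx]; apply: nx.
    have [y [cy Ay] yx] := KA _ Kx.
    by rewrite -(coordK Mc cx) -yx coordK.
  by exists A0; split=> // y A0y; apply: hK => -[cy Ky]; exact: A0K A0y cy Ky.
have sh : smooth h.
  apply/smoothP => x; have [cx|ncx] := pselect (dom c x).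
    have sb' : smooth_at (b \o coord c) x.
      by apply: smooth_at_comp openT I sb _ => j; exact: smooth_at_coord Mc cx.
    apply: smooth_at_eq (mopen_dom Mc) cx _ sb' => y cy /=.
    by rewrite /h asboolT.
  have [|B [oB Bx B0]] := hs x; first by case.
  apply: smooth_at_eq oB Bx _ (smooth_at_cst 0 x) => y By.
  by rewrite B0.
exists (mkCinf sh), [set x | dom c x /\ `|coord c x - coord c p| < e / 3]; split.
- apply: (mopen_chart (V := [set z | `|z - coord c p| < e / 3])) => //.
  rewrite (_ : mkset _ = ball (coord c p) (e / 3)); first exact: ball_open.
  by apply/seteqP; split=> z; rewrite -ball_normE /= distrC.
- by split=> //; rewrite subrr normr0.
- move=> x [cx xe]; have [|y [cy Ay] yx] := KA (coord c x).
    by apply: ltW; apply: lt_trans xe _; rewrite mulr2n ltrDl.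
  by rewrite -(coordK Mc cx) -yx coordK.
- by move=> x [cx xe] /=; rewrite /h asboolT // b1 // ltW.
- by move=> x nA; apply: hs => -[].
Qed.

End ManifoldTopology.
Arguments mopen {R n} M A.

Lemma smooth_at_map {R : realType} {n k} {M : manifold R n} {N : manifold R k}
    (h : N -> M) (f : M -> R) (q : N) c A :
  smooth_at f (h q) -> atlas_of M c -> dom c (h q) ->
  mopen N A -> A q -> (forall x, A x -> dom c (h x)) ->
  (forall j, smooth_at (fun x => coord c (h x) 0 j) q) -> smooth_at (f \o h) q.
Proof.
move=> sf Mc ch oA Aq Ac sh.
have [V [oV Vp Vc sV]] := smooth_at_chart sf Mc ch mopen_setT I.
apply: smooth_at_eq oA Aq _ (smooth_at_comp (u := fun x => coord c (h x)) oV Vp sV sh).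
by move=> x Ax /=; rewrite coordK //; exact: Ac.
Qed.

(** * Tangent vectors in coordinates *)

Section TangentVectors.
Context {R : realType} {n : nat} {M : manifold R n}.
Implicit Types (c : chart R n M) (p q x y : M) (A B : set M) (f g : Cinf M).

Lemma CinfD f g p : (f + g) p = f p + g p. Proof. by []. Qed.
Lemma CinfM f g p : (f * g) p = f p * g p. Proof. by []. Qed.
Lemma CinfN f p : (- f) p = - f p. Proof. by []. Qed.
Lemma CinfB f g p : (f - g) p = f p - g p. Proof. by []. Qed.
Lemma Cinf0 p : (0 : Cinf M) p = 0. Proof. by []. Qed.

Lemma Cinf_sum (J : Type) (r : seq J) (F : J -> Cinf M) p :
  (\sum_(j <- r) F j) p = \sum_(j <- r) F j p.
Proof. by elim: r => [|j r IH]; rewrite ?big_nil ?big_cons // CinfD IH. Qed.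

Section At.
Context {p : M}.
Implicit Types u v : tangent p.

Lemma tangentD v f g : v (f + g) = v f + v g.
Proof. by have [/(_ 1 f g)] := tangent_derivation v; rewrite !scale1r. Qed.

Lemma tangentM v f g : v (f * g) = f p * v g + g p * v f.
Proof. by have [_] := tangent_derivation v; exact. Qed.

Lemma tangent_cst v k : v (cst_Cinf M k) = 0.
Proof.
have [vZ _] := tangent_derivation v.
have v1 : v (cst_Cinf M 1) = 0.
  have E : cst_Cinf M 1 = cst_Cinf M 1 * cst_Cinf M 1.
    by apply: CinfP => x /=; rewrite mulr1.
  have := tangentM v (cst_Cinf M 1) (cst_Cinf M 1).
  rewrite -E /= !mul1r => /eqP; rewrite -subr_eq0 opprD addrA subrr sub0r oppr_eq0.
  by move/eqP.
have -> : cst_Cinf M k = k *: cst_Cinf M 1 + 0.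
  by apply: CinfP => x; rewrite CinfD /= mulr1 addr0.
rewrite vZ v1 [k *: (0 : R^o)]mulr0 add0r.
by have := vZ (-1) 0 0; rewrite scaler0 addr0 scaleN1r addNr.
Qed.

Lemma tangent0 v : v 0 = 0.
Proof. by rewrite -(tangent_cst v 0); congr (v _); apply: CinfP. Qed.

Lemma tangentN v f : v (- f) = - v f.
Proof. by apply/eqP; rewrite -addr_eq0 -tangentD addNr tangent0. Qed.

Lemma tangentB v f g : v (f - g) = v f - v g.
Proof. by rewrite tangentD tangentN. Qed.

Lemma tangent_sum v (J : Type) (r : seq J) (F : J -> Cinf M) :
  v (\sum_(j <- r) F j) = \sum_(j <- r) v (F j).
Proof.
by elim: r => [|j r IH]; rewrite ?big_nil ?big_cons ?tangent0 // tangentD IH.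
Qed.

Lemma tan_addE u v f : (u + v) f = u f + v f. Proof. by []. Qed.
Lemma tan_scaleE k v f : (k *: v) f = k * v f. Proof. by []. Qed.
Lemma tan_oppE v f : (- v) f = - v f.
Proof. by rewrite -scaleN1r tan_scaleE mulN1r. Qed.
Lemma tan_zeroE f : (0 : tangent p) f = 0. Proof. by []. Qed.
Lemma tan_sumE (J : Type) (r : seq J) (F : J -> tangent p) f :
  (\sum_(j <- r) F j) f = \sum_(j <- r) F j f.
Proof. by elim: r => [|j r IH]; rewrite ?big_nil ?big_cons // tan_addE IH. Qed.

(** Apply the vector to [f - g] multiplied by a bump function supported where
    it vanishes. *)
Lemma tangent_local v A f g : mopen M A -> A p -> (forall x, A x -> f x = g x) ->
  v f = v g.
Proof.
move=> oA Ap fg; have [h [B [oB Bp BA h1 hs]]] := bump oA Ap.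
have : h * (f - g) = 0.
  apply: CinfP => x; rewrite CinfM CinfB Cinf0.
  have [/fg ->|nAx] := pselect (A x); first by rewrite subrr mulr0.
  by rewrite (supp_in0 hs nAx) mul0r.
move/(congr1 v); rewrite tangentM tangent0 h1 // mul1r CinfB fg // subrr mul0r addr0.
by rewrite tangentB => /eqP; rewrite subr_eq0 => /eqP.
Qed.

Lemma tangentM0 v h f : f p = 0 -> v (h * f) = h p * v f.
Proof. by move=> f0; rewrite tangentM f0 mul0r addr0. Qed.

(** By Hadamard's lemma, f - f p is a combination of the X_j - X_j p with
    smooth coefficients near [p]. Multiplied by h^2 for a bump function [h], this
    becomes an identity of global functions: one factor [h] extends the
    coefficients, the other one the coordinates. A derivation at [p] only
    differentiates the factors that vanish at [p]. *)
Lemma tangent_coord v c (X : 'I_n -> Cinf M) B f : atlas_of M c -> dom c p ->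
  mopen M B -> B p -> (forall j x, B x -> X j x = coord c x 0 j) ->
  v f = \sum_j v (X j) * 'D_(delta_mx 0 j) (f \o icoord c) (coord c p).
Proof.
move=> Mc cp oB Bp XB; set z0 := coord c p.
have : nbhs z0 (coord c @` (dom c `&` B)).
  by apply: open_nbhs_nbhs; split; [exact: oB|exists p].
move=> /nbhs_normP[e /= e0 eA].
have eA' z : `|z - z0| < e -> (coord c @` (dom c `&` B)) z.
  by move=> ze; apply: eA; rewrite /= distrC.
have sf : smooth_on [set z | `|z - z0| < e] (f \o icoord c).
  by apply: smooth_onS (Cinf_smooth f Mc) => z /eA'[x [cx _] <-]; exists x.
have de : e / 2 < e by lra.
have d0 : 0 < e / 2 by lra.
have [g [sg fE g0]] := hadamard de sf.
pose A := [set x | dom c x /\ `|coord c x - z0| < e / 2].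
have oball : open [set z : 'rV[R]_n | `|z - z0| < e / 2].
  rewrite (_ : mkset _ = ball z0 (e / 2)); first exact: ball_open.
  by apply/seteqP; split=> z; rewrite -ball_normE /= distrC.
have oA : mopen M A by exact: mopen_chart Mc oball.
have Ap : A p by split=> //; rewrite subrr normr0.
have AB x : A x -> B x.
  move=> [cx xd]; have [|y [cy By] yx] := eA' (coord c x); first exact: lt_trans xd de.
  by rewrite -(coordK Mc cx) -yx coordK.
have [h [A' [_ A'p _ h1 hs]]] := bump oA Ap.
have sG j : smooth (fun x => h x * g j (coord c x)).
  apply: cutoff_smooth hs _ => [|x [cx xd]]; first exact: Cinf_smooth.
  apply: (smooth_at_comp (u := coord c) oball xd (sg j)) => k.
  exact: smooth_at_coord Mc cx.
have hp : h p = 1 by exact: h1.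
have E : (h * h) * (f - cst_Cinf M (f p)) =
    \sum_j (mkCinf (sG j)) * (h * (X j - cst_Cinf M (z0 0 j))).
  apply: CinfP => x; rewrite Cinf_sum !CinfM CinfB.
  have [Ax|nAx] := pselect (A x); last first.
    rewrite (supp_in0 hs nAx) !mul0r big1 // => j _.
    by rewrite CinfM /= (supp_in0 hs nAx) !mul0r.
  have [cx xd] := Ax; have := fE _ xd.
  rewrite [(f \o _) _]/= [(f \o _) z0]/= (coordK Mc cx) (coordK Mc cp) => ->.
  rewrite [cst_Cinf M (f p) x]/= addrC addKr mulr_sumr; apply: eq_bigr => j _.
  by rewrite !CinfM CinfB (XB j x (AB x Ax)) !mxE /=; ring.
move/(congr1 v): E; rewrite tangentM0; last by rewrite CinfB /= subrr.
rewrite CinfM hp !mul1r tangentB tangent_cst subr0 tangent_sum => ->.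
apply: eq_bigr => j _; rewrite tangentM0; last first.
  by rewrite CinfM CinfB /= XB // subrr mulr0.
rewrite /= hp mul1r g0 tangentM0; last by rewrite CinfB /= XB // subrr.
by rewrite hp mul1r tangentB tangent_cst subr0 mulrC.
Qed.

End At.

Lemma chart_coords c p : atlas_of M c -> dom c p ->
  exists (X : 'I_n -> Cinf M) B, [/\ mopen M B, B p, B `<=` dom c &
    forall j x, B x -> X j x = coord c x 0 j].
Proof.
move=> Mc cp; have [h [B [oB Bp BA h1 hs]]] := bump (mopen_dom Mc) cp.
have sX j : smooth (fun x => h x * coord c x 0 j).
  apply: cutoff_smooth hs _ => [|x cx]; first exact: Cinf_smooth.
  exact: smooth_at_coord Mc cx.
exists (fun j => mkCinf (sX j)), B; split=> // j x Bx /=.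
by rewrite h1 // mul1r.
Qed.

Lemma smooth_at_partial c p f j : atlas_of M c -> dom c p ->
  smooth_at (fun x => 'D_(delta_mx 0 j) (f \o icoord c) (coord c x)) p.
Proof.
move=> Mc cp.
have sD := smooth_on_derive (delta_mx 0 j) (Cinf_smooth f Mc).
apply: (smooth_at_comp (u := coord c) (open_chart Mc) _ sD) => [|k].
  by exists p.
exact: smooth_at_coord Mc cp.
Qed.

(** The factor [k] is the value at [x] of a cut-off function; where it is 0
    the point may lie outside the chart. *)
Lemma chart_derivation c x (k : R) (u : 'rV[R]_n) : atlas_of M c -> (k != 0 -> dom c x) ->
  derivation_at x (fun f : Cinf M => k * 'D_u (f \o icoord c) (coord c x)).
Proof.
move=> Mc kx; have [->|k0] := eqVneq k 0.
  by split=> [a f g|f g]; rewrite !mul0r ?mulr0 ?addr0 // [_ *: _]mulr0.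
have cx := kx k0.
have df f : derivable (f \o icoord c) (coord c x) u.
  apply: diff_derivable; apply: smooth_on_differentiable (Cinf_smooth f Mc) _.
  by exists x.
split=> [a f g|f g].
  have -> : (a *: f + g : Cinf M) \o icoord c = a *: (f \o icoord c) + (g \o icoord c) by [].
  rewrite deriveD //; last exact: derivableZ.
  by rewrite deriveZ // /GRing.scale /=; ring.
have -> : (f * g : Cinf M) \o icoord c = (f \o icoord c) * (g \o icoord c) by [].
rewrite deriveM // /GRing.scale /= coordK //; ring.
Qed.

(** The coordinate fields of a chart, cut off by a bump function. *)
Lemma tangent_frame p : exists (X : 'I_n -> Cinf M) (d : 'I_n -> vector_field M) A,
  [/\ mopen M A, A p,
      forall x, A x -> forall v : tangent x, v = \sum_j v (X j) *: (d j x : tangent x) &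
      forall x, A x -> forall j k, (d j x : tangent x) (X k) = (j == k)%:R].
Proof.
have [c Mc cp] := chart_at p.
have [X [B [oB Bp Bc XB]]] := chart_coords Mc cp.
have [h [C [oC Cp CA h1 hs]]] := bump (mopen_dom Mc) cp.
have hc x : h x != 0 -> dom c x by exact: supp_inW hs.
have dd x j := chart_derivation (delta_mx 0 j) Mc (hc x).
have sd j : @smooth_vector_field R n M (fun x => mkTangent (dd x j)).
  move=> f; apply: cutoff_smooth hs _ => [|x cx]; first exact: Cinf_smooth.
  exact: smooth_at_partial.
pose d j : vector_field M := @MkSection _ _ _ (TM M) _ (sd j).
exists X, d, (B `&` C); split=> //; first exact: mopenI.
  move=> x [Bx Cx] v; apply: tangentP => f; rewrite tan_sumE.
  rewrite (tangent_coord v f Mc (Bc _ Bx) oB Bx XB); apply: eq_bigr => j _.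
  by rewrite tan_scaleE /= h1 // mul1r.
move=> x [Bx Cx] j k /=; rewrite h1 // mul1r.
have -> : 'D_(delta_mx 0 j) (X k \o icoord c) (coord c x) =
    'D_(delta_mx 0 j) (fun z : 'rV[R]_n => z 0 k) (coord c x).
  apply: near_eq_derive.
  have : nbhs (coord c x) (coord c @` (dom c `&` B)).
    by apply: open_nbhs_nbhs; split; [exact: oB|exists x => //; split=> //; exact: Bc].
  by apply: filterS => _ [y [cy By] <-] /=; rewrite coordK // XB.
by rewrite derive_coord mxE eqxx eq_sym.
Qed.

Lemma vector_field_through p (v : tangent p) : exists Z : vector_field M, Z p = v.
Proof.
have [X [d [A [oA Ap vE dX]]]] := tangent_frame p.
exists (\sum_j mul_section (cst_Cinf M (v (X j))) (d j)).
rewrite [RHS](vE p Ap).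
elim: (index_enum _) => [|j r IH]; rewrite ?big_nil ?big_cons //.
by rewrite -IH.
Qed.

End TangentVectors.

(** * The total space of a vector bundle *)

Lemma mopen_local {R : realType} {n} {M : manifold R n} (A : set M) :
  (forall p, A p -> exists B, [/\ mopen M B, B p & B `<=` A]) -> mopen M A.
Proof.
move=> loc c Mc; rewrite openE => _ [p [cp Ap] <-].
have [B [oB Bp BA]] := loc p Ap.
apply: filterS (open_nbhs_nbhs (conj (oB c Mc) _)); last by exists p.
by move=> _ [x [cx Bx] <-]; exists x => //; split=> //; exact: BA.
Qed.

Section TotalSpace.
Context {R : realType} {n : nat} {M : manifold R n} {r : nat}.
Context {E : vector_bundle M r}.
Implicit Types (f g : Cinf M) (F G : Cinf (total_space E)).
Implicit Types (s : sections (vsbundle E)).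

Local Notation P := (total_space E).
Local Notation trivialization := (local_trivialization (total_structure E)).

Definition pr (q : P) : M := projT1 q.
Definition pt m (e : vfiber E m) : P := existT _ m e.

Lemma bundle_chartP c t t' : trivialization c t t' ->
  atlas_of P (bundle_chart c t t').
Proof. by case. Qed.

Lemma base_chart c t t' : trivialization c t t' -> atlas_of M c.
Proof. by case. Qed.

Section Trivialized.
Context {c : chart R n M}.
Context {t : forall m, vfiber E m -> 'rV[R]_r} {t' : forall m, 'rV[R]_r -> vfiber E m}.
Hypothesis lt : trivialization c t t'.

Lemma triv_linear m : dom c m -> linear (@t m).
Proof. by case: lt => _ tl _ /tl[]. Qed.

Lemma trivK m : dom c m -> cancel (@t m) (@t' m).
Proof. by case: lt => _ tl _ /tl[]. Qed.

Lemma trivK' m : dom c m -> cancel (@t' m) (@t m).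
Proof. by case: lt => _ tl _ /tl[]. Qed.

Lemma triv0 m : dom c m -> t (0 : vfiber E m) = 0.
Proof.
move=> cm; have := triv_linear cm (-1) 0 0.
by rewrite scaler0 addr0 scaleN1r addNr.
Qed.

Lemma trivD m (u v : vfiber E m) : dom c m -> t (u + v) = t u + t v.
Proof. by move=> cm; have := triv_linear cm 1 u v; rewrite !scale1r. Qed.

Lemma trivZ m a (u : vfiber E m) : dom c m -> t (a *: u) = a *: t u.
Proof. by move=> cm; have := triv_linear cm a u 0; rewrite triv0 // !addr0. Qed.

Lemma smooth_at_fibre_coord q j : dom c (pr q) ->
  smooth_at (fun q : P => t (projT2 q) 0 j) q.
Proof.
move=> cq; have Pc := bundle_chartP lt.
apply: smooth_at_eq (mopen_setT (M := P)) Logic.I _ (smooth_at_coord (rshift n j) Pc (p := q) cq).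
by move=> x _ /=; rewrite row_mxEr.
Qed.

Lemma smooth_at_base_coord q j : dom c (pr q) ->
  smooth_at (fun q : P => coord c (pr q) 0 j) q.
Proof.
move=> cq; have Pc := bundle_chartP lt.
apply: smooth_at_eq (mopen_setT (M := P)) Logic.I _ (smooth_at_coord (lshift r j) Pc (p := q) cq).
by move=> x _ /=; rewrite row_mxEl.
Qed.

Lemma smooth_at_pullback (f : M -> R) (q : P) : dom c (pr q) ->
  smooth_at f (pr q) -> smooth_at (f \o pr) q.
Proof.
move=> cq sf; have Pc := bundle_chartP lt.
have oA := mopen_dom Pc.
apply: (smooth_at_map (h := pr) sf (base_chart lt) cq oA) => // j.
exact: smooth_at_base_coord.
Qed.

Lemma smooth_at_along (u : forall m, vfiber E m) (F : P -> R) m : dom c m ->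
  (forall j, smooth_at (fun m => t (u m) 0 j) m) -> smooth_at F (pt (u m)) ->
  smooth_at (fun m => F (pt (u m))) m.
Proof.
move=> cm su sF; have Pc := bundle_chartP lt; have Mc := base_chart lt.
apply: (smooth_at_map (h := fun m => pt (u m)) sF Pc cm (mopen_dom Mc)) => // j.
rewrite /=; case: (splitP j) => k jk.
  have -> : j = lshift r k by exact: val_inj.
  apply: smooth_at_eq mopen_setT Logic.I _ (smooth_at_coord k Mc cm) => x _.
  by rewrite row_mxEl.
have -> : j = rshift n k by exact: val_inj.
apply: smooth_at_eq mopen_setT Logic.I _ (su k) => x _.
by rewrite row_mxEr.
Qed.

Lemma smooth_at_section s m j : dom c m -> smooth_at (fun m => t (s m) 0 j) m.
Proof.
move=> cm; have Mc := base_chart lt.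
exists c, (coord c @` dom c); split=> //.
- exact: open_chart.
- by split=> //; exists m.
- exact: ((section_smooth s : smooth_vsection s) _ _ _ lt j).
Qed.

End Trivialized.

Lemma triv_at m : exists c t t', trivialization c t t' /\ dom c m.
Proof. exact: locally_trivial. Qed.

(** A change of trivialization is part of a transition map of the total
    space, so it transports smoothness of the components. *)
Lemma smooth_vsection_local (u : forall m, vfiber E m) :
  (forall m, exists c t t', [/\ trivialization c t t', dom c m &
     forall j, smooth_at (fun m => t m (u m) 0 j) m]) -> smooth_vsection u.
Proof.
move=> loc c2 t2 t2' lt2 j; have Mc2 := base_chart lt2.
apply: smooth_on_local => _ [m c2m <-].
have [c [t [t' [lt cm su]]]] := loc m.
have su2 : smooth_at (fun m => t2 m (u m) 0 j) m.
  apply: (smooth_at_along (F := fun q => t2 (pr q) (projT2 q) 0 j) lt cm su).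
  exact: (smooth_at_fibre_coord lt2).
have [V [oV Vm _ sV]] := smooth_at_chart su2 Mc2 c2m mopen_setT Logic.I.
by exists V.
Qed.

Lemma smooth_pullback f : smooth (f \o pr).
Proof.
apply/smoothP => q; have [c [t [t' [lt cq]]]] := triv_at (pr q).
by apply: (smooth_at_pullback lt cq); apply: smooth_smooth_at; exact: Cinf_smooth.
Qed.

Definition pullback f : Cinf P := mkCinf (smooth_pullback f).

Lemma smooth_restrict s F : smooth (fun m => F (pt (s m))).
Proof.
apply/smoothP => m; have [c [t [t' [lt cm]]]] := triv_at m.
apply: (smooth_at_along lt cm) => [j|]; first exact: (smooth_at_section lt).
by apply: smooth_smooth_at; exact: Cinf_smooth.
Qed.

(** The pull-back s^* F. *)
Definition restrict s F : Cinf M := mkCinf (smooth_restrict s F).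

Lemma mopen_pr (A : set M) : mopen M A -> mopen P (pr @^-1` A).
Proof.
move=> oA; apply: mopen_local => q Aq.
have [c [t [t' [lt cq]]]] := triv_at (pr q).
have Mc := base_chart lt; have Pc := bundle_chartP lt.
pose V : set 'rV[R]_(n + r) := lsubmx @^-1` (coord c @` (dom c `&` A)).
have oV : open V.
  rewrite openE => z Vz; have cz : {for z, continuous (@lsubmx R 1 n r)}.
    by apply: differentiable_continuous; exact: differentiable_lsubmx.
  by apply: cz; apply: open_nbhs_nbhs; split=> //; exact: oA.
exists [set x | dom c (pr x) /\ V (coord (bundle_chart c t t') x)]; split.
- exact: mopen_chart Pc oV.
- by split=> //; rewrite /V /= row_mxKl; exists (pr q).
- move=> x [cx]; rewrite /V /= row_mxKl => -[m [cm Am] mx].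
  have E' : m = pr x by rewrite -(coordK Mc cm) mx coordK.
  by rewrite /= -E'.
Qed.

Lemma supp_in_pr (h : M -> R) (A : set M) : supp_in h A -> supp_in (h \o pr) (pr @^-1` A).
Proof.
move=> hs q /= nA; have [B [oB Bq B0]] := hs _ nA.
by exists (pr @^-1` B); split=> //; [exact: mopen_pr|move=> x /B0].
Qed.

(** The fibre coordinates dual to the frame are taken as smooth functions on
    the total space, so that tangent vectors of the total space act on them and
    their pull-backs by a section are its components. *)
Definition fibre_frame (A : set M) (e : 'I_r -> sections (vsbundle E))
    (Y : 'I_r -> Cinf P) :=
  forall m, A m -> [/\ forall k, linear (fun w : vfiber E m => Y k (pt w) : R^o),
    forall w : vfiber E m, w = \sum_k Y k (pt w) *: (e k m : vfiber E m) &
    forall j k, Y j (pt (e k m)) = (j == k)%:R].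

(** The trivialization links [Y] to the charts of the total space. *)
Definition local_frame (A : set M) e (Y : 'I_r -> Cinf P) :=
  [/\ mopen M A, fibre_frame A e Y & exists c t t',
    [/\ trivialization c t t', A `<=` dom c &
      forall q k, A (pr q) -> Y k q = t (pr q) (projT2 q) 0 k]].

Lemma local_frame_at m0 : exists A e Y, A m0 /\ local_frame A e Y.
Proof.
have [c [t [t' [lt cm0]]]] := triv_at m0.
have Mc := base_chart lt.
have [h [A [oA Am0 Ac h1 hs]]] := bump (mopen_dom Mc) cm0.
have se k : smooth_vsection (fun m => h m *: t' m (delta_mx 0 k) : vfiber E m).
  apply: smooth_vsection_local => m.
  have [cm|ncm] := pselect (dom c m).
    exists c, t, t'; split=> // j.
    have sh : smooth_at (fun x => h x * (delta_mx 0 k : 'rV[R]_r) 0 j) m.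
      by apply: smooth_atM (smooth_at_cst _ _); apply: smooth_smooth_at; exact: Cinf_smooth.
    apply: smooth_at_eq (mopen_dom Mc) cm _ sh => x cx.
    by rewrite (trivZ lt) // (trivK' lt) // [RHS]mxE.
  have [B [oB Bm B0]] := hs _ ncm.
  have [c2 [t2 [t2' [lt2 c2m]]]] := triv_at m.
  exists c2, t2, t2'; split=> // j.
  have oB2 := mopenI oB (mopen_dom (base_chart lt2)).
  apply: smooth_at_eq oB2 (conj Bm c2m) _ (smooth_at_cst 0 m) => x [Bx c2x].
  by rewrite B0 // scale0r (triv0 lt2) // mxE.
have sY k : smooth (fun q : P => h (pr q) * t (pr q) (projT2 q) 0 k).
  apply: cutoff_smooth (supp_in_pr hs) _; first exact: smooth_pullback.
  by move=> q /= cq; exact: (smooth_at_fibre_coord lt).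
exists A, (fun k => @MkSection _ _ _ (vsbundle E) _ (se k)), (fun k => mkCinf (sY k)).
split=> //; split=> //; last first.
  by exists c, t, t'; split=> // q k Aq /=; rewrite h1 // mul1r.
move=> m Am; have cm := Ac _ Am; have hm := h1 _ Am; split=> /=.
- by move=> k a u v; rewrite /= hm !mul1r (triv_linear lt) // !mxE.
- move=> w; apply: (can_inj (trivK lt cm)).
  have tsum (J : Type) (l : seq J) (G : J -> vfiber E m) :
      t m (\sum_(j <- l) G j) = \sum_(j <- l) t m (G j).
    elim: l => [|j l IH]; rewrite ?big_nil ?big_cons ?(triv0 lt) //.
    by rewrite (trivD lt) // IH.
  rewrite tsum {1}(row_sum_delta (t m w)); apply: eq_bigr => k _.
  by rewrite !(trivZ lt) // (trivK' lt) // hm mul1r scale1r.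
- by move=> j k; rewrite hm mul1r scale1r (trivK' lt) // mxE eqxx.
Qed.

Lemma section_through m (w : vfiber E m) : exists s, s m = w.
Proof.
have [A [e [Y [Am [_ fr _]]]]] := local_frame_at m.
have [_ wE _] := fr m Am.
exists (\sum_k mul_section (cst_Cinf M (Y k (pt w))) (e k)).
rewrite [RHS]wE; elim: (index_enum _) => [|j l IH]; rewrite ?big_nil ?big_cons //.
by rewrite -IH.
Qed.

(** The coordinates of a bundle chart are functions of these two kinds, so
    [tangent_coord] applies. The identities between tangent vectors of the total
    space are proved by this test. *)
Lemma tangent_total_ext (q : P) (u v : tangent q) A e Y :
  local_frame A e Y -> A (pr q) ->
  (forall f, u (pullback f) = v (pullback f)) -> (forall k, u (Y k) = v (Y k)) ->
  u = v.
Proof.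
move=> [oA fr [c [t [t' [lt Ac Yt]]]]] Aq uvf uvY; apply: tangentP => F.
have Mc := base_chart lt; have Pc := bundle_chartP lt.
have [X [B [oB Bq Bc XB]]] := chart_coords Mc (Ac _ Aq).
pose Z (a : 'I_(n + r)) : Cinf P :=
  match fintype.split a with inl j => pullback (X j) | inr k => Y k end.
have oAB := mopen_pr (mopenI oA oB).
have ZE a x : (pr @^-1` (A `&` B)) x -> Z a x = coord (bundle_chart c t t') x 0 a.
  move=> [Ax Bx]; rewrite /Z /= mxE; case: (fintype.split a) => k /=.
    by rewrite XB.
  by rewrite Yt.
have cq : dom (bundle_chart c t t') q by exact: Ac.
rewrite (tangent_coord u F Pc cq oAB (conj Aq Bq) ZE).
rewrite (tangent_coord v F Pc cq oAB (conj Aq Bq) ZE).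
by apply: eq_bigr => a _; rewrite /Z; case: (fintype.split a) => k; rewrite ?uvf ?uvY.
Qed.

Lemma smooth_at_field (V : forall q : P, tangent q) (q : P) A e Y :
  local_frame A e Y -> A (pr q) ->
  (forall f, smooth_at (fun x => V x (pullback f)) q) ->
  (forall k, smooth_at (fun x => V x (Y k)) q) ->
  forall F, smooth_at (fun x => V x F) q.
Proof.
move=> [oA fr [c [t [t' [lt Ac Yt]]]]] Aq sVf sVY F.
have Mc := base_chart lt; have Pc := bundle_chartP lt.
have [X [B [oB Bq Bc XB]]] := chart_coords Mc (Ac _ Aq).
pose Z (a : 'I_(n + r)) : Cinf P :=
  match fintype.split a with inl j => pullback (X j) | inr k => Y k end.
have oAB := mopen_pr (mopenI oA oB).
have ZE a x : (pr @^-1` (A `&` B)) x -> Z a x = coord (bundle_chart c t t') x 0 a.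
  move=> [Ax Bx]; rewrite /Z /= mxE; case: (fintype.split a) => k /=.
    by rewrite XB.
  by rewrite Yt.
have cq x : (pr @^-1` (A `&` B)) x -> dom (bundle_chart c t t') x.
  by move=> [Ax _]; exact: Ac.
have sV a : smooth_at (fun x => V x (Z a)) q.
  by rewrite /Z; case: (fintype.split a).
have ABq : (pr @^-1` (A `&` B)) q by [].
apply: (smooth_at_eq oAB ABq _ (smooth_at_sum (index_enum _)
  (fun a => smooth_atM (sV a) (smooth_at_partial F a Pc (cq _ ABq))))) => x ABx.
by rewrite (tangent_coord (V x) F Pc (cq _ ABx) oAB ABx ZE).
Qed.

End TotalSpace.

(** * Sections and vector fields at a point *)

Section SectionsAndFields.
Context {R : realType} {n : nat} {M : manifold R n}.
Implicit Types (f g : Cinf M) (X Z : vector_field M).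

Lemma section_addE {B : sbundle M} (a b : sections B) m : (a + b) m = a m + b m.
Proof. by []. Qed.

Lemma section_mulE {B : sbundle M} f (a : sections B) m : mul_section f a m = f m *: a m.
Proof. by []. Qed.

Lemma section_oppE {B : sbundle M} (a : sections B) m : (- a) m = - a m.
Proof. by rewrite -scaleN1r. Qed.

Lemma section_subE {B : sbundle M} (a b : sections B) m : (a - b) m = a m - b m.
Proof. by rewrite section_addE section_oppE. Qed.

Lemma section_sumE {B : sbundle M} (J : Type) (l : seq J) (G : J -> sections B) m :
  (\sum_(j <- l) G j) m = \sum_(j <- l) G j m.
Proof. by elim: l => [|j l IH]; rewrite ?big_nil ?big_cons // section_addE IH. Qed.

Lemma mul_section1 {B : sbundle M} (a : sections B) : mul_section 1 a = a.
Proof. by apply: sectionP => x /=; rewrite scale1r. Qed.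

Lemma actE X f p :
  act X f p = (X p : tangent p) f.
Proof. by []. Qed.

Lemma actD X f g : act X (f + g) = act X f + act X g.
Proof. by apply: CinfP => p; rewrite actE tangentD. Qed.
Lemma actM X f g : act X (f * g) = f * act X g + g * act X f.
Proof. by apply: CinfP => p; rewrite actE tangentM. Qed.
Lemma actN X f : act X (- f) = - act X f.
Proof. by apply: CinfP => p; rewrite actE tangentN. Qed.
Lemma actDl X Z f : act (X + Z) f = act X f + act Z f.
Proof. exact: CinfP. Qed.
Lemma actMl X f g : act (mul_section f X) g = f * act X g.
Proof. exact: CinfP. Qed.
Lemma actNl X f : act (- X) f = - act X f.
Proof. by apply: CinfP => p; rewrite actE section_oppE tan_oppE. Qed.
Lemma actBl X Z f : act (X - Z) f = act X f - act Z f.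
Proof. by rewrite actDl actNl. Qed.
Lemma act_lie X Z f : act (lie X Z) f = act X (act Z f) - act Z (act X f).
Proof. exact: CinfP. Qed.

Lemma act_inj X Z : (forall f, act X f = act Z f) -> X = Z.
Proof.
move=> XZ; apply: sectionP => p; apply: tangentP => f.
by have := congr1 (fun g : Cinf M => g p) (XZ f).
Qed.

End SectionsAndFields.

(** * Vertical vectors and vertical lifts *)

Section VerticalVectors.
Context {R : realType} {n : nat} {M : manifold R n} {r : nat}.
Context {E : vector_bundle M r}.
Implicit Types (f g : Cinf M) (F G : Cinf (total_space E)).
Implicit Types (s u : sections (vsbundle E)) (m : M).

Local Notation P := (total_space E).
Local Notation trivialization := (local_trivialization (total_structure E)).

Section Frame.
Context {A : set M} {e : 'I_r -> sections (vsbundle E)} {Y : 'I_r -> Cinf P}.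
Hypothesis lf : local_frame A e Y.

Lemma frame_open : mopen M A. Proof. by case: lf. Qed.

Context {m : M}.
Hypothesis Am : A m.
Implicit Types v w : vfiber E m.

Lemma frame_expand w : w = \sum_k Y k (pt w) *: (e k m : vfiber E m).
Proof. by have [_ /(_ _ Am)[]] := lf. Qed.

Lemma frame_delta j k : Y j (pt (e k m)) = (j == k)%:R.
Proof. by have [_ /(_ _ Am)[]] := lf. Qed.

Lemma frame_coordP k a v w : Y k (pt (a *: v + w)) = a * Y k (pt v) + Y k (pt w).
Proof. by have [_ /(_ _ Am)[-> _ _]] := lf. Qed.

Lemma frame_coordD k v w : Y k (pt (v + w)) = Y k (pt v) + Y k (pt w).
Proof. by have := frame_coordP k 1 v w; rewrite scale1r mul1r. Qed.

Lemma frame_coord0 k : Y k (pt (0 : vfiber E m)) = 0.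
Proof.
have := frame_coordD k 0 0; rewrite addr0 => /eqP.
by rewrite -subr_eq subrr eq_sym => /eqP.
Qed.

Lemma frame_coordZ k a w : Y k (pt (a *: w)) = a * Y k (pt w).
Proof. by have := frame_coordP k a w 0; rewrite frame_coord0 !addr0. Qed.

Lemma frame_coord_sum k (J : Type) (l : seq J) (G : J -> vfiber E m) :
  Y k (pt (\sum_(j <- l) G j)) = \sum_(j <- l) Y k (pt (G j)).
Proof.
by elim: l => [|j l IH]; rewrite ?big_nil ?big_cons ?frame_coord0 // frame_coordD IH.
Qed.

Lemma frame_eq0 w : (forall k, Y k (pt w) = 0) -> w = 0.
Proof. by move=> Y0; rewrite (frame_expand w) big1 // => k _; rewrite Y0 scale0r. Qed.

End Frame.

Definition vert_fun m (w v : vfiber E m) (F : Cinf P) : R :=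
  derive1 (fun t : R => F (pt (w + t *: v)) : R^o) 0.

(** In a bundle chart the curve w + t v is a straight line. *)
Lemma vert_fun_coord m (w v : vfiber E m) c t t' F : trivialization c t t' ->
  dom c m -> vert_fun w v F =
  'D_(row_mx 0 (t m v)) (F \o icoord (bundle_chart c t t'))
     (coord (bundle_chart c t t') (pt w)).
Proof.
move=> lt cm; have Pc := bundle_chartP lt; rewrite /vert_fun derive1E.
set bc := bundle_chart c t t'.
pose z0 := coord bc (pt w); pose z1 : 'rV[R]_(n + r) := row_mx 0 (t m v).
have E1 : (fun a : R => F (pt (w + a *: v))) = (fun a : R => (F \o icoord bc) (z0 + a *: z1)).
  apply/funext => a.
  have -> : z0 + a *: z1 = coord bc (pt (w + a *: v)).
    rewrite /z0 /z1 /= scale_row_mx add_row_mx scaler0 addr0.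
    by rewrite (trivD lt) // (trivZ lt).
  exact: (congr1 F (esym (@coordK _ _ P bc (pt (w + a *: v)) Pc cm))).
rewrite E1; have dF : differentiable (F \o icoord bc) (z0 + 0 *: z1).
  apply: smooth_on_differentiable (Cinf_smooth F Pc) _.
  by rewrite scale0r addr0; exists (pt w).
by have [_ ->] := is_derive_line dF; rewrite scale0r addr0.
Qed.

Lemma vert_derivation m (w v : vfiber E m) :
  derivation_at (pt w : P) (vert_fun w v : Cinf P -> R^o).
Proof.
have [c [t [t' [lt cm]]]] := triv_at (E := E) m.
have Pc := bundle_chartP lt.
have cd := @chart_derivation _ _ P _ (pt w) 1 (row_mx 0 (t m v)) Pc (fun=> cm).
have E1 F : 1 * 'D_(row_mx 0 (t m v)) (F \o icoord (bundle_chart c t t'))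
    (coord (bundle_chart c t t') (pt w)) = vert_fun w v F.
  by rewrite mul1r (vert_fun_coord _ _ _ lt cm).
have E2 := funext E1.
by rewrite E2 in cd.
Qed.

(** The velocity at t = 0 of the curve w + t v in the fibre. *)
Definition vert m (w v : vfiber E m) : tangent (pt w : P) :=
  mkTangent (vert_derivation w v).

Lemma vert_pullback m (w v : vfiber E m) f : vert w v (pullback f) = 0.
Proof. by rewrite /= /vert_fun /= derive1_cst. Qed.

Lemma vert_frame A e Y m (w v : vfiber E m) k : local_frame A e Y -> A m ->
  vert w v (Y k) = Y k (pt v).
Proof.
move=> lf Am; rewrite /= /vert_fun derive1E.
have -> : (fun a : R => Y k (pt (w + a *: v)) : R^o) =
    (cst (Y k (pt w)) + (fun a : R => a * Y k (pt v)) : R -> R).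
  by apply/funext => a; rewrite (frame_coordD lf Am) (frame_coordZ lf Am).
have dM : is_derive (0 : R) (1 : R) (fun a : R => a * Y k (pt v)) (Y k (pt v)).
  have := is_deriveM (is_derive_id (0 : R) (1 : R)) (is_derive_cst (Y k (pt v)) (0 : R) (1 : R)).
  by rewrite scaler0 add0r /GRing.scale /= mulr1.
have [_ ->] := is_deriveD (is_derive_cst (Y k (pt w)) (0 : R) (1 : R)) dM.
by rewrite add0r.
Qed.

Lemma vertP m (w : vfiber E m) a v v' : vert w (a *: v + v') = a *: vert w v + vert w v'.
Proof.
have [A [e [Y [Am lf]]]] := local_frame_at (E := E) m.
apply: (tangent_total_ext (q := pt w) lf Am) => [f|k].
  by rewrite tan_addE tan_scaleE !vert_pullback mulr0 addr0.
by rewrite tan_addE tan_scaleE !(vert_frame _ _ _ lf Am) (frame_coordP lf Am).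
Qed.

Lemma vertD m (w : vfiber E m) v v' : vert w (v + v') = vert w v + vert w v'.
Proof. by have := vertP w 1 v v'; rewrite !scale1r. Qed.

Lemma vert0 m (w : vfiber E m) : vert w 0 = 0.
Proof. by have /eqP := vertD w 0 0; rewrite addr0 -subr_eq subrr eq_sym => /eqP. Qed.

Lemma vertZ m (w : vfiber E m) a v : vert w (a *: v) = a *: vert w v.
Proof. by have := vertP w a v 0; rewrite vert0 !addr0. Qed.

Lemma vertN m (w : vfiber E m) v : vert w (- v) = - vert w v.
Proof. by rewrite -scaleN1r vertZ scaleN1r. Qed.

Definition vlift_at s (q : P) : tangent q :=
  match q with existT m w => vert w (s m) end.

Lemma vlift_smooth s : @smooth_vector_field R _ P (vlift_at s).
Proof.
move=> F; apply/smoothP => q; have [A [e [Y [Aq lf]]]] := local_frame_at (E := E) (pr q).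
apply: (smooth_at_field lf Aq) => [f|k].
  apply: smooth_at_eq (mopen_setT (M := P)) Logic.I _ (smooth_at_cst 0 q).
  by move=> [m w] _; rewrite vert_pullback.
have oA := mopen_pr (E := E) (frame_open lf).
have sS := smooth_smooth_at q (smooth_pullback (E := E) (restrict s (Y k))).
refine (smooth_at_eq oA Aq _ sS).
by move=> [m w] Am; rewrite [RHS](vert_frame _ _ _ lf Am).
Qed.

Definition vlift s : vector_field P := @MkSection _ _ _ (TM P) _ (vlift_smooth s).

Lemma vertical_liftE s : vertical_lift s = vlift s.
Proof.
have vl : is_vertical_lift s (vlift s) by [].
have Hv : is_vertical_lift s (vertical_lift s).
  by apply: (xgetPex 0 (P := [set V | is_vertical_lift s V])); exists (vlift s).
by apply: sectionP => -[m w]; apply: tangentP => F; rewrite Hv.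
Qed.

End VerticalVectors.

(** * Connections, parallel sections and horizontal lifts *)

Section Connection.
Context {R : realType} {n : nat} {M : manifold R n} {r : nat}.
Context {E : vector_bundle M r} (D : connection E).
Implicit Types (f g : Cinf M) (F G : Cinf (total_space E)).
Implicit Types (s u : sections (vsbundle E)) (m : M) (Z : vector_field M).

Local Notation P := (total_space E).

Lemma nabla0r Z : D Z 0 = 0.
Proof. by have /eqP := connectionDr D Z 0 0; rewrite addr0 -subr_eq subrr eq_sym => /eqP. Qed.

Lemma nabla_sumr Z (J : Type) (l : seq J) (G : J -> sections (vsbundle E)) :
  D Z (\sum_(j <- l) G j) = \sum_(j <- l) D Z (G j).
Proof.
by elim: l => [|j l IH]; rewrite ?big_nil ?big_cons ?nabla0r // connectionDr IH.
Qed.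

Lemma nablaDl Z Z' s : D (Z + Z') s = D Z s + D Z' s.
Proof. by have := connectionXl D 1 Z Z' s; rewrite !mul_section1. Qed.

Lemma nabla0l s : D 0 s = 0.
Proof. by have /eqP := nablaDl 0 0 s; rewrite addr0 -subr_eq subrr eq_sym => /eqP. Qed.

Lemma nablaMl f Z s : D (mul_section f Z) s = mul_section f (D Z s).
Proof. by have := connectionXl D f Z 0 s; rewrite nabla0l !addr0. Qed.

Lemma nabla_suml s (J : Type) (l : seq J) (G : J -> vector_field M) :
  D (\sum_(j <- l) G j) s = \sum_(j <- l) D (G j) s.
Proof.
by elim: l => [|j l IH]; rewrite ?big_nil ?big_cons ?nabla0l // nablaDl IH.
Qed.

(** The Leibniz rule applied to a bump function times [s - u], which is 0. *)
Lemma nabla_local Z s u A m : mopen M A -> A m -> (forall x, A x -> s x = u x) ->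
  D Z s m = D Z u m.
Proof.
move=> oA Am su; have [h [B [oB Bp BA h1 hs]]] := bump oA Am.
have su0 : mul_section h (s - u) = 0.
  apply: sectionP => x; rewrite section_mulE section_subE.
  have [/su ->|nAx] := pselect (A x); first by rewrite subrr scaler0.
  by rewrite (supp_in0 hs nAx) scale0r.
have := congr1 (fun a : sections _ => a m) (connectionMr D Z h (s - u)).
rewrite su0 nabla0r section_addE !section_mulE section_subE su // subrr scaler0 add0r.
rewrite h1 // scale1r => D0.
by rewrite -[s in LHS](subrK u) connectionDr section_addE -D0 add0r.
Qed.

(** Expand [Z] in a local frame of the tangent bundle. *)
Lemma nabla_pointwise Z Z' s m : Z m = Z' m -> D Z s m = D Z' s m.
Proof.
suff H (U : vector_field M) : U m = 0 -> D U s m = 0.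
  move=> ZZ; rewrite -[Z](subrK Z') nablaDl section_addE H ?add0r //.
  by rewrite section_subE ZZ subrr.
move: U => {}Z Z0.
have [X [d [A [oA Am vE dX]]]] := tangent_frame m.
have [h [B [oB Bp BA h1 hs]]] := bump oA Am.
have hZ : mul_section h Z = \sum_j mul_section (h * act Z (X j)) (d j).
  apply: sectionP => x; rewrite section_mulE section_sumE.
  have [Ax|nAx] := pselect (A x); last first.
    rewrite (supp_in0 hs nAx) scale0r big1 // => j _.
    by rewrite section_mulE CinfM (supp_in0 hs nAx) mul0r scale0r.
  rewrite [in LHS](vE x Ax (Z x)) scaler_sumr; apply: eq_bigr => j _.
  by rewrite section_mulE CinfM scalerA.
have := congr1 (fun a : sections _ => a m) (nablaMl h Z s).
rewrite hZ nabla_suml section_sumE section_mulE h1 // scale1r => <-.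
rewrite big1 // => j _; rewrite nablaMl section_mulE CinfM /=.
by rewrite Z0 tan_zeroE mulr0 scale0r.
Qed.

(** The covariant derivative in components, the Christoffel symbols being
    the components of the derivatives of the frame. *)
Lemma nabla_frame A e Y Z s m k : local_frame A e Y -> A m ->
  Y k (pt (D Z s m)) = (Z m : tangent m) (restrict s (Y k)) +
    \sum_l Y l (pt (s m)) * Y k (pt (D Z (e l) m)).
Proof.
move=> lf Am.
have -> : D Z s m = D Z (\sum_l mul_section (restrict s (Y l)) (e l)) m.
  apply: nabla_local (frame_open lf) Am _ => x Ax.
  by rewrite section_sumE [LHS](frame_expand lf Ax).
rewrite nabla_sumr section_sumE (frame_coord_sum lf Am).
under eq_bigr => l _.
  rewrite connectionMr section_addE !section_mulE.
  rewrite (frame_coordP lf Am) (frame_coordZ lf Am) (frame_delta lf Am) /=.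
  over.
rewrite big_split /=; congr (_ + _).
rewrite (bigD1 k) //= eqxx mulr1 big1 ?addr0 // => l lk.
by rewrite eq_sym (negbTE lk) mulr0.
Qed.

(** Take coefficients that have the given values at [m] and are affine in
    the coordinates of the base: their slopes are free and can be chosen so that
    they cancel the Christoffel symbols at the single point [m]. *)
Lemma parallel_through m (w : vfiber E m) :
  exists s, s m = w /\ forall Z, D Z s m = 0.
Proof.
have [A [e [Y [Am lf]]]] := local_frame_at (E := E) m.
have [X [d [B [oB Bm vE dX]]]] := tangent_frame m.
pose G j k := \sum_l Y l (pt w) * Y k (pt (D (d j) (e l) m)).
have [c [cm dc]] : exists c : 'I_r -> Cinf M, (forall k, c k m = Y k (pt w)) /\
    forall k (v : tangent m), v (c k) = - \sum_j v (X j) * G j k.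
  exists (fun k => cst_Cinf M (Y k (pt w)) -
    \sum_j (cst_Cinf M (G j k) * (X j - cst_Cinf M (X j m)))).
  split=> [k|k v].
    rewrite CinfB Cinf_sum big1 ?subr0 // => j _.
    by rewrite CinfM CinfB /= subrr mulr0.
  rewrite tangentB tangent_cst sub0r tangent_sum; congr (- _).
  apply: eq_bigr => j _; rewrite tangentM0; last by rewrite CinfB /= subrr.
  by rewrite tangentB tangent_cst subr0 /= mulrC.
pose s : sections (vsbundle E) := \sum_k mul_section (c k) (e k).
have sm : s m = w.
  rewrite section_sumE [RHS](frame_expand lf Am); apply: eq_bigr => k _.
  by rewrite section_mulE cm.
exists s; split=> // Z; apply: (frame_eq0 lf Am) => k.
rewrite (nabla_frame _ _ _ lf Am) sm.
have -> : (Z m : tangent m) (restrict s (Y k)) = (Z m : tangent m) (c k).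
  apply: tangent_local (frame_open lf) Am _ => x Ax; rewrite [restrict s _ x]/=.
  rewrite section_sumE (frame_coord_sum lf Ax) (bigD1 k) //= big1 ?addr0.
    by rewrite (frame_coordZ lf Ax) (frame_delta lf Ax) eqxx mulr1.
  by move=> l lk; rewrite (frame_coordZ lf Ax) (frame_delta lf Ax) eq_sym (negbTE lk) mulr0.
have -> : (Z m : tangent m) (c k) =
    - \sum_j \sum_l (Z m : tangent m) (X j) * (Y l (pt w) * Y k (pt (D (d j) (e l) m))).
  by rewrite dc; congr (- _); apply: eq_bigr => j _; rewrite mulr_sumr.
rewrite exchange_big /= -[X in X + _]sumrN -big_split big1 //= => l _.
have -> : D Z (e l) m = D (\sum_j mul_section (cst_Cinf M ((Z m : tangent m) (X j))) (d j)) (e l) m.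
  apply: nabla_pointwise; rewrite section_sumE [LHS](vE m Bm (Z m : tangent m)).
  by apply: eq_bigr => j _.
rewrite nabla_suml section_sumE (frame_coord_sum lf Am) mulr_sumr -sumrN -big_split.
rewrite big1 //= => j _; rewrite nablaMl section_mulE (frame_coordZ lf Am) /=.
by rewrite mulrCA addNr.
Qed.

Definition parallel m (w : vfiber E m) : sections (vsbundle E) :=
  projT1 (cid (parallel_through w)).

Lemma parallelE m (w : vfiber E m) : parallel w m = w.
Proof. by have [] := projT2 (cid (parallel_through w)). Qed.

Lemma nabla_parallel m (w : vfiber E m) Z : D Z (parallel w) m = 0.
Proof. by have [_] := projT2 (cid (parallel_through w)); exact. Qed.

Lemma restrict_pullback s f : restrict s (pullback f) = f.
Proof. exact: CinfP. Qed.

Lemma restrictM s F G : restrict s (F * G) = restrict s F * restrict s G.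
Proof. exact: CinfP. Qed.

Lemma restrictP s a F G : restrict s (a *: F + G) = a *: restrict s F + restrict s G.
Proof. exact: CinfP. Qed.

Lemma push_derivation s m (v : tangent m) (w : vfiber E m) : s m = w ->
  derivation_at (pt w : P) (fun F => v (restrict s F)).
Proof.
move=> sw; have [vZ vM] := tangent_derivation v; split=> [a F G|F G].
  by rewrite restrictP vZ.
by rewrite restrictM vM /= sw.
Qed.

Definition push s m (v : tangent m) : tangent (pt (s m) : P) :=
  mkTangent (push_derivation v (erefl (s m))).

(** The image of [v] under the differential of a section parallel at [m]. *)
Definition hor m (w : vfiber E m) (v : tangent m) : tangent (pt w : P) :=
  mkTangent (push_derivation v (parallelE w)).

Lemma hor_pullback m (w : vfiber E m) v f : hor w v (pullback f) = v f.
Proof. by rewrite /= restrict_pullback. Qed.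

(** The right-hand side no longer involves the chosen parallel section and is
    smooth in [w]: this is why horizontal lifts are smooth. *)
Lemma hor_frame A e Y m (w : vfiber E m) Z k : local_frame A e Y -> A m ->
  hor w (Z m) (Y k) = - \sum_l Y l (pt w) * Y k (pt (D Z (e l) m)).
Proof.
move=> lf Am; have := nabla_frame Z (parallel w) k lf Am.
rewrite nabla_parallel (frame_coord0 lf Am) parallelE => /esym/eqP.
by rewrite addr_eq0 => /eqP.
Qed.

Lemma horP m (w : vfiber E m) a (u v : tangent m) : hor w (a *: u + v) = a *: hor w u + hor w v.
Proof. exact: tangentP. Qed.

Lemma hor0 m (w : vfiber E m) : hor w 0 = 0.
Proof. exact: tangentP. Qed.

(** The vertical part of the differential of a section is its covariant
    derivative. Both sides act on fibre coordinates by [nabla_frame]. *)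
Lemma push_split s m Z :
  push s (Z m : tangent m) = hor (s m) (Z m) + vert (s m) (D Z s m).
Proof.
have [A [e [Y [Am lf]]]] := local_frame_at (E := E) m.
apply: (tangent_total_ext (q := pt (s m)) lf Am) => [f|k]; rewrite tan_addE.
  by rewrite vert_pullback addr0 hor_pullback /= restrict_pullback.
rewrite (hor_frame _ _ _ lf Am) (vert_frame _ _ _ lf Am).
by rewrite (nabla_frame _ _ _ lf Am) addrC addrK.
Qed.

Definition hlift_at Z (q : P) : tangent q :=
  match q with existT m w => hor w (Z m) end.

Lemma hlift_smooth Z : @smooth_vector_field R _ P (hlift_at Z).
Proof.
move=> F; apply/smoothP => q; have [A [e [Y [Aq lf]]]] := local_frame_at (E := E) (pr q).
apply: (smooth_at_field lf Aq) => [f|k].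
  apply: (smooth_at_eq (mopen_setT (M := P)) Logic.I _ (smooth_smooth_at q (smooth_pullback (E := E) (act Z f)))).
  by move=> [m w] _; rewrite [RHS]hor_pullback.
have oA := mopen_pr (E := E) (frame_open lf).
pose G : Cinf P := - \sum_l (Y l * pullback (restrict (D Z (e l)) (Y k))).
apply: (smooth_at_eq oA Aq _ (smooth_smooth_at q (Cinf_smooth G))).
move=> [m w] Am; rewrite [RHS](hor_frame _ _ _ lf Am) CinfN Cinf_sum.
by congr (- _); apply: eq_bigr.
Qed.

Definition hlift Z : vector_field P := @MkSection _ _ _ (TM P) _ (hlift_smooth Z).

Lemma hlift_horizontal Z : is_horizontal_lift D Z (hlift Z).
Proof.
move=> m s Ds F g gF.
have := congr1 (fun v : tangent _ => v F) (push_split s m Z).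
rewrite Ds vert0 addr0 /= => <-; congr (Z m _).
by apply: CinfP => x; rewrite gF.
Qed.

Lemma horizontal_liftE Z : horizontal_lift D Z = hlift Z.
Proof.
have Hv : is_horizontal_lift D Z (horizontal_lift D Z).
  apply: (xgetPex 0 (P := [set V | is_horizontal_lift D Z V])).
  by exists (hlift Z); exact: hlift_horizontal.
apply: sectionP => -[m w]; apply: tangentP => F.
have [s [sw Ds]] := parallel_through w.
rewrite -sw (Hv m s Ds F (restrict s F)) //.
have Hh : is_horizontal_lift D Z (hlift Z) by exact: hlift_horizontal.
by rewrite (Hh m s Ds F (restrict s F)).
Qed.

End Connection.

(** * Lie brackets of horizontal lifts *)

Lemma sum_delta {R : pzRingType} r (F : 'I_r -> R) k :
  \sum_l F l * (k == l)%:R = F k.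
Proof.
rewrite (bigD1 k) //= eqxx mulr1 big1 ?addr0 // => l lk.
by rewrite eq_sym (negbTE lk) mulr0.
Qed.

Section LieBracketOfLifts.
Context {R : realType} {n : nat} {M : manifold R n} {r : nat}.
Context {E : vector_bundle M r} (D : connection E).
Implicit Types (f g : Cinf M) (F G : Cinf (total_space E)).
Implicit Types (s u : sections (vsbundle E)) (m : M) (X Z : vector_field M).

Local Notation P := (total_space E).

Lemma vert_sum m (w : vfiber E m) (J : Type) (l : seq J) (G : J -> vfiber E m) :
  vert w (\sum_(j <- l) G j) = \sum_(j <- l) vert w (G j).
Proof. by elim: l => [|j l IH]; rewrite ?big_nil ?big_cons ?vert0 // vertD IH. Qed.

(** Along [s], the function u^v F is a combination of the components of [u].
    As these vanish at [m], only they are differentiated, and their derivatives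
    are the components of [D Z u m]. *)
Lemma derive_vlift_along s u m Z F : u m = 0 ->
  (Z m : tangent m) (restrict s (act (vlift u) F)) = vert (s m) (D Z u m) F.
Proof.
move=> um; have [A [e [Y [Am lf]]]] := local_frame_at (E := E) m.
have -> : (Z m : tangent m) (restrict s (act (vlift u) F)) =
    (Z m : tangent m) (\sum_k restrict u (Y k) * restrict s (act (vlift (e k)) F)).
  apply: tangent_local (frame_open lf) Am _ => x Ax.
  rewrite Cinf_sum -[LHS]/(vert (s x) (u x) F) (frame_expand lf Ax (u x)).
  rewrite vert_sum tan_sumE; apply: eq_bigr => k _.
  by rewrite vertZ tan_scaleE CinfM.
rewrite tangent_sum (frame_expand lf Am (D Z u m)) vert_sum tan_sumE.
apply: eq_bigr => k _; rewrite vertZ tan_scaleE tangentM.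
have Y0 l : Y l (pt (u m)) = 0 by rewrite um (frame_coord0 lf Am).
have -> : restrict u (Y k) m = 0 by exact: Y0.
rewrite mul0r add0r mulrC; congr (_ * _).
rewrite (nabla_frame _ _ _ _ lf Am).
under eq_bigr => l _ do rewrite Y0 mul0r.
by rewrite sumr_const mul0rn addr0.
Qed.

Lemma restrict_hlift s Z F : restrict s (act (hlift D Z) F) =
  act Z (restrict s F) - restrict s (act (vlift (D Z s)) F).
Proof.
apply: CinfP => m; rewrite CinfB.
have := congr1 (fun v : tangent _ => v F) (push_split D s m Z).
rewrite tan_addE => E1; apply/eqP; rewrite eq_sym subr_eq; apply/eqP.
exact: E1.
Qed.

Lemma hlift_parallelE s m Z F : (forall Y, D Y s m = 0) ->
  (hlift D Z (pt (s m)) : tangent (pt (s m) : P)) F = (Z m : tangent m) (restrict s F).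
Proof.
move=> Ds; have Hh : is_horizontal_lift D Z (hlift D Z) by exact: hlift_horizontal.
by rewrite (Hh m s Ds F (restrict s F)).
Qed.

(** Let [s] be parallel at [m], so that X^h acts at [s m] as [X] on
    pull-backs by [s]. By [restrict_hlift] the pull-back of Z^h F is
    Z (s^* F) - s^* ((D Z s)^v F), and D Z s vanishes at [m]: by
    [derive_vlift_along], X^h (Z^h F) = X (Z (s^* F)) - (D X (D Z s))^v F there.
    Exchange [X] and [Z] and subtract. *)
Lemma lie_hlift s m X Z : (forall Y, D Y s m = 0) ->
  lie (hlift D X) (hlift D Z) (pt (s m)) =
  (hlift D (lie X Z) (pt (s m)) : tangent (pt (s m) : P)) -
    vert (s m) (curvature D X Z s m).
Proof.
move=> Ds; apply: tangentP => F.
have half X1 Z1 : (hlift D X1 (pt (s m)) : tangent (pt (s m) : P)) (act (hlift D Z1) F)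
    = (X1 m : tangent m) (act Z1 (restrict s F)) - vert (s m) (D X1 (D Z1 s) m) F.
  by rewrite hlift_parallelE // restrict_hlift tangentB derive_vlift_along.
rewrite tan_addE tan_oppE hlift_parallelE // /curvature !section_subE Ds subr0.
rewrite vertD vertN tan_addE tan_oppE.
rewrite -[LHS]/(_ (act (hlift D Z) F) - _ (act (hlift D X) F)) !half.
by rewrite -[(lie X Z m : tangent m) _]/(_ - _); ring.
Qed.

End LieBracketOfLifts.

(** * Lifts generate the vector fields on the total space *)

Section CourantLiftMap.
Context {R : realType} {n : nat} {M : manifold R n} {r : nat}.
Context {E : vector_bundle M r} (D : connection E).
Implicit Types (f g : Cinf M) (F G : Cinf (total_space E)).
Implicit Types (s u : sections (vsbundle E)) (m : M) (X Z : vector_field M).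

Local Notation P := (total_space E).
Local Notation TE := (whitney_sum (TM M) (vsbundle E)).
Implicit Types (a b : sections TE).

(** The lift at a point of the total space, as a map from the fibre of
    TM (+) E; by the next lemmas it is bijective. *)
Definition lift_at m (w : vfiber E m) (x : TE m) : tangent (pt w : P) :=
  hor D w x.1 + vert w x.2.

Lemma lift_sectionE a m (w : vfiber E m) :
  lift_section D a (pt w) = lift_at w (a m).
Proof. by rewrite /lift_section horizontal_liftE vertical_liftE. Qed.

Lemma act_liftE a m (w : vfiber E m) F :
  act (lift_section D a) F (pt w) = lift_at w (a m) F.
Proof. by rewrite actE lift_sectionE. Qed.

Lemma lift_at_pullback m (w : vfiber E m) (x : TE m) f :
  lift_at w x (pullback f) = x.1 f.
Proof. by rewrite tan_addE vert_pullback addr0 hor_pullback. Qed.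

Lemma lift_atP m (w : vfiber E m) k (x y : TE m) :
  lift_at w (k *: x + y) = k *: lift_at w x + lift_at w y.
Proof.
rewrite /lift_at /= horP vertP scalerDr -!addrA; congr (_ + _).
by rewrite addrCA.
Qed.

Lemma lift_atD m (w : vfiber E m) (x y : TE m) :
  lift_at w (x + y) = lift_at w x + lift_at w y.
Proof. by have := lift_atP w 1 x y; rewrite !scale1r. Qed.

Lemma lift_at0 m (w : vfiber E m) : lift_at w 0 = 0.
Proof. by have /eqP := lift_atD w 0 0; rewrite addr0 -subr_eq subrr eq_sym => /eqP. Qed.

Lemma lift_at_eq0 m (w : vfiber E m) (x : TE m) : lift_at w x = 0 -> x = 0.
Proof.
move=> x0; have x1 : x.1 = 0.
  by apply: tangentP => f; rewrite -(lift_at_pullback w) x0.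
move: x0; rewrite /lift_at x1 hor0 add0r => x2.
have [A [e [Y [Am lf]]]] := local_frame_at (E := E) m.
case: x x1 x2 => x1 x2 /= -> v0; congr pair; apply: (frame_eq0 lf Am) => k.
by rewrite -(vert_frame w _ _ lf Am) v0.
Qed.

Lemma pullback_derivation (q : P) (v : tangent q) :
  derivation_at (pr q) (fun f => v (pullback f)).
Proof.
have [vZ vM] := tangent_derivation v; split=> [k f g|f g].
  by rewrite -vZ; congr (v _); exact: CinfP.
have -> : pullback (f * g) = pullback f * pullback g :> Cinf P by exact: CinfP.
by rewrite vM.
Qed.

(** The first component is the image of [v] on the base; the second one is
    read off on fibre coordinates once the horizontal part is removed. *)
Lemma lift_at_surj m (w : vfiber E m) (v : tangent (pt w : P)) :
  exists x, v = lift_at w x.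
Proof.
pose x1 : tangent m := mkTangent (pullback_derivation v).
have [A [e [Y [Am lf]]]] := local_frame_at (E := E) m.
pose x2 : vfiber E m := \sum_k (v (Y k) - hor D w x1 (Y k)) *: (e k m : vfiber E m).
exists ((x1, x2) : TE m); apply: (tangent_total_ext (q := pt w) lf Am) => [f|k].
  by rewrite lift_at_pullback.
rewrite tan_addE (vert_frame _ _ _ lf Am) (frame_coord_sum lf Am) (bigD1 k) //=.
rewrite (frame_coordZ lf Am) (frame_delta lf Am) eqxx mulr1 big1 ?addr0.
  by rewrite addrC subrK.
by move=> l lk; rewrite (frame_coordZ lf Am) (frame_delta lf Am) eq_sym (negbTE lk) mulr0.
Qed.

Lemma smooth_pair_of Z s : smooth_pair (B := TM M) (C := vsbundle E) (fun p => (Z p, s p)).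
Proof. by split; exact: section_smooth. Qed.

Definition pair_of Z s : sections TE := @MkSection _ _ _ TE _ (smooth_pair_of Z s).

Lemma pair_section_through m (x : TE m) : exists a, a m = x.
Proof.
have [Z Zx] := vector_field_through x.1; have [s sx] := section_through (E := E) x.2.
by exists (pair_of Z s); rewrite /= Zx sx; case: (x).
Qed.

(** The lifts of the coordinate fields of the base and of the frame of E are
    a local frame of the total space; the coefficients of [W] in it are smooth,
    being found by applying [W] to base functions and fibre coordinates. *)
Lemma lift_generate (W : vector_field P) (q : P) : exists (h : Cinf P) (l : seq (Cinf P * sections TE)),
  h q = 1 /\ mul_section h W = \sum_(i <- l) mul_section i.1 (lift_section D i.2).
Proof.
have [X [d [A [oA Aq vE dX]]]] := tangent_frame (pr q).
have [B [e [Y [Bq lf]]]] := local_frame_at (E := E) (pr q).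
have oAB := mopen_pr (E := E) (mopenI oA (frame_open lf)).
have [h [C [oC Cq CA h1 hs]]] := bump oAB (conj Aq Bq).
pose y k : Cinf P := act W (Y k) -
  \sum_j act W (pullback (X j)) * act (lift_section D (pair_of (d j) 0)) (Y k).
pose l1 := [seq (h * act W (pullback (X j)), pair_of (d j) 0) | j <- index_enum 'I_n].
pose l2 := [seq (h * y k, pair_of 0 (e k)) | k <- index_enum 'I_r].
exists h, (l1 ++ l2); split; first exact: h1.
rewrite big_cat /l1 /l2 !big_map; apply: sectionP => -[m w].
rewrite section_addE !section_sumE section_mulE.
under eq_bigr do rewrite section_mulE lift_sectionE.
under [X in _ = _ + X]eq_bigr do rewrite section_mulE lift_sectionE.
have [[Am Bm]|nAB] := pselect ((pr @^-1` (A `&` B)) (pt w)); last first.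
  have h0 := supp_in0 hs nAB.
  by rewrite h0 scale0r !big1 ?addr0 // => i _; rewrite CinfM h0 mul0r scale0r.
apply: (tangent_total_ext (q := pt w) lf Bm) => [f|k].
  rewrite tan_addE !tan_sumE tan_scaleE [X in _ + X]big1 ?addr0; last first.
    by move=> k _; rewrite tan_scaleE lift_at_pullback mulr0.
  have -> : (W (pt w) : tangent (pt w : P)) (pullback f) =
      \sum_j act W (pullback (X j)) (pt w) * (d j m : tangent m) f.
    pose v : tangent m := mkTangent (pullback_derivation (W (pt w) : tangent (pt w : P))).
    by rewrite -[LHS]/(v f) (vE m Am v) tan_sumE; apply: eq_bigr.
  rewrite mulr_sumr; apply: eq_bigr => j _.
  by rewrite tan_scaleE lift_at_pullback CinfM mulrA.
rewrite tan_addE !tan_sumE tan_scaleE.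
have -> : \sum_l ((h * y l) (pt w) *: lift_at w (pair_of 0 (e l) m)) (Y k)
    = (h * y k) (pt w).
  have lY l : lift_at w (pair_of 0 (e l) m) (Y k) = (k == l)%:R.
    by rewrite tan_addE hor0 add0r (vert_frame _ _ _ lf Bm) (frame_delta lf Bm).
  rewrite (eq_bigr (fun l => (h * y l) (pt w) * (k == l)%:R)) => [|l _]; last first.
    by rewrite tan_scaleE lY.
  exact: (sum_delta (fun l => (h * y l) (pt w))).
have -> : \sum_j (h * act W (pullback (X j))) (pt w) *
    lift_at w (pair_of (d j) 0 m) (Y k) = h (pt w) * (\sum_j
    act W (pullback (X j)) * act (lift_section D (pair_of (d j) 0)) (Y k)) (pt w).
  rewrite Cinf_sum mulr_sumr; apply: eq_bigr => j _.
  by rewrite !CinfM act_liftE mulrA.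
by rewrite CinfM /y CinfB mulrBr addrC subrK.
Qed.

(** A map that is linear over smooth functions commutes with the
    decomposition of [lift_generate], whose factor [h] is 1 at the given
    point. *)
Lemma tensorial_lift0 (T : vector_field P -> Cinf P) :
  (forall V W, T (V + W) = T V + T W) ->
  (forall F V, T (mul_section F V) = F * T V) ->
  (forall a, T (lift_section D a) = 0) -> forall V, T V = 0.
Proof.
move=> TD TM T0 V; apply: CinfP => q.
have [h [l [hq hV]]] := lift_generate V q.
have := congr1 (fun F => F q) (TM h V); rewrite hV CinfM hq mul1r => <-.
clear hV; have -> : T (\sum_(i <- l) mul_section i.1 (lift_section D i.2)) = 0 => //.
elim: l => [|i l IH]; rewrite ?big_nil ?big_cons; last by rewrite TD IH TM T0 mulr0 addr0.
by have /eqP := TD 0 0; rewrite addr0 -subr_eq subrr eq_sym => /eqP.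
Qed.

End CourantLiftMap.

(** * Representing linear forms by a pairing *)

Section Riesz.
Context {R : realType}.

Lemma linear_form (V : lmodType R) (phi : V -> R) :
  (forall a x y, phi (a *: x + y) = a * phi x + phi y) ->
  [/\ forall x y, phi (x + y) = phi x + phi y, forall a x, phi (a *: x) = a * phi x &
      forall x, phi (- x) = - phi x].
Proof.
move=> lin; have addphi x y : phi (x + y) = phi x + phi y.
  by have := lin 1 x y; rewrite scale1r mul1r.
have phi0 : phi 0 = 0.
  by have /eqP := addphi 0 0; rewrite addr0 -subr_eq subrr eq_sym => /eqP.
have scalephi a x : phi (a *: x) = a * phi x by have := lin a x 0; rewrite phi0 !addr0.
by split=> // x; rewrite -scaleN1r scalephi mulN1r.
Qed.

Definition spanned (V : lmodType R) := exists k (e : 'I_k -> V),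
  forall x, exists c : 'I_k -> R, x = \sum_j c j *: e j.

(** The generators [e] may be dependent, so their Gram matrix need not be
    invertible. Yet a combination of generators killed by the Gram matrix is 0
    by non-degeneracy, hence killed by [alpha]: the values of [alpha] on the
    generators lie in the row space of the Gram matrix. *)
Lemma riesz (V : lmodType R) (b : V -> V -> R) (alpha : V -> R^o) :
  spanned V -> (forall x, linear (b x : V -> R^o)) -> (forall x y, b x y = b y x) ->
  (forall x, (forall y, b x y = 0) -> x = 0) -> linear alpha ->
  exists x, forall y, b x y = alpha y.
Proof.
move=> [k [e eP]] bl bs bn al.
pose comb (c : 'I_k -> R) := \sum_j c j *: e j.
have lin (phi : V -> R^o) : linear phi -> forall c, phi (comb c) = \sum_j c j * phi (e j).
  move=> phil; have phi0 : phi 0 = 0.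
    by have := phil (-1) 0 0; rewrite scaler0 addr0 scaleN1r addNr.
  move=> c; rewrite /comb; elim: (index_enum _) => [|j l IH]; rewrite ?big_nil ?big_cons //.
  by rewrite phil IH.
pose G : 'M[R]_k := \matrix_(i, j) b (e i) (e j).
pose v : 'rV[R]_k := \row_j alpha (e j).
have : (v <= G)%MS.
  rewrite submxE; apply/eqP/rowP => j; rewrite !mxE.
  pose z i := cokermx G i j.
  have Gz : comb z = 0.
    apply: bn => y; have [c ->] := eP y.
    rewrite -/(comb c) bs (lin _ (bl _)).
    have bz i : b (comb c) (e i) = \sum_l c l * G l i.
      by rewrite bs (lin _ (bl _)); apply: eq_bigr => l _; rewrite mxE bs.
    under eq_bigr => i _ do rewrite bz mulr_sumr.
    rewrite exchange_big /= big1 // => l _.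
    have /matrixP/(_ l j) := mulmx_coker G; rewrite !mxE => Gl.
    under eq_bigr => i _ do rewrite mulrCA [z i * _]mulrC.
    by rewrite -mulr_sumr Gl mulr0.
  have := lin _ al z; rewrite Gz.
  have -> : alpha 0 = 0 by have := al (-1) 0 0; rewrite scaler0 addr0 scaleN1r addNr.
  by move=> E1; rewrite [RHS]E1; apply: eq_bigr => i _; rewrite mxE mulrC.
move=> /submxP[c vE]; exists (comb (fun i => c 0 i)) => y; have [d ->] := eP y.
rewrite -/(comb d) (lin _ (bl _)) (lin _ al); apply: eq_bigr => j _; congr (_ * _).
have /rowP/(_ j) := vE; rewrite !mxE => ->.
by rewrite bs (lin _ (bl _)); apply: eq_bigr => i _; rewrite mxE bs.
Qed.

Lemma spanned_tangent {n} {M : manifold R n} (p : M) : spanned (tangent p).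
Proof.
have [X [d [A [oA Ap vE dX]]]] := tangent_frame p.
exists n, (fun j => d j p) => v; exists (fun j => v (X j)); exact: vE.
Qed.

Lemma spanned_fibre {n r} {M : manifold R n} (E : vector_bundle M r) (p : M) :
  spanned (vfiber E p).
Proof.
have [A [e [Y [Am lf]]]] := local_frame_at (E := E) p.
exists r, (fun j => e j p) => v; exists (fun k => Y k (pt v)).
exact: (frame_expand lf Am).
Qed.

Lemma spanned_prod (V W : lmodType R) : spanned V -> spanned W -> spanned (V * W)%type.
Proof.
move=> [k [e eP]] [l [f fP]].
exists (k + l)%N, (fun i => match fintype.split i with inl j => (e j, 0) | inr j => (0, f j) end).
move=> [x y]; have [c ->] := eP x; have [d ->] := fP y.
exists (fun i => match fintype.split i with inl j => c j | inr j => d j end).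
have sl i : fintype.split (lshift l i) = inl i :> 'I_k + 'I_l := unsplitK (inl i).
have sr i : fintype.split (rshift k i) = inr i :> 'I_k + 'I_l := unsplitK (inr i).
rewrite big_split_ord (eq_bigr (fun i => c i *: (e i, 0 : W))); last first.
  by move=> i _; cbv beta; rewrite sl.
rewrite [X in _ = _ + X](eq_bigr (fun i => d i *: (0 : V, f i))); last first.
  by move=> i _; cbv beta; rewrite sr.
have fsum (I : Type) (s : seq I) (G : I -> V * W) :
    \sum_(i <- s) G i = (\sum_(i <- s) (G i).1, \sum_(i <- s) (G i).2).
  by elim: s => [|i s IH]; rewrite ?big_nil ?big_cons // IH.
rewrite !fsum /=; congr pair => /=.
  by rewrite [X in _ = _ + X]big1 ?addr0 // => i _; rewrite scaler0.
by rewrite [X in _ = X + _]big1 ?add0r // => i _; rewrite scaler0.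
Qed.

End Riesz.

(** * Anchor defect and Jacobiator of an algebroid *)

Section AlgebroidAlgebra.
Context {R : realType} {n : nat} {M : manifold R n} {B : sbundle M}.
Context (A : algebroid B).
Implicit Types (a b c d : sections B) (f g h : Cinf M) (X Z : vector_field M).

Local Notation "<| a , b |>" := (pair_sections A a b).
Local Notation "[| a , b |]" := (bracket A a b).
Local Notation ac := (fun a f => act (rho_section A a) f).

Hypothesis spB : forall p, spanned (B p).
Hypothesis thB : forall p (x : B p), exists a : sections B, a p = x.

Lemma pair_sectionsE a b p : <| a, b |> p = metric A p (a p) (b p).
Proof. by []. Qed.
Lemma rho_sectionE a p : rho_section A a p = rho A p (a p).
Proof. by []. Qed.

Lemma pairC a b : <| a, b |> = <| b, a |>.
Proof. by apply: CinfP => p; rewrite /= pair_sym. Qed.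
Lemma pairDr a b c : <| a, b + c |> = <| a, b |> + <| a, c |>.
Proof.
apply: CinfP => p; rewrite CinfD !pair_sectionsE section_addE.
by have := pair_linear (metric A) (a p) 1 (b p) (c p); rewrite !scale1r.
Qed.
Lemma pair0r a : <| a, 0 |> = 0.
Proof. by have /eqP := pairDr a 0 0; rewrite addr0 -subr_eq subrr eq_sym => /eqP. Qed.
Lemma pairMr a f b : <| a, mul_section f b |> = f * <| a, b |>.
Proof.
apply: CinfP => p; have := pair_linear (metric A) (a p) (f p) (b p) 0.
have := congr1 (fun g : Cinf M => g p) (pair0r a).
by rewrite CinfM !pair_sectionsE section_mulE addr0 => -> ->; rewrite addr0.
Qed.
Lemma pairNr a b : <| a, - b |> = - <| a, b |>.
Proof. by apply/eqP; rewrite -addr_eq0 -pairDr addNr pair0r. Qed.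
Lemma pairBr a b c : <| a, b - c |> = <| a, b |> - <| a, c |>.
Proof. by rewrite pairDr pairNr. Qed.
Lemma pairDl a b c : <| a + b, c |> = <| a, c |> + <| b, c |>.
Proof. by rewrite !(pairC _ c) pairDr. Qed.
Lemma pairMl a f b : <| mul_section f a, b |> = f * <| a, b |>.
Proof. by rewrite !(pairC _ b) pairMr. Qed.
Lemma pairNl a b : <| - a, b |> = - <| a, b |>.
Proof. by rewrite !(pairC _ b) pairNr. Qed.
Lemma pairBl a b c : <| a - b, c |> = <| a, c |> - <| b, c |>.
Proof. by rewrite !(pairC _ c) pairBr. Qed.

Lemma pair_inj a b : (forall c, <| a, c |> = <| b, c |>) -> a = b.
Proof.
move=> ab; apply: sectionP => p; apply/eqP; rewrite -subr_eq0; apply/eqP.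
apply: (@pair_nondegenerate _ _ _ _ (metric A) p) => y; have [c <-] := thB y.
have := congr1 (fun g : Cinf M => g p) (pairBl a b c).
rewrite CinfB ab subrr => <-.
by rewrite pair_sectionsE section_subE.
Qed.

Lemma rho_sectionD a b : rho_section A (a + b) = rho_section A a + rho_section A b.
Proof. by apply: sectionP => p; rewrite rho_sectionE !section_addE linearD. Qed.
Lemma rho_sectionM f a : rho_section A (mul_section f a) = mul_section f (rho_section A a).
Proof. by apply: sectionP => p; rewrite rho_sectionE !section_mulE linearZ. Qed.

Lemma bracketDl a b c : [| a + b, c |] = [| a, c |] + [| b, c |].
Proof. by have := bracket_linearl A c 1 a b; rewrite !scale1r. Qed.
Lemma bracketDr a b c : [| a, b + c |] = [| a, b |] + [| a, c |].
Proof. by have := bracket_linearr A a 1 b c; rewrite !scale1r. Qed.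

(** The choice in [rho_dual] is never the default one, by [riesz]. *)
Lemma rho_dualP p (alpha : {linear tangent p -> R^o}) (y : B p) :
  metric A p (rho_dual A alpha) y = alpha (rho A p y).
Proof.
have ex : exists x : B p, forall y : B p, metric A p x y = alpha (rho A p y).
  apply: (@riesz _ (B p) (metric A p) (fun y : B p => alpha (rho A p y))) => //.
  - exact: pair_linear.
  - exact: pair_sym.
  - exact: pair_nondegenerate.
  - by move=> k u v; rewrite !linearP.
by have := xgetPex 0 (P := [set x : B p | forall y : B p, metric A p x y = alpha (rho A p y)]) ex; exact.
Qed.

(** (Ca1) and (Ca5) paired with a further section. They become identities in
    the ring of smooth functions, where [rho_dual] no longer appears. *)
Definition weak_Ca1 := forall a b c, <| [| a, b |] + [| b, a |], c |> = ac c <| a, b |>.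

Definition weak_Ca5 := forall a b c f, <| [| mul_section f a, b |], c |> =
  - ac b f * <| a, c |> + f * <| [| a, b |], c |> + <| a, b |> * ac c f.

Lemma pair_at_eq p (u v : B p) : (forall y : B p, metric A p u y = metric A p v y) -> u = v.
Proof.
move=> uv; apply/eqP; rewrite -subr_eq0; apply/eqP.
apply: (@pair_nondegenerate _ _ _ _ (metric A) p) => y.
rewrite pair_sym; have := pair_linear (metric A) y (-1) v u.
by rewrite !scaleN1r [- v + u]addrC => ->; rewrite ![metric A p y _]pair_sym uv addNr.
Qed.

Lemma Ca1P : Ca1 A <-> weak_Ca1.
Proof.
split=> [C1 a b c|C1 a b p].
  apply: CinfP => p; rewrite -[LHS]/(metric A p (([| a, b |] + [| b, a |]) p) (c p)).
  by rewrite section_addE C1 rho_dualP.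
apply: pair_at_eq => y; have [c <-] := thB y; rewrite rho_dualP.
by have := congr1 (fun g : Cinf M => g p) (C1 a b c).
Qed.

Lemma Ca5_weak : Ca5 A -> weak_Ca5.
Proof.
move=> C5 a b c f; apply: CinfP => p.
rewrite -[LHS]/(metric A p ([| mul_section f a, b |] p) (c p)) C5 pair_sym.
have [linD linZ _] := linear_form (pair_linear (metric A) (c p)).
rewrite -scaleNr !linD !linZ ![metric A p (c p) _]pair_sym rho_dualP.
by rewrite !CinfD !CinfM CinfN.
Qed.

(** In (Ca2) the anchor of [a] differentiates the coefficient [f]. *)
Lemma metric_Ca4 : Ca2 A -> Ca4 A.
Proof.
move=> C2 a b f; apply: pair_inj => c.
have := C2 a (mul_section f b) c; rewrite !pairMl actM C2 => E1.
rewrite pairDl !pairMl; apply/esym/eqP; rewrite -subr_eq0; apply/eqP.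
have -> : <| [| a, mul_section f b |], c |> = f * (<| [| a, b |], c |> + <| b, [| a, c |] |>) +
    <| b, c |> * ac a f - f * <| b, [| a, c |] |> by rewrite E1; ring.
by ring.
Qed.

Lemma act_anchor_defect a b f : act (anchor_defect A a b) f =
  ac [| a, b |] f - (ac a (ac b f) - ac b (ac a f)).
Proof. by rewrite actBl act_lie. Qed.

Definition jacobiator a b c :=
  [| a, [| b, c |] |] - ([| [| a, b |], c |] + [| b, [| a, c |] |]).

Lemma Ca3P : Ca3 A <-> forall a b c, jacobiator a b c = 0.
Proof.
split=> [C3 a b c|J a b c]; first by rewrite /jacobiator C3 subrr.
by apply/eqP; rewrite -subr_eq0; apply/eqP; exact: J.
Qed.

Lemma anchor_defectMr a b f : Ca4 A ->
  anchor_defect A a (mul_section f b) = mul_section f (anchor_defect A a b).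
Proof.
move=> C4; apply: act_inj => g; rewrite actMl !act_anchor_defect C4 rho_sectionD.
by rewrite actDl !rho_sectionM !actMl actM; ring.
Qed.

Lemma anchor_defectDr a b c :
  anchor_defect A a (b + c) = anchor_defect A a b + anchor_defect A a c.
Proof.
apply: act_inj => g; rewrite actDl !act_anchor_defect bracketDr !rho_sectionD.
by rewrite !actDl actD; ring.
Qed.

(** Expanding with (Ca4), the only second-order terms in [f] that remain are
    those of the anchor defect. *)
Lemma jacobiatorMr a b c f : Ca4 A -> jacobiator a b (mul_section f c) =
  mul_section f (jacobiator a b c) - mul_section (act (anchor_defect A a b) f) c.
Proof.
move=> C4; apply: pair_inj => d.
rewrite act_anchor_defect /jacobiator !C4 !bracketDr !C4.
by rewrite !(pairBl, pairDl, pairMl); ring.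
Qed.

Lemma jacobiatorDr a b c d : jacobiator a b (c + d) = jacobiator a b c + jacobiator a b d.
Proof. by rewrite /jacobiator !bracketDr; apply: pair_inj => x; rewrite !(pairBl, pairDl); ring. Qed.

Lemma jacobiatorDm a b c d : jacobiator a (b + c) d = jacobiator a b d + jacobiator a c d.
Proof.
rewrite /jacobiator !(bracketDl, bracketDr); apply: pair_inj => x.
by rewrite !(pairBl, pairDl); ring.
Qed.

(** What [jacobiatorMr] leaves of the Jacobi identity for [f c]. *)
Lemma anchor_defect_jacobi a b c f : Ca4 A -> Ca3 A ->
  mul_section (act (anchor_defect A a b) f) c = 0.
Proof.
move=> C4 /Ca3P J; have := jacobiatorMr a b c f C4.
rewrite !J => /eqP; rewrite eq_sym subr_eq add0r => /eqP <-.
by apply: sectionP => p; rewrite section_mulE scaler0.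
Qed.

Definition anchor_morphism := forall a b, anchor_defect A a b = 0.

Lemma anchor_morphismE a b f : anchor_morphism ->
  ac [| a, b |] f = ac a (ac b f) - ac b (ac a f).
Proof.
move=> F0; have := act_anchor_defect a b f; rewrite F0 => E1.
have Z0 : act (0 : vector_field M) f = 0 by exact: CinfP.
by move: E1; rewrite Z0 => /esym/eqP; rewrite subr_eq0 => /eqP.
Qed.

(** The symmetric part of the bracket is rho^* d<a, b>. When the anchor is a
    morphism, pairing the bracket with [d] leaves the second derivatives of
    <a, b> along [c] and [d], which cancel. *)
Lemma bracket_symm_part a b c : weak_Ca1 -> Ca2 A -> anchor_morphism ->
  [| [| a, b |] + [| b, a |], c |] = 0.
Proof.
move=> C1 C2 F0; set s := _ + _; apply: pair_inj => d.
have E1 := C1 s c d; have E2 := C2 c s d.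
have sE x : <| s, x |> = ac x <| a, b |> by exact: C1.
rewrite !sE pairDl in E1 E2.
rewrite (anchor_morphismE _ _ _ F0) in E2.
have -> : <| [| s, c |], d |> = ac d (ac c <| a, b |>) - <| [| c, s |], d |> by rewrite -E1; ring.
have -> : <| [| c, s |], d |> = ac c (ac d <| a, b |>) -
  (ac c (ac d <| a, b |>) - ac d (ac c <| a, b |>)) by rewrite {1}E2; ring.
by rewrite (pairC 0) pair0r; ring.
Qed.

(** The symmetrization in the first two arguments is the bracket of
    [bracket_symm_part]. *)
Lemma jacobiator_antisym a b c : weak_Ca1 -> Ca2 A -> anchor_morphism ->
  jacobiator b a c = - jacobiator a b c.
Proof.
move=> C1 C2 F0; apply/eqP; rewrite -addr_eq0; apply/eqP.
have := bracket_symm_part a b c C1 C2 F0; rewrite bracketDl => S0.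
apply: pair_inj => x; have := congr1 (fun y => <| y, x |>) S0.
by rewrite /jacobiator !(pairBl, pairDl) (pairC 0) pair0r => S1; rewrite -[RHS]oppr0 -S1; ring.
Qed.

(** (Ca5) brings in multiples of rho^* d f. Paired with [d], they cancel by
    (Ca2) and the morphism property of the anchor. *)
Lemma jacobiatorMm a b c f : Ca2 A -> Ca4 A -> weak_Ca5 -> anchor_morphism ->
  jacobiator a (mul_section f b) c = mul_section f (jacobiator a b c).
Proof.
move=> C2 C4 C5 F0; apply: pair_inj => d.
have adj x y z : <| [| x, y |], z |> = ac x <| y, z |> - <| y, [| x, z |] |>.
  by rewrite C2; ring.
rewrite /jacobiator !(pairBl, pairDl, pairMl).
rewrite (adj a [| mul_section f b, c |]) !C5 C4 bracketDl pairDl !C5.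
rewrite !(actD, actM, actN) !(anchor_morphismE _ _ _ F0).
rewrite (adj a [| b, c |]) (adj a b d) (adj a b c); ring.
Qed.

End AlgebroidAlgebra.

(** * Tensoriality of the curvature *)

Section Curvature.
Context {R : realType} {n : nat} {M : manifold R n} {r : nat}.
Context {E : vector_bundle M r} (D : connection E).
Implicit Types (f g : Cinf M) (s u : sections (vsbundle E)) (X Z : vector_field M).

(** Turns identities in the module of sections into identities between real
    numbers, provable by computation in a ring. *)
Lemma fibre_ext m (v w : vfiber E m) :
  (forall phi : vfiber E m -> R, (forall a x y, phi (a *: x + y) = a * phi x + phi y) ->
     phi v = phi w) -> v = w.
Proof.
move=> vw; have [A [e [Y [Am lf]]]] := local_frame_at (E := E) m.
rewrite (frame_expand lf Am v) (frame_expand lf Am w); apply: eq_bigr => k _.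
by rewrite (vw (fun x => Y k (pt x))) // => a x y; exact: (frame_coordP lf Am).
Qed.

Lemma curvatureD X Z s u : curvature D X Z (s + u) = curvature D X Z s + curvature D X Z u.
Proof.
apply: sectionP => m; apply: fibre_ext => phi /linear_form[pD pZ pN].
rewrite /curvature !connectionDr !section_addE !section_oppE !section_addE.
by rewrite !(pD, pN); ring.
Qed.

Lemma curvatureM X Z f s : curvature D X Z (mul_section f s) = mul_section f (curvature D X Z s).
Proof.
apply: sectionP => m; apply: fibre_ext => phi /linear_form[pD pZ pN].
rewrite /curvature !(connectionMr, connectionDr).
rewrite !(section_addE, section_oppE, section_mulE) act_lie CinfB.
by rewrite !(pD, pZ, pN); ring.
Qed.

Lemma curvature0 X Z : curvature D X Z 0 = 0.
Proof. by have /eqP := curvatureD X Z 0 0; rewrite addr0 -subr_eq subrr eq_sym => /eqP. Qed.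

Lemma curvature_local X Z s u A m : mopen M A -> A m -> (forall x, A x -> s x = u x) ->
  curvature D X Z s m = curvature D X Z u m.
Proof.
move=> oA Am su; have loc Y x : A x -> D Y s x = D Y u x.
  by move=> Ax; exact: (nabla_local D Y oA Ax su).
have loc2 Y Y' : D Y (D Y' s) m = D Y (D Y' u) m.
  exact: (nabla_local D Y oA Am (loc Y')).
by rewrite /curvature !section_subE !loc2 loc.
Qed.

(** The curvature is local and linear over smooth functions in the section,
    so it can be computed on components in a frame. *)
Lemma curvature_pointwise X Z s u m : s m = u m ->
  curvature D X Z s m = curvature D X Z u m.
Proof.
move=> su; have [A [e [Y [Am lf]]]] := local_frame_at (E := E) m.
have expand v : curvature D X Z v m = \sum_k Y k (pt (v m)) *: curvature D X Z (e k) m.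
  rewrite (@curvature_local X Z v (\sum_k mul_section (restrict v (Y k)) (e k)) A m) //.
  - transitivity ((\sum_k curvature D X Z (mul_section (restrict v (Y k)) (e k))) m).
      congr (section_val _ m); elim: (index_enum _) => [|k l IH]; rewrite ?big_nil ?big_cons ?curvature0 //.
      by rewrite curvatureD IH.
    rewrite section_sumE; apply: eq_bigr => k _.
    by rewrite curvatureM section_mulE.
  - exact: (frame_open lf).
  - move=> x Ax; rewrite section_sumE [LHS](frame_expand lf Ax).
    by apply: eq_bigr.
by rewrite !expand su.
Qed.

End Curvature.

(** * Identities of the lifted algebroid *)

Section LiftedAlgebroid.
Context {R : realType} {n r : nat} {M : manifold R n}.
Context {E : vector_bundle M r} (D : connection E).

Local Notation P := (total_space E).
Local Notation TE := (whitney_sum (TM M) (vsbundle E)).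
Context (A : algebroid TE) (L : algebroid (TM P)).
Implicit Types (a b c : sections TE) (x y z : vector_field P) (f : Cinf M) (F G : Cinf P).

Hypothesis metric_lift : forall a b q,
  metric L q (lift_section D a q) (lift_section D b q) = pair_sections A a b (projT1 q).
Hypothesis rho_lift : forall a,
  rho_section L (lift_section D a) = horizontal_lift D (rho_section A a).
Hypothesis bracket_lift : forall a b,
  bracket L (lift_section D a) (lift_section D b) = lift_section D (bracket A a b).

Local Notation phi := (lift_section D).

Lemma spanned_TE m : spanned (TE m).
Proof. exact: spanned_prod (spanned_tangent m) (spanned_fibre E m). Qed.

Lemma spanned_TP (q : P) : spanned (TM P q).
Proof. exact: spanned_tangent. Qed.

Lemma through_TE m (v : TE m) : exists a, a m = v.
Proof. exact: pair_section_through. Qed.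

Lemma through_TP (q : P) (v : TM P q) : exists x : vector_field P, x q = v.
Proof. exact: vector_field_through. Qed.

Lemma lift_sectionD a b : phi (a + b) = phi a + phi b.
Proof.
apply: sectionP => -[m w].
have phiE c : phi c (pt w) = lift_at D w (c m) by exact: lift_sectionE.
have sumE : (phi a + phi b) (pt w) = phi a (pt w) + phi b (pt w) by [].
have := lift_atD D w (a m) (b m); rewrite -!phiE -sumE; move=> <-.
exact: phiE.
Qed.

Lemma lift_section0 : phi 0 = 0.
Proof. by have /eqP := lift_sectionD 0 0; rewrite addr0 -subr_eq subrr eq_sym => /eqP. Qed.

Lemma lift_sectionN a : phi (- a) = - phi a.
Proof. by apply/eqP; rewrite -addr_eq0 -lift_sectionD addNr lift_section0. Qed.

Lemma lift_section_inj a : phi a = 0 -> a = 0.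
Proof.
move=> a0; apply: sectionP => m; have [s _] := section_through (E := E) (0 : vfiber E m).
apply: (@lift_at_eq0 _ _ _ _ _ D m (s m)); rewrite -lift_sectionE a0.
by [].
Qed.

Lemma pair_lift a b : pair_sections L (phi a) (phi b) = pullback (pair_sections A a b).
Proof. by apply: CinfP => q; rewrite pair_sectionsE metric_lift. Qed.

Lemma act_rho_lift a f :
  act (rho_section L (phi a)) (pullback f) = pullback (act (rho_section A a) f).
Proof.
rewrite rho_lift horizontal_liftE; apply: CinfP => -[m w].
by rewrite actE [LHS]hor_pullback.
Qed.

Lemma jacobiator_lift a b c :
  jacobiator L (phi a) (phi b) (phi c) = phi (jacobiator A a b c).
Proof.
have phiB (x y z : sections TE) : phi (x - (y + z)) = phi x - (phi y + phi z).
  by rewrite lift_sectionD lift_sectionN lift_sectionD.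
rewrite /jacobiator; have := bracket_lift.
move: (lift_section D) phiB (bracket L) => ph phB br brP.
by rewrite !brP phB.
Qed.

(** By [lie_hlift], the defect of the lift has the defect of [A] as its
    horizontal part and the curvature along the anchor as its vertical part. *)
Lemma anchor_defect_lift a b s m : (forall Z, D Z s m = 0) ->
  anchor_defect L (phi a) (phi b) (pt (s m)) =
  lift_at D (s m) (anchor_defect A a b m, curvature D (rho_section A a) (rho_section A b) s m).
Proof.
move=> Ds; have rhoE c : rho_section L (phi c) = hlift D (rho_section A c).
  exact: etrans (rho_lift c) (horizontal_liftE _ _).
have E1 : anchor_defect L (phi a) (phi b) = hlift D (rho_section A (bracket A a b)) -
    lie (hlift D (rho_section A a)) (hlift D (rho_section A b)).
  rewrite /anchor_defect; have := bracket_lift; move: (bracket L) => brL ->.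
  move: (lift_section D) (rho_section L) rhoE => ph rhoL rhoE.
  by rewrite !rhoE.
rewrite E1.
rewrite [LHS]section_subE lie_hlift //.
have horB (X Z : vector_field M) : hor D (s m) ((X - Z) m) =
    (hlift D X (pt (s m)) : tangent (pt (s m) : P)) - hlift D Z (pt (s m)).
  by apply: tangentP => F; rewrite tan_addE tan_oppE section_subE -tan_oppE.
rewrite /lift_at horB opprD opprK; exact: addrA.
Qed.

(** The difference of the two sides is linear over smooth functions in all
    three arguments, by (Ca4) and (Ca5), and vanishes on lifts. *)
Lemma lifted_Ca1 : Ca4 L -> weak_Ca5 L -> weak_Ca1 A -> weak_Ca1 L.
Proof.
move=> C4 C5 C1.
pose T x y z := pair_sections L (bracket L x y + bracket L y x) z -
  act (rho_section L z) (pair_sections L x y).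
have TC x y z : T x y z = T y x z by rewrite /T [bracket L x y + _]addrC [pair_sections L x y]pairC.
have Dz x y z z' : T x y (z + z') = T x y z + T x y z'.
  by rewrite /T !(pairDr, rho_sectionD, actDl); ring.
have Mz x y F z : T x y (mul_section F z) = F * T x y z.
  by rewrite /T !(pairMr, rho_sectionM, actMl); ring.
have Dy x y y' z : T x (y + y') z = T x y z + T x y' z.
  by rewrite /T !(bracketDl, bracketDr, pairDl, pairDr, actD); ring.
have My x y F z : T x (mul_section F y) z = F * T x y z.
  rewrite /T C4 !(pairDl, pairMl, pairMr) C5 actM [pair_sections L y x]pairC; ring.
have T0 a b c : T (phi a) (phi b) (phi c) = 0.
  have E1 : bracket L (phi a) (phi b) + bracket L (phi b) (phi a) =
      phi (bracket A a b + bracket A b a).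
    by rewrite lift_sectionD -!bracket_lift.
  have E2 := act_rho_lift c (pair_sections A a b).
  rewrite -C1 -(pair_lift a b) -(pair_lift _ c) -E1 in E2.
  by rewrite /T -E2 subrr.
have T1 a b : forall z, T (phi a) (phi b) z = 0.
  by apply: (tensorial_lift0 (D := D)) => // c; exact: T0.
have T2 a z : forall y, T (phi a) y z = 0.
  by apply: (tensorial_lift0 (D := D)) => // b; exact: T1.
have T3 y z : forall x, T x y z = 0.
  apply: (tensorial_lift0 (D := D)) => [x x'|F x|a]; last exact: T2.
    by rewrite !(TC _ y) Dy.
  by rewrite !(TC _ y) My.
move=> x y z; have := T3 y z x; rewrite /T => /eqP; rewrite subr_eq0 => /eqP.
exact.
Qed.

(** As for (Ca1): the derivatives of coefficients cancel by (Ca4) and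
    (Ca5). *)
Lemma lifted_Ca2 : Ca4 L -> weak_Ca5 L -> Ca2 A -> Ca2 L.
Proof.
move=> C4 C5 C2.
pose T x y z := act (rho_section L x) (pair_sections L y z) -
  (pair_sections L (bracket L x y) z + pair_sections L y (bracket L x z)).
have TC x y z : T x y z = T x z y.
  by rewrite /T [pair_sections L y z]pairC addrC [pair_sections L y _]pairC
    [pair_sections L z (bracket L x y)]pairC [X in - X]addrC addrC.
have Dx x x' y z : T (x + x') y z = T x y z + T x' y z.
  by rewrite /T !(bracketDl, pairDl, pairDr, rho_sectionD, actDl); ring.
have Mx x F y z : T (mul_section F x) y z = F * T x y z.
  rewrite /T rho_sectionM actMl C5 [pair_sections L y (bracket L (mul_section _ _) _)]pairC C5.
  by rewrite [pair_sections L y (bracket L x z)]pairC [pair_sections L y z]pairC; ring.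
have Dy x y y' z : T x (y + y') z = T x y z + T x y' z.
  by rewrite /T !(bracketDr, pairDl, actD); ring.
have My x y F z : T x (mul_section F y) z = F * T x y z.
  by rewrite /T C4 !(pairDl, pairMl) actM; ring.
have T0 a b c : T (phi a) (phi b) (phi c) = 0.
  have E2 := act_rho_lift a (pair_sections A b c).
  have pbD f g : pullback (f + g) = pullback f + pullback g :> Cinf P by exact: CinfP.
  rewrite C2 pbD -(pair_lift b c) -(pair_lift _ c) -(pair_lift b _) -!bracket_lift in E2.
  by rewrite /T -E2 subrr.
have T1 a b : forall z, T (phi a) (phi b) z = 0.
  apply: (tensorial_lift0 (D := D)) => [z z'|F z|c]; last exact: T0.
    by rewrite !(TC _ (phi b)) Dy.
  by rewrite !(TC _ (phi b)) My.
have T2 a z : forall y, T (phi a) y z = 0.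
  by apply: (tensorial_lift0 (D := D)) => // b; exact: T1.
have T3 y z : forall x, T x y z = 0.
  by apply: (tensorial_lift0 (D := D)) => // a; exact: T2.
move=> x y z; have := T3 y z x; rewrite /T => /eqP; rewrite subr_eq0 => /eqP.
exact.
Qed.

(** With a vanishing anchor defect the Jacobiator is linear over smooth
    functions in its last two arguments, and by antisymmetry also in the first
    one. *)
Lemma lifted_jacobi : Ca2 L -> Ca4 L -> weak_Ca1 L -> weak_Ca5 L ->
  anchor_morphism L -> Ca3 A -> Ca3 L.
Proof.
move=> C2 C4 C1 C5 F0 /Ca3P J; apply/Ca3P.
have thP := through_TP.
have T0 a b c : jacobiator L (phi a) (phi b) (phi c) = 0.
  by rewrite jacobiator_lift J lift_section0.
have MR x y z F : jacobiator L x y (mul_section F z) = mul_section F (jacobiator L x y z).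
  rewrite (jacobiatorMr thP _ _ _ _ C4) F0.
  apply: sectionP => q; rewrite section_subE !section_mulE.
  by rewrite actE tan_zeroE scale0r subr0.
have MM x y z F : jacobiator L x (mul_section F y) z = mul_section F (jacobiator L x y z).
  exact: (jacobiatorMm thP).
suff H x y z d : pair_sections L (jacobiator L x y z) d = 0.
  by move=> x y z; apply: (pair_inj (A := L) thP) => d; rewrite H pairC pair0r.
have S1 a b : forall z, pair_sections L (jacobiator L (phi a) (phi b) z) d = 0.
  apply: (tensorial_lift0 (D := D)) => [z' z''|F z'|c].
  - by rewrite (jacobiatorDr L thP) pairDl.
  - by rewrite MR pairMl.
  - by rewrite T0 pairC pair0r.
have S2 a z' : forall y, pair_sections L (jacobiator L (phi a) y z') d = 0.
  apply: (tensorial_lift0 (D := D)) => [y' y''|F y'|b].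
  - by rewrite (jacobiatorDm L thP) pairDl.
  - by rewrite MM pairMl.
  - exact: S1.
have anti x' y' : jacobiator L y' x' z = - jacobiator L x' y' z.
  exact: (jacobiator_antisym thP).
have S3 : forall x', pair_sections L (jacobiator L x' y z) d = 0.
  apply: (tensorial_lift0 (D := D)) => [x' x''|F x'|a]; last exact: S2.
    by rewrite !(anti _ x') !(anti y) (jacobiatorDm L thP) !pairNl pairDl opprD.
  by rewrite !(anti y) MM !pairNl pairMl mulrN.
exact: S3.
Qed.

End LiftedAlgebroid.

(** * Anchors of Courant algebroids *)

Section AnchorOfCourant.
Context {R : realType} {n : nat} {M : manifold R n} {B : sbundle M}.
Context (A : algebroid B).
Implicit Types (a b c : sections B) (f h : Cinf M).
Hypothesis spB : forall p, spanned (B p).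
Hypothesis thB : forall p (x : B p), exists a : sections B, a p = x.

Lemma anchor_defect_sym a b : anchor_defect A a b + anchor_defect A b a =
  rho_section A (bracket A a b + bracket A b a).
Proof.
by apply: act_inj => f; rewrite actDl !act_anchor_defect rho_sectionD actDl; ring.
Qed.

(** For f = <a, b>, the vector rho (rho^* d f) is the anchor of
    [a, b] + [b, a], hence a sum of anchor defects. For general [f], write
    d (f <a, b>) with the product rule: <a, b> rho (rho^* d f) = 0, and [a], [b]
    can be chosen with a non-zero pairing at [p] unless rho^* d f is 0 there. *)
Lemma rho_rho_dual f p : Ca1 A -> anchor_morphism A ->
  rho A p (rho_dual A (@differential _ _ _ f p : {linear tangent p -> R^o})) = 0.
Proof.
move=> C1 F0; pose dual h := rho_dual A (@differential _ _ _ h p : {linear tangent p -> R^o}).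
have dualP h y : metric A p (dual h) y = rho A p y h by exact: rho_dualP.
have K a b : rho A p (dual (pair_sections A a b)) = 0.
  have := anchor_defect_sym a b; rewrite !F0 addr0 => E1.
  rewrite /dual -C1 -section_addE -rho_sectionE -E1.
  by [].
apply: contrapT => nz; have xn0 : dual f <> 0.
  by move=> x0; apply: nz; rewrite -/(dual f) x0 linear0.
have [y ny] : exists y, metric A p (dual f) y <> 0.
  apply: contrapT => ny; apply: xn0.
  apply: (@pair_nondegenerate _ _ _ _ (metric A) p) => y.
  by apply: contrapT => my; apply: ny; exists y.
have [a ax] := thB (dual f); have [b bx] := thB y.
set h := pair_sections A a b.
have hp : h p = metric A p (dual f) y by rewrite pair_sectionsE ax bx.
have E1 : dual (pair_sections A (mul_section f a) b) = f p *: dual h + h p *: dual f.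
  apply: (pair_at_eq (A := A)) => z; rewrite dualP pairMl -/h tangentM.
  rewrite -!dualP pair_sym.
  have [linD linZ _] := linear_form (pair_linear (metric A) z).
  by rewrite [RHS]pair_sym linD !linZ ![metric A p z _]pair_sym.
have rhoP k l (u v : B p) : rho A p (k *: u + l *: v) = k *: rho A p u + l *: rho A p v.
  by rewrite linearP linearZ.
have := K (mul_section f a) b; rewrite E1 rhoP K scaler0 add0r => /eqP.
rewrite scaler_eq0 hp => /orP[/eqP my|/eqP]; first exact: ny my.
exact: nz.
Qed.

End AnchorOfCourant.

Section LiftedAnchor.
Context {R : realType} {n r : nat} {M : manifold R n}.
Context {E : vector_bundle M r} (D : connection E).

Local Notation P := (total_space E).
Local Notation TE := (whitney_sum (TM M) (vsbundle E)).
Context (A : algebroid TE) (L : algebroid (TM P)).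
Implicit Types (a b c : sections TE) (x y z : vector_field P) (f : Cinf M) (F G : Cinf P).

Hypothesis metric_lift : forall a b q,
  metric L q (lift_section D a q) (lift_section D b q) = pair_sections A a b (projT1 q).
Hypothesis rho_lift : forall a,
  rho_section L (lift_section D a) = horizontal_lift D (rho_section A a).
Hypothesis bracket_lift : forall a b,
  bracket L (lift_section D a) (lift_section D b) = lift_section D (bracket A a b).

Local Notation phi := (lift_section D).

Lemma rho_lift_at a m (w : vfiber E m) :
  rho L (pt w) (phi a (pt w)) = hor D w (rho A m (a m)).
Proof. by rewrite -rho_sectionE rho_lift horizontal_liftE. Qed.

(** At [w], the dual of d F is the lift of the dual of d (s^* F), where [s] is
    parallel through [w]. So [rho_rho_dual] for [A] carries over. *)
Lemma lifted_rho_rho_dual F (q : P) : Ca1 A -> anchor_morphism A ->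
  rho L q (rho_dual L (@differential _ _ _ F q : {linear tangent q -> R^o})) = 0.
Proof.
move=> C1 F0; case: q => m w; set dF := rho_dual _ _.
pose f := restrict (parallel D w) F.
have [u um] := through_TE (rho_dual A (@differential _ _ _ f m : {linear tangent m -> R^o})).
suff -> : dF = phi u (pt w).
  rewrite rho_lift_at um (rho_rho_dual spanned_TE through_TE) //.
  exact: hor0.
apply: (pair_at_eq (A := L)) => v; have [x ->] := lift_at_surj D v.
have [b <-] := through_TE x; rewrite -lift_sectionE.
rewrite (rho_dualP L spanned_TP) [RHS]metric_lift pair_sectionsE um.
by rewrite (rho_dualP A spanned_TE) rho_lift_at.
Qed.

(** The anchor defect is linear over smooth functions in its second
    argument only. This gives its vanishing on a lift and any field; its
    symmetric part, the anchor of rho^* d<x, y>, is zero, so the arguments can be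
    exchanged and the step repeated. *)
Lemma lifted_anchor_morphism : Ca1 L -> Ca4 L -> Ca1 A -> anchor_morphism A ->
  (forall a b s, curvature D (rho_section A a) (rho_section A b) s = 0) ->
  anchor_morphism L.
Proof.
move=> C1L C4 C1 F0 K0.
have T0 a b : anchor_defect L (phi a) (phi b) = 0.
  apply: sectionP => -[m w]; have [s [sw Ds]] := parallel_through D w.
  rewrite -sw [LHS](anchor_defect_lift rho_lift bracket_lift a b Ds) F0 K0.
  exact: lift_at0.
have act0 G : act (0 : vector_field P) G = 0 by exact: CinfP.
have T1 a y : anchor_defect L (phi a) y = 0.
  apply: act_inj => G; rewrite act0; move: y; apply: (tensorial_lift0 (D := D)).
  - by move=> y y'; rewrite anchor_defectDr actDl.
  - by move=> F y; rewrite (anchor_defectMr _ _ _ C4) actMl.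
  - by move=> b; rewrite T0 act0.
have anti x y : anchor_defect L x y + anchor_defect L y x = 0.
  rewrite anchor_defect_sym; apply: sectionP => q.
  by rewrite rho_sectionE section_addE C1L lifted_rho_rho_dual.
have T2 a y : anchor_defect L y (phi a) = 0.
  by have := anti y (phi a); rewrite T1 addr0.
move=> x y; apply: act_inj => G; rewrite act0; move: y; apply: (tensorial_lift0 (D := D)).
- by move=> y y'; rewrite anchor_defectDr actDl.
- by move=> F y; rewrite (anchor_defectMr _ _ _ C4) actMl.
- by move=> b; rewrite T2 act0.
Qed.

(** The defect F (x, y) is itself a vector field, so that the Jacobi identity
    gives (F (x, y) f) F (x, y) = 0; at [f] this is a square. *)
Lemma courant_anchor_morphism_TM : Ca4 L -> Ca3 L -> anchor_morphism L.
Proof.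
move=> C4 C3 x y; set F := anchor_defect L x y.
apply: sectionP => q; apply: tangentP => f.
have := anchor_defect_jacobi through_TP x y F f C4 C3.
move=> /(congr1 (fun V : vector_field P => act V f)); rewrite actMl => FF.
have : act F f q * act F f q = 0 by rewrite -CinfM FF.
by move=> /eqP; rewrite mulf_eq0 orbb => /eqP.
Qed.

(** The Jacobi identity gives (F (a, b) f) c = 0 for every section c; take for
    c the defect itself, seen in the first summand of TM (+) E. *)
Lemma courant_anchor_morphism_TE : Ca4 A -> Ca3 A -> anchor_morphism A.
Proof.
move=> C4 C3 a b; set F := anchor_defect A a b.
apply: sectionP => p; apply: tangentP => f.
have := anchor_defect_jacobi through_TE a b (pair_of F 0) f C4 C3.
move=> /(congr1 (fun c : sections TE => act (fst_section c) f p)) FF.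
have : act F f p * act F f p = 0 by exact: FF.
by move=> /eqP; rewrite mulf_eq0 orbb => /eqP.
Qed.

End LiftedAnchor.

Theorem theorem4p9 (R : realType) (n r : nat) (M : manifold R n)
    (E : vector_bundle M r) (nabla : connection E)
    (A : algebroid (whitney_sum (TM M) (vsbundle E)))
    (L : algebroid (TM (total_space E))) :
  curved_courant_algebroid A ->
  is_courant_lift nabla A L ->
  (courant_algebroid L <->
   (forall (a b : sections (whitney_sum (TM M) (vsbundle E)))
           (s : sections (vsbundle E)),
      curvature nabla (rho_section A a) (rho_section A b) s = 0) /\
   courant_algebroid A).
Proof.
move=> [[C1 C2] _] [gL rhoL brL C4L C5L].
have C4 := metric_Ca4 through_TE C2.
split=> [[C1L C2L C3L]|[K0 [_ _ C3]]].
  have F0L := courant_anchor_morphism_TM C4L C3L.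
  have zero a b s m : curvature nabla (rho_section A a) (rho_section A b) s m = 0.
    (* The curvature at [m] only sees [s m], so [s] may be taken parallel at [m]. *)
    have [u [us Du]] := parallel_through nabla (s m : vfiber E m).
    have := anchor_defect_lift rhoL brL a b Du; rewrite F0L => /esym/lift_at_eq0.
    by move=> /(congr1 snd) K0; rewrite -[RHS]K0; exact/esym/curvature_pointwise.
  split=> [a b s|]; first by apply: sectionP => m; exact: zero.
  split=> //; apply/Ca3P => a b c; apply: (lift_section_inj (D := nabla)).
  by rewrite -(jacobiator_lift brL); move/Ca3P: C3L => ->.
have F0 := courant_anchor_morphism_TE C4 C3.
have C5w := Ca5_weak spanned_TP C5L.
have C1w : weak_Ca1 L.
  by apply: (lifted_Ca1 gL rhoL brL C4L C5w); exact/(Ca1P A spanned_TE through_TE).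
have C1L : Ca1 L by exact/(Ca1P L spanned_TP through_TP).
have C2L : Ca2 L by exact: (lifted_Ca2 gL rhoL brL C4L C5w C2).
split=> //.
have F0L := lifted_anchor_morphism gL rhoL brL C1L C4L C1 F0 K0.
exact: (lifted_jacobi brL).
Qed.
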